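(* Let $0<\vartheta<\pi/2$ and $a>0$. If $R(\vartheta,a)$ is a reptile and $\vartheta/\pi\in\mathbb{Q}$, then the pair $(\vartheta,a)$ equals one of $\left(\frac{\pi}{4},\frac{1}{\sqrt2}\right)$, $\left(\frac{\pi}{3},1\right)$, $\left(\frac{\pi}{3},\frac12\right)$, $\left(\frac{\pi}{3},\frac14\right)$, $\left(\frac{\pi}{3},\frac16\right)$, $\left(\frac{\pi}{3},\frac18\right)$.
   Context: $R(\vartheta,a)$ denotes the right trapezoid (not a parallelogram) whose acute internal angle is $\vartheta$, whose longer leg has length $1$ (so the shorter leg, perpendicular to the bases, has length $\sin\vartheta$), and whose shorter base has length $a$ (so the longer base has length $a+\cos\vartheta$). A planar figure is rep-$n$ if it can be dissected into $n$ similar copies of itself that are congruent to each other (reflected copies are allowed); it is a reptile if it is rep-$n$ for some $n\ge 2$. *)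

(* Defs.v *)
From mathcomp Require Import all_boot all_order all_algebra.
From mathcomp Require Import all_classical all_reals all_analysis.
Set Implicit Arguments.
Unset Strict Implicit.
Unset Printing Implicit Defensive.
Import Order.TTheory GRing.Theory Num.Theory.
Import numFieldNormedType.Exports.

Local Open Scope classical_set_scope.
Local Open Scope ring_scope.

(* The norm of [plane R] is the sup norm; it has the usual open sets, but the
   metric notions below need the Euclidean distance [euclid_dist]. *)
Definition plane (R : realType) : normedModType R := (R^o * R^o)%type.

Definition euclid_dist (R : realType) (p q : plane R) : R :=
  Num.sqrt ((p.1 - q.1) ^+ 2 + (p.2 - q.2) ^+ 2).

(* Similarities may reverse orientation, so reflected copies are allowed. *)
Definition similarity (R : realType) (k : R) (f : plane R -> plane R) : Prop :=
  0 < k /\ forall p q, euclid_dist (f p) (f q) = k * euclid_dist p q.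

Definition similar_sets (R : realType) (A B : set (plane R)) : Prop :=
  exists k f, similarity k f /\ B = f @` A.

Definition congruent_sets (R : realType) (A B : set (plane R)) : Prop :=
  exists f, similarity 1 f /\ B = f @` A.

(* Tiles may share boundary points: only their interiors are disjoint. *)
Definition dissection (R : realType) (I : Type) (A : set (plane R))
    (T : I -> set (plane R)) : Prop :=
  \bigcup_i T i = A /\ trivIset setT (fun i => (T i)°).

Definition rep (R : realType) (n : nat) (A : set (plane R)) : Prop :=
  exists T : 'I_n -> set (plane R),
    [/\ dissection A T,
        forall i, similar_sets A (T i) &
        forall i j, congruent_sets (T i) (T j)].

Definition reptile (R : realType) (A : set (plane R)) : Prop :=
  exists2 n, (2 <= n)%N & rep n A.

Definition convex_hull (R : realType) (V : set (plane R)) : set (plane R) :=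
  smallest (@convex_set R (plane R)) V.

(* R(theta, a), placed with the right angles at (0, 0) and (0, sin theta) and
   the acute angle theta at (a + cos theta, 0). *)
Definition right_trapezoid (R : realType) (theta a : R) : set (plane R) :=
  convex_hull
    [set (0, 0); (a + cos theta, 0); (a, sin theta); (0, sin theta)].

(* Main.v *)
Require Import Defs.
From mathcomp Require Import all_boot all_order all_algebra.
From mathcomp Require Import all_classical all_reals all_analysis.
From mathcomp Require Import ring lra zify complex.
(** Enlarge the dissection until the tiles are copies of [P = R(theta, a)] itself:
    they dissect [N P] for some [N], and [N ^ 2 = n] because the areas agree
    ([dissection_ratio]). Write [s] and [c] for the sine and cosine of [theta].

    Words. Along a line whose lower side is occupied, the tiles above follow one
    another by whole sides, and at each common end the two angles fit into a half
    plane. With the codes 1, 0 and -1 for acute, right and obtuse angles, this says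
    that the codes have a nonnegative sum ([chain_from]). The sides of [N P] are
    such lines ([big_side]). The numbers of sides of each kind on them form a matrix
    with eigenvalue [N]; by a Perron argument [N] is an integer ([ratio_natural]).
    The word of the shorter base then expresses [a] through 1, [s] and [c] with
    nonnegative rational coefficients ([short_base]).

    Strips. Cut [N P] into [N] rows of height [s], and in each row let as many tiles
    as possible fill a strip that starts from one fixed leg. The strip ends on a
    line that is vertical or has the slope of a leg. A free tile with a leg on
    that line, at the end where its angle is acute, would continue the strip;
    so a line that is enclosed at one end carries another side there. Ties between
    consecutive rows are rare by a count of lengths and parities. With the strips
    along the short leg, following the rows upwards one always meets a unit line
    that is exactly covered by a word starting with a side other than a leg
    ([upright_forces]). With those along the long leg, when [c = s] and [a <> c],
    the enclosed line itself is contradictory ([slanted_impossible]).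

    Arithmetic. If [c] is not in [Q + Q s], a word of length 1 contains no long base,
    and the strips along the short leg give a contradiction ([independent_case]).
    Otherwise, as [theta / pi] is rational, conjugation and Niven's theorem give
    [2 c = 1] or [c = s] ([dependent_angle]). When [2 c = 1], the exact word consists
    of at most one long base and of at most three short ones, and its length
    determines [a] ([third_case]). When [c = s], the strips along the long leg force
    [a = c] ([quarter_case]). *)

Set Implicit Arguments.
Unset Strict Implicit.
Unset Printing Implicit Defensive.
Import Order.TTheory GRing.Theory Num.Theory.
Import numFieldNormedType.Exports.
Local Open Scope ring_scope.

(** * Statements valid for all small positive numbers *)

(** Germs at [0+]: a point [x] is inside a tile, along a direction or a curve,
    when this holds for all small positive parameters. These germs stand for all
    neighbourhoods and limits in the local study of the tiles. *)
Definition ev (R : realFieldType) (Q : R -> Prop) : Prop :=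
  exists2 e0 : R, 0 < e0 & forall e, 0 < e -> e < e0 -> Q e.

Section Eventually.
Variable R : realFieldType.
Implicit Types (Q : R -> Prop) (k l m : R).

Lemma ev_always Q : (forall e, 0 < e -> Q e) -> ev Q.
Proof. by move=> h; exists 1 => // e e0 _; exact: h. Qed.

Lemma ev_imp Q Q' : ev Q -> (forall e, 0 < e -> Q e -> Q' e) -> ev Q'.
Proof. by move=> [e0 e00 h] h'; exists e0 => // e e1 e2; apply: h' => //; exact: h. Qed.

Lemma ev_and Q Q' : ev Q -> ev Q' -> ev (fun e => Q e /\ Q' e).
Proof.
move=> [e1 e10 h1] [e2 e20 h2]; exists (Num.min e1 e2).
  by rewrite lt_min e10 e20.
by move=> e e0; rewrite lt_min => /andP[l1 l2]; split; [exact: h1|exact: h2].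
Qed.

Lemma ev_ex Q : ev Q -> exists2 e, 0 < e & Q e.
Proof. by move=> [e0 e00 h]; exists (e0 / 2); [lra|apply: h; lra]. Qed.

Lemma ev_false Q : ev Q -> ev (fun e => ~ Q e) -> False.
Proof. by move=> h h'; have [e _ []] := ev_ex (ev_and h h'). Qed.

Lemma ev_lt k : 0 < k -> ev (fun e => e < k).
Proof. by move=> k0; exists k. Qed.

Lemma ev_allfin n (Q : 'I_n -> R -> Prop) :
  (forall i, ev (Q i)) -> ev (fun e => forall i, Q i e).
Proof.
elim: n Q => [|n IH] Q h; first by apply: ev_always => e _ [].
have h1 := ev_and (h ord_max) (IH (fun i => Q (widen_ord (leqnSn n) i)) (fun i => h _)).
apply: (ev_imp h1) => e _ [q1 q2] i.
case: (ltngtP i n) => [lin|/leq_trans/(_ (ltn_ord i))|ein]; last first.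
- suff -> : i = ord_max by [].
  exact: val_inj.
- by rewrite ltnn.
by have := q2 (Ordinal lin); congr Q; apply: val_inj.
Qed.

Lemma ev_lin k l : 0 < k \/ k = 0 /\ 0 < l -> ev (fun e => 0 < k + l * e).
Proof.
case=> [k0|[-> l0]]; last by apply: ev_always => e e0; rewrite add0r mulr_gt0.
have l1 : 0 < `|l| + 1 by apply: ltr_wpDl => //; exact: normr_ge0.
exists (k / (`|l| + 1)); first exact: divr_gt0.
move=> e e0; rewrite ltr_pdivlMr // => h.
have := ler_norm (- l); rewrite normrN => h'.
have : (- l) * e <= `|l| * e by rewrite ler_pM2r.
nra.
Qed.

Lemma ev_quad_pos k' l' m' : 0 < k' \/ k' = 0 /\ 0 < l' ->
    ev (fun e => 0 < k' + l' * e + m' * e ^+ 2).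
Proof.
case=> [k0|[-> l0]].
  have h1 : ev (fun e : R => 0 < k' / 2 + l' * e) by apply: ev_lin; left; lra.
  have h2 : ev (fun e : R => 0 < k' / 2 + m' * e) by apply: ev_lin; left; lra.
  apply: (ev_imp (ev_and (ev_and h1 h2) (ev_lt ltr01))) => e e0 [[q1 q2] e1].
  have : 0 <= e * (k' / 2 + m' * e) by rewrite mulr_ge0 // ltW.
  have : 0 <= (1 - e) * (k' / 2) by rewrite mulr_ge0 //; lra.
  rewrite expr2; lra.
have h1 : ev (fun e : R => 0 < l' + m' * e) by apply: ev_lin; left; lra.
apply: (ev_imp h1) => e e0 q.
by have := mulr_gt0 e0 q; rewrite expr2; lra.
Qed.

(** The first nonzero coefficient decides. A half-plane is thus entered or left
    only once by a parabola, however close to its origin. *)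
Lemma ev_quad k l m : ev (fun e => 0 <= k + l * e + m * e ^+ 2) \/
  ev (fun e => ~ 0 <= k + l * e + m * e ^+ 2).
Proof.
have pos := ev_quad_pos.
have neg k' l' m' : k' < 0 \/ k' = 0 /\ l' < 0 ->
    ev (fun e => ~ 0 <= k' + l' * e + m' * e ^+ 2).
  move=> h; have := pos (- k') (- l') (- m').
  case; first by case: h => [|[->]]; [left|right; rewrite oppr0; split=> //]; lra.
  by move=> e0 e00 q; exists e0 => // e e1 e2; have := q e e1 e2 => ? ?; lra.
case: (ltgtP k 0) => [k0|k0|->]; first by right; apply: neg; left.
  by left; apply: (ev_imp (pos k l m _)) => [|e _ /ltW //]; left.
case: (ltgtP l 0) => [l0|l0|->]; first by right; apply: neg; right.
  by left; apply: (ev_imp (pos 0 l m _)) => [|e _ /ltW //]; right.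
case: (leP 0 m) => m0; [left|right]; apply: ev_always => e e0.
  by rewrite !add0r mul0r add0r mulr_ge0 // sqr_ge0.
by rewrite mul0r !add0r nmulr_rge0 // => h; have := exprn_gt0 2 e0; lra.
Qed.

(** From the parabola [(e, e ^ 2)] to its tangent: a half-plane that contains a
    germ of the parabola contains the origin and a germ of the axis. *)
Lemma ev_quad_lin k l m : ev (fun e => 0 <= k + l * e + m * e ^+ 2) ->
  0 <= k /\ ev (fun e => 0 <= k + l * e).
Proof.
move=> h.
have hk : 0 <= k.
  rewrite leNgt; apply/negP => k0; apply: (ev_false h).
  have h1 : ev (fun e : R => 0 < - k / 2 + (- l) * e) by apply: ev_lin; left; lra.
  have h2 : ev (fun e : R => 0 < - k / 2 + (- m) * e) by apply: ev_lin; left; lra.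
  apply: (ev_imp (ev_and (ev_and h1 h2) (ev_lt ltr01))) => e e0 [[q1 q2] e1].
  have : 0 <= e * (- k / 2 + - m * e) by rewrite mulr_ge0 // ltW.
  have : 0 <= (1 - e) * (- k / 2) by rewrite mulr_ge0 //; lra.
  rewrite expr2; lra.
split=> //; case: (ltgtP k 0) hk => // [k0|k0] _.
  by apply: (ev_imp (ev_lin (k:=k) (l:=l) _)) => [|e _ /ltW //]; left.
case: (leP 0 l) => l0; first by rewrite k0; apply: ev_always => e e0; rewrite add0r mulr_ge0 // ltW.
exfalso; apply: (ev_false h).
have h1 : ev (fun e : R => 0 < - l + (- m) * e) by apply: ev_lin; left; lra.
apply: (ev_imp h1) => e e0 q; rewrite k0 => q'.
by have := mulr_gt0 e0 q; move: q'; rewrite expr2; lra.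
Qed.

End Eventually.

(** * The trapezoid seen from its sides *)

(** An isometry of the plane: the image of the origin, the unit vector
    [(fp, fq)] along the image of the first axis, and the sign [fe] of the
    determinant. *)
Record frame (R : Type) := Frame { fx : R; fy : R; fp : R; fq : R; fe : R }.

(** [Vert] is the leg that is perpendicular to the bases. *)
Inductive side := Leg | Vert | Short | Long.

(** The boolean is the direction in which the side is followed. *)
Definition edge : Type := side * bool.

Section Frames.
Variable R : realFieldType.
Implicit Types (f : frame R) (x y : R).

Definition px f x y := fx f + fp f * x - fe f * fq f * y.
Definition py f x y := fy f + fq f * x + fe f * fp f * y.

Definition okf f := fp f * fp f + fq f * fq f = 1 /\ fe f * fe f = 1.

Definition shift f x0 := Frame (px f x0 0) (py f x0 0) (fp f) (fq f) (fe f).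

(** The axis of [f] followed backwards from its point of abscissa [l]; the half
    plane above it is the same. *)
Definition turn f l :=
  Frame (px f l 0) (py f l 0) (- fp f) (- fq f) (- fe f).

Lemma okf_shift f x0 : okf f -> okf (shift f x0).
Proof. by []. Qed.

Lemma okf_turn f l : okf f -> okf (turn f l).
Proof. by case: f => ? ? ? ? ? [/= h1 h2]; split => /=; rewrite !mulrNN. Qed.

Lemma px_shift f x0 x y : px (shift f x0) x y = px f (x0 + x) y.
Proof. by rewrite /px /shift /px /=; ring. Qed.

Lemma py_shift f x0 x y : py (shift f x0) x y = py f (x0 + x) y.
Proof. by rewrite /py /shift /py /=; ring. Qed.

Lemma px_turn f l x y : px (turn f l) x y = px f (l - x) y.
Proof. by rewrite /px /turn /px /=; ring. Qed.

Lemma py_turn f l x y : py (turn f l) x y = py f (l - x) y.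
Proof. by rewrite /py /turn /py /=; ring. Qed.

End Frames.

Section Shapes.
Variables (R : realFieldType) (s c a : R).
Hypotheses (s_gt0 : 0 < s) (c_gt0 : 0 < c) (a_gt0 : 0 < a) (sc1 : s * s + c * c = 1).
Implicit Types (f : frame R) (x y : R) (t : edge).

Definition trap x y := [&& 0 <= y, y <= s, 0 <= x & x * s + y * c <= (a + c) * s].
Definition strap x y := [&& 0 < y, y < s, 0 < x & x * s + y * c < (a + c) * s].

Definition slen (k : side) :=
  match k with Leg => 1 | Vert => s | Short => a | Long => a + c end.
Definition len t := slen t.1.

(** The angle at the two ends of a side, coded by 1 (acute), 0 (right) and
    -1 (obtuse): the trapezoid lies between the lines issued from the ends
    with inverse slope [tau * c / s], so that two angles fit on the same side
    of a straight line exactly when their codes have a nonnegative sum. *)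
Definition tau t : int :=
  match t with
  | (Leg, false) => 1 | (Leg, true) => -1
  | (Vert, _) => 0
  | (Short, false) => 0 | (Short, true) => -1
  | (Long, false) => 0 | (Long, true) => 1
  end.
Definition rev t : edge := (t.1, ~~ t.2).

(** In each of these frames the side is on the axis and the trapezoid above. *)
Definition sframe (k : side) : frame R :=
  match k with
  | Long => Frame 0 0 1 0 1
  | Short => Frame 0 s 1 0 (-1)
  | Vert => Frame 0 0 0 1 (-1)
  | Leg => Frame (a + c) 0 (- c) s 1
  end.
Definition eframe t := if t.2 then turn (sframe t.1) (len t) else sframe t.1.

Definition shape t x y := trap (px (eframe t) x y) (py (eframe t) x y).
Definition sshape t x y := strap (px (eframe t) x y) (py (eframe t) x y).

Lemma okf_eframe t : okf (eframe t).
Proof.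
have h : okf (sframe t.1).
  by case: t => -[] b; split => /=; rewrite ?mulrNN ?mulr1 ?mulr0 ?addr0 ?add0r // addrC.
by rewrite /eframe; case: t.2 => //; exact: okf_turn.
Qed.

Lemma revK t : rev (rev t) = t.
Proof. by case: t => k []. Qed.

Lemma len_gt0 t : 0 < len t.
Proof. by case: t => -[] b; rewrite /len /= ?ltr01 ?addr_gt0. Qed.

Lemma shape_rev t x y : shape (rev t) x y = shape t (len t - x) y.
Proof.
rewrite /shape; case: t => k [] /=; rewrite /eframe /= ?px_turn ?py_turn //.
by rewrite /len /=; congr trap; congr px || congr py; ring.
Qed.

Lemma sshape_rev t x y : sshape (rev t) x y = sshape t (len t - x) y.
Proof.
rewrite /sshape; case: t => k [] /=; rewrite /eframe /= ?px_turn ?py_turn //.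
by rewrite /len /=; congr strap; congr px || congr py; ring.
Qed.

(** The trapezoid is convex, so it lies between the lines of the two sides that
    are adjacent to [t]; nothing else of it matters near the line of [t]. *)
Lemma shape_wedge t x y : shape t x y ->
  [/\ 0 <= y, y * ((tau t)%:~R * c) <= x * s &
      y * ((tau (rev t))%:~R * c) <= (len t - x) * s].
Proof.
wlog t2 : t x / t.2 = false.
  move=> h; case e : t.2; last exact: h.
  rewrite -(revK t) shape_rev => /h; rewrite revK /= e => /(_ erefl) [h1 h2 h3].
  by split=> //; rewrite -[X in _ <= X * s](_ : len (rev t) - (len (rev t) - x) = _) //; ring.
case: t t2 => -[] [] //= _; rewrite /shape /trap /eframe /px /py /len /= => /and4P[h1 h2 h3 h4].
- have hy : 0 <= y.
    have : 0 <= (s * s + c * c) * y by move: h4; lra.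
    by rewrite sc1 mul1r.
  by split=> //; rewrite ?mulrN1z ?mulr1z; try lra; nra.
- by split; rewrite ?mulr0z; try lra; nra.
- by split; rewrite ?mulr0z ?mulrN1z; try lra; nra.
- by split; rewrite ?mulr0z ?mulr1z; try lra; nra.
Qed.

(** Below the heights [s] and [a s] no other side is met: there the trapezoid
    fills the wedge of [shape_wedge]. *)
Lemma wedge_sshape t x y : 0 < y -> y < s -> y < a * s ->
  y * ((tau t)%:~R * c) < x * s ->
  y * ((tau (rev t))%:~R * c) < (len t - x) * s -> sshape t x y.
Proof.
wlog t2 : t x / t.2 = false.
  move=> h; case e : t.2; last exact: h.
  move=> y0 ys yas h1 h2; rewrite -(revK t) sshape_rev; apply: h => //; first by rewrite /= e.
  by rewrite revK; have -> : len (rev t) - (len (rev t) - x) = x by ring.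
have s1 : s < 1.
  have c2 := mulr_gt0 c_gt0 c_gt0; rewrite ltNge; apply/negP => h.
  by move: sc1 c2 (ler_pM ler01 ler01 h h) => e1 e2 e3; lra.
case: t t2 => -[] [] //= _; rewrite /sshape /strap /eframe /px /py /len /=
  ?mulrN1z ?mulr1z ?mulr0z => y0 ys yas h1 h2; apply/and4P; split; try by [lra|nra].
- have q2 : c * (y * (- (1) * c)) < c * ((1 - x) * s) by rewrite ltr_pM2l.
  have q3 : y = y * (s * s + c * c) by rewrite sc1 mulr1.
  rewrite -(pmulr_lgt0 _ s_gt0); lra.
- have q3 : y = y * (s * s + c * c) by rewrite sc1 mulr1.
  by lra.
- have xs : x < s by rewrite -subr_gt0 -(pmulr_lgt0 _ s_gt0); lra.
  have ya : y < a by apply: (lt_trans yas); rewrite gtr_pMr.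
  have := ltr_pM2r s_gt0 y a; have := ltr_pM2r c_gt0 x s; rewrite xs ya; lra.
Qed.

Lemma shape_edge t x : 0 <= x -> x <= len t -> shape t x 0.
Proof.
wlog t2 : t x / t.2 = false.
  move=> h; case e : t.2; last exact: h.
  move=> x0 xl; rewrite -(revK t) shape_rev; apply: h; rewrite /len /= ?e //.
    by rewrite subr_ge0.
  by rewrite gerBl.
case: t t2 => -[] [] //= _; rewrite /shape /trap /eframe /px /py /len /= => x0 xl.
- have q1 : 0 <= s * x by rewrite mulr_ge0 // ltW.
  have q2 : c * x <= c * 1 by rewrite ler_pM2l.
  have q3 : s * x <= s * 1 by rewrite ler_pM2l.
  by move: (a_gt0) => ?; apply/and4P; split; lra.
- have q1 : 0 <= a * s by rewrite mulr_ge0 ?ltW.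
  have q2 : x * c <= s * c by rewrite ler_pM2r.
  by apply/and4P; split; lra.
- have q2 : x * s <= a * s by rewrite ler_pM2r.
  by move: (s_gt0) => ?; apply/and4P; split; lra.
- have q2 : x * s <= (a + c) * s by rewrite ler_pM2r.
  by move: (s_gt0) => ?; apply/and4P; split; lra.
Qed.

Lemma shape_of_sshape t x y : sshape t x y -> shape t x y.
Proof. by rewrite /sshape /shape /strap /trap => /and4P[/ltW-> /ltW-> /ltW-> /ltW->]. Qed.

End Shapes.

(** * Tiles *)

Section FrameGroup.
Variable R : realFieldType.
Implicit Types (f g : frame R) (x y : R).

Definition compf g f :=
  Frame (px g (fx f) (fy f)) (py g (fx f) (fy f))
    (fp g * fp f - fe g * fq g * fq f) (fq g * fp f + fe g * fp g * fq f)
    (fe g * fe f).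

Definition invf f :=
  Frame (- (fp f * fx f + fq f * fy f)) (fe f * (fq f * fx f - fp f * fy f))
    (fp f) (- (fe f * fq f)) (fe f).

Lemma okf_comp g f : okf g -> okf f -> okf (compf g f).
Proof.
case: g f => [? ? p q e] [? ? p' q' e'] [/= h1 h2] [/= h3 h4]; split=> /=; last first.
  by rewrite mulrACA h2 h4 mulr1.
rewrite -(mulr1 1) -{1}h1 -h3; ring: h2.
Qed.

Lemma px_comp g f x y : okf g -> px (compf g f) x y = px g (px f x y) (py f x y).
Proof.
case: g f => [? ? p q e] [? ? p' q' e'] [/= h1 h2]; rewrite /compf /invf /px /py /=.
by ring: h2.
Qed.

Lemma py_comp g f x y : okf g -> py (compf g f) x y = py g (px f x y) (py f x y).
Proof.
case: g f => [? ? p q e] [? ? p' q' e'] [/= h1 h2]; rewrite /compf /invf /px /py /=.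
by ring: h2.
Qed.

Lemma okf_inv f : okf f -> okf (invf f).
Proof.
case: f => [? ? p q e] [/= h1 h2]; split=> //=.
by rewrite -h1; ring: h2.
Qed.

Lemma px_inv f x y : okf f -> px f (px (invf f) x y) (py (invf f) x y) = x.
Proof.
case: f => [u v p q e] [/= h1 h2]; rewrite /compf /invf /px /py /=.
have h3 : p * p = 1 - q * q by rewrite -h1 addrK.
by ring: h2 h3.
Qed.

Lemma py_inv f x y : okf f -> py f (px (invf f) x y) (py (invf f) x y) = y.
Proof.
case: f => [u v p q e] [/= h1 h2]; rewrite /compf /invf /px /py /=.
have h3 : p * p = 1 - q * q by rewrite -h1 addrK.
by ring: h2 h3.
Qed.

End FrameGroup.

Section Tiles.
Variables (R : realFieldType) (s c a : R).
Hypotheses (s_gt0 : 0 < s) (c_gt0 : 0 < c) (a_gt0 : 0 < a) (sc1 : s * s + c * c = 1).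
Implicit Types (f g : frame R) (x y : R) (t : edge) (k : side).
Notation trap := (trap s c a).
Notation strap := (strap s c a).
Notation len := (len s c a).
Notation shape := (shape s c a).
Notation sshape := (sshape s c a).
Notation eframe := (eframe s c a).
Notation sframe := (sframe s c a).

(** The distance to the line of the side [k], positive inside. It makes the
    trapezoid an intersection of half-planes in which all sides play the same
    part. *)
Definition height k x y := py (invf (sframe k)) x y.

Lemma okf_sframe k : okf (sframe k).
Proof. exact: (okf_eframe a sc1 (k, false)). Qed.

Lemma trapP x y : trap x y <-> forall k, 0 <= height k x y.
Proof.
rewrite /trap; split=> [/and4P[h1 h2 h3 h4] []|h].
1-4: by rewrite /height /invf /py /=; lra.
by have := (h Leg, h Vert, h Short, h Long); rewrite /height /invf /py /= => -[[[h1 h2] h3] h4];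
  apply/and4P; split; lra.
Qed.

Lemma strapP x y : strap x y <-> forall k, 0 < height k x y.
Proof.
rewrite /strap; split=> [/and4P[h1 h2 h3 h4] []|h].
1-4: by rewrite /height /invf /py /=; lra.
by have := (h Leg, h Vert, h Short, h Long); rewrite /height /invf /py /= => -[[[h1 h2] h3] h4];
  apply/and4P; split; lra.
Qed.

Variables (T S : R -> R -> bool).

(** [T] is a congruent copy of the trapezoid and [S] its interior, as tests on
    the coordinates. *)
Definition tile := exists g, okf g /\ forall x y,
  T x y = trap (px g x y) (py g x y) /\ S x y = strap (px g x y) (py g x y).

Hypothesis T_tile : tile.

(** The side [t] of the tile is on the axis of [f] and starts from its origin,
    with the tile above. *)
Definition placed f t := forall x y,
  T (px f x y) (py f x y) = shape t x y /\ S (px f x y) (py f x y) = sshape t x y.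

Lemma tile_sides f : okf f -> exists h : side -> frame R, (forall k, okf (h k)) /\
  forall x y, (T (px f x y) (py f x y) <-> forall k, 0 <= py (h k) x y) /\
   (S (px f x y) (py f x y) <-> forall k, 0 < py (h k) x y).
Proof.
move=> fo; case: T_tile => g [go hg].
have gfo : okf (compf g f) := okf_comp go fo.
have io k : okf (invf (sframe k)) by apply: okf_inv; exact: okf_sframe.
exists (fun k => compf (invf (sframe k)) (compf g f)); split.
  by move=> k; apply: okf_comp.
move=> x y; have [-> ->] := hg (px f x y) (py f x y).
rewrite -(px_comp f x y go) -(py_comp f x y go); split.
  by rewrite trapP; split=> hh k; have := hh k; rewrite /height (py_comp _ _ _ (io k)).
by rewrite strapP; split=> hh k; have := hh k; rewrite /height (py_comp _ _ _ (io k)).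
Qed.

(** The midpoint of two common points of the tile and the axis cannot be inside
    the tile, which would then reach below the axis. It is therefore on the line
    of a side; the two points are then on this line too, which is the axis. *)
Lemma edge_placed f e0 : okf f -> 0 < e0 ->
  (forall x y, T (px f x y) (py f x y) -> 0 <= y) ->
  T (px f 0 0) (py f 0 0) -> T (px f e0 0) (py f e0 0) ->
  exists t x0, [/\ 0 <= x0, x0 < len t & placed (shift f (- x0)) t].
Proof.
move=> fo e00 half.
case: T_tile => g [go hg].
have gfo : okf (compf g f) := okf_comp go fo.
have io k : okf (invf (sframe k)) by apply: okf_inv; exact: okf_sframe.
pose h k := compf (invf (sframe k)) (compf g f).
have ho k : okf (h k) by apply: okf_comp.
have hT x y : T (px f x y) (py f x y) <-> forall k, 0 <= py (h k) x y.
  have [-> _] := hg (px f x y) (py f x y).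
  rewrite -(px_comp f x y go) -(py_comp f x y go) trapP.
  by split=> hh k; have := hh k; rewrite /height (py_comp _ _ _ (io k)).
move=> T0 T1; have {}T0 := (hT 0 0).1 T0; have {}T1 := (hT e0 0).1 T1.
pose m := e0 / 2.
have [k hk] : exists k, py (h k) m 0 = 0.
  apply: contrapT => hn.
  have pos k : 0 < py (h k) m 0.
    rewrite lt_def; apply/andP; split; first by apply/eqP => e; apply: hn; exists k.
    have := T0 k; have := T1 k; rewrite /py /m; lra.
  have e k : ev (fun e => 0 <= py (h k) m (- e)).
    apply: (ev_imp (ev_lin (k := py (h k) m 0) (l := - (fe (h k) * fp (h k))) (or_introl (pos k)))).
    by move=> e _; rewrite /py; lra.
  have [x x0 [[[e1 e2] e3] e4]] :=
    ev_ex (ev_and (ev_and (ev_and (e Leg) (e Vert)) (e Short)) (e Long)).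
  have : T (px f m (- x)) (py f m (- x)) by apply/hT => -[].
  by move/half; lra.
have qk : fq (h k) = 0 /\ fy (h k) = 0.
  have := T0 k; have := T1 k; have := hk; rewrite /py /m => h1 h2 h3.
  have h4 : fq (h k) * e0 = 0 by lra.
  have h5 : fq (h k) = 0 by move/eqP: h4; rewrite mulf_eq0 (gt_eqF e00) orbF => /eqP.
  by rewrite h5 in h1 *; split=> //; lra.
have [qk0 yk0] := qk.
have pp : fp (h k) * fp (h k) = 1 by have [] := ho k; rewrite qk0; lra.
have eE : fe (h k) * fe (h k) = 1 by have [] := ho k.
have hTk x y : T (px f x y) (py f x y) = shape (k, false) (px (h k) x y) (py (h k) x y) /\
   S (px f x y) (py f x y) = sshape (k, false) (px (h k) x y) (py (h k) x y).
  have [-> ->] := hg (px f x y) (py f x y).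
  rewrite -(px_comp f x y go) -(py_comp f x y go) /shape /sshape /eframe /=.
  by rewrite /h (px_comp _ _ _ (io k)) (py_comp _ _ _ (io k)) px_inv ?py_inv //; exact: okf_sframe.
(* The tile is above the axis, not below: test a point inside it near the side. *)
have ep : fe (h k) * fp (h k) = 1.
  have sq : (fe (h k) * fp (h k)) * (fe (h k) * fp (h k)) = 1 by rewrite mulrACA pp eE mulr1.
  have [y [y0 ys]] : exists y, 0 < y /\ sshape (k, false) (len (k, false) / 2) y.
    have l0 := len_gt0 s_gt0 c_gt0 a_gt0 (k, false).
    have e1 := ev_lin (k := len (k, false) / 2 * s) (l := - ((tau (k, false))%:~R * c)).
    have e2 := ev_lin (k := len (k, false) / 2 * s) (l := - ((tau (rev (k, false)))%:~R * c)).
    have pz : 0 < len (k, false) / 2 * s by rewrite mulr_gt0 ?divr_gt0.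
    have [y y0 [[[h1 h2] h3] h4]] := ev_ex (ev_and (ev_and (ev_and (e1 (or_introl pz))
        (e2 (or_introl pz))) (ev_lt s_gt0)) (ev_lt (mulr_gt0 a_gt0 s_gt0))).
    by exists y; split=> //; apply: wedge_sshape => //; lra.
  have [u [v [eu evv]]] : exists u v, px (h k) u v = len (k, false) / 2 /\ py (h k) u v = y.
    exists (px (invf (h k)) (len (k, false) / 2) y), (py (invf (h k)) (len (k, false) / 2) y).
    by rewrite px_inv // py_inv.
  have Tuv : T (px f u v) (py f u v).
    by have [-> _] := hTk u v; rewrite eu evv; apply: shape_of_sshape.
  have v0 := half _ _ Tuv.
  have vy : fe (h k) * fp (h k) * v = y by rewrite -evv /py qk0 yk0; lra.
  have pos : 0 < fe (h k) * fp (h k).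
    have vp : 0 < v by rewrite lt_def v0 andbT; apply: contraTneq y0 => v00; rewrite -vy v00 mulr0 ltxx.
    by rewrite -(pmulr_lgt0 _ vp) vy.
  nra.
have wedge x : T (px f x 0) (py f x 0) -> 0 <= px (h k) x 0 <= len (k, false).
  have [-> _] := hTk x 0.
  have -> : py (h k) x 0 = 0 by rewrite /py qk0 yk0; ring.
  move=> /(shape_wedge sc1)[_].
  rewrite !mul0r => h1 h2.
  by rewrite -(pmulr_lge0 _ s_gt0) h1 -subr_ge0 -(pmulr_lge0 _ s_gt0) h2.
have w0 := wedge 0 (proj2 (hT 0 0) T0); have w1 := wedge e0 (proj2 (hT e0 0) T1).
have [p1|p1] : fp (h k) = 1 \/ fp (h k) = -1.
  have : (fp (h k) - 1) * (fp (h k) + 1) = 0 by lra.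
  by move/eqP; rewrite mulf_eq0 => /orP[] /eqP ?; [left|right]; lra.
- have e1 : fe (h k) = 1 by move: ep; rewrite p1; lra.
  exists (k, false), (fx (h k)).
  move: w0 w1; rewrite /px p1 qk0 => /andP[h1 h2] /andP[h3 h4]; split; try lra.
  move=> x y; rewrite px_shift py_shift; have [-> ->] := hTk (- fx (h k) + x) y.
  have -> : px (h k) (- fx (h k) + x) y = x by rewrite /px p1 qk0; ring.
  by have -> : py (h k) (- fx (h k) + x) y = y by rewrite /py p1 qk0 e1 yk0; ring.
- have e1 : fe (h k) = -1 by move: ep; rewrite p1; lra.
  exists (k, true), (len (k, true) - fx (h k)).
  move: w0 w1; rewrite /px p1 qk0 /len /= => /andP[h1 h2] /andP[h3 h4]; split; try lra.
  move=> x y; rewrite px_shift py_shift.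
  have [-> ->] := hTk (- (len (k, true) - fx (h k)) + x) y.
  rewrite -(revK (k, true)) shape_rev sshape_rev /=.
  have -> : px (h k) (- (len (k, true) - fx (h k)) + x) y = len (rev (k, true)) - x.
    by rewrite /px p1 qk0 /len /=; ring.
  by have -> : py (h k) (- (len (k, true) - fx (h k)) + x) y = y by rewrite /py p1 qk0 e1 yk0; ring.
Qed.

End Tiles.

(** * Chains of sides along a straight front *)

(** [admissible z w] : the word [w] of sides can follow an angle of code [- z]
    on one side of a line; [final z w] is the opposite of the code of its last
    angle. *)
Fixpoint admissible (z : int) (w : seq edge) : bool :=
  if w is t :: w' then (z <= tau t) && admissible (- tau (rev t)) w' else true.
Fixpoint final (z : int) (w : seq edge) : int :=
  if w is t :: w' then final (- tau (rev t)) w' else z.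

Section Chain.
Variables (R : archiRealFieldType) (s c a : R).
Hypotheses (s_gt0 : 0 < s) (c_gt0 : 0 < c) (a_gt0 : 0 < a) (sc1 : s * s + c * c = 1).
Implicit Types (f g : frame R) (x y : R) (t : edge) (w : seq edge).
Notation len := (len s c a).
Notation shape := (shape s c a).
Notation sshape := (sshape s c a).

Definition wlen w := \sum_(t <- w) len t.

Variables (n : nat) (T S : 'I_n -> R -> R -> bool).
Hypothesis tiles : forall i, tile s c a (T i) (S i).
Hypothesis disj : forall i j x y, S i x y -> T j x y -> i = j.
Notation placed i f t := (placed s c a (T i) (S i) f t).

Lemma S_T i x y : S i x y -> T i x y.
Proof.
have [g [_ h]] := tiles i; have [-> ->] := h x y.
by rewrite /strap /trap => /and4P[/ltW-> /ltW-> /ltW-> /ltW->].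
Qed.

Lemma placed_S i f t x y : placed i f t ->
  0 < y -> y < s -> y < a * s -> y * ((tau t)%:~R * c) < x * s ->
  y * ((tau (rev t))%:~R * c) < (len t - x) * s -> S i (px f x y) (py f x y).
Proof. by move=> h *; have [_ ->] := h x y; apply: wedge_sshape. Qed.

Lemma placed_wedge i f t x y : placed i f t -> T i (px f x y) (py f x y) ->
  [/\ 0 <= y, y * ((tau t)%:~R * c) <= x * s &
      y * ((tau (rev t))%:~R * c) <= (len t - x) * s].
Proof. by move=> h; have [-> _] := h x y; apply: shape_wedge. Qed.

Lemma placed_rev i f t : placed i f t -> placed i (turn f (len t)) (rev t).
Proof. by move=> h x y; rewrite px_turn py_turn shape_rev sshape_rev; exact: h. Qed.

Lemma placed_start i f t vx vy : placed i f t -> 0 < vy ->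
  vy * ((tau t)%:~R * c) < vx * s -> ev (fun e => S i (px f (e * vx) (e * vy)) (py f (e * vx) (e * vy))).
Proof.
move=> h vy0 hv.
have l0 := len_gt0 s_gt0 c_gt0 a_gt0 t.
have e1 : ev (fun e => 0 < s + (- vy) * e) by apply: ev_lin; left.
have e2 : ev (fun e => 0 < a * s + (- vy) * e) by apply: ev_lin; left; rewrite mulr_gt0.
have e3 : ev (fun e => 0 < len t * s + (- (vx * s + vy * ((tau (rev t))%:~R * c))) * e).
  by apply: ev_lin; left; rewrite mulr_gt0.
apply: (ev_imp (ev_and (ev_and e1 e2) e3)) => e e0 [[q1 q2] q3].
apply: (placed_S h); rewrite ?mulr_gt0 //; try lra.
by have := ltr_pM2l e0 (vy * ((tau t)%:~R * c)) (vx * s); rewrite hv; lra.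
Qed.

Lemma placed_inside i f t x0 vx vy : placed i f t -> 0 < x0 -> x0 < len t -> 0 < vy ->
  ev (fun e => S i (px f (x0 + e * vx) (e * vy)) (py f (x0 + e * vx) (e * vy))).
Proof.
move=> h x00 x0l vy0.
have e1 : ev (fun e => 0 < s + (- vy) * e) by apply: ev_lin; left.
have e2 : ev (fun e => 0 < a * s + (- vy) * e) by apply: ev_lin; left; rewrite mulr_gt0.
have e3 : ev (fun e => 0 < (len t - x0) * s + (- (vx * s + vy * ((tau (rev t))%:~R * c))) * e).
  by apply: ev_lin; left; rewrite mulr_gt0 ?subr_gt0.
have e4 : ev (fun e => 0 < x0 * s + (vx * s - vy * ((tau t)%:~R * c)) * e).
  by apply: ev_lin; left; rewrite mulr_gt0 ?subr_gt0.
apply: (ev_imp (ev_and (ev_and (ev_and e1 e2) e3) e4)) => e e0 [[[q1 q2] q3] q4].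
by apply: (placed_S h); rewrite ?mulr_gt0 //; lra.
Qed.

(** At the point where the side [t] starts or passes, another tile already takes
    all the directions of inverse slope less than [z c / s]. The side cannot pass
    through that point, for it would take a half-disc there, and the angle of
    [t] must leave these directions free. *)
Lemma corner i f t x0 (z : R) : placed i (shift f (- x0)) t -> 0 <= x0 -> x0 < len t ->
  (forall vx vy, 0 < vy -> vx * s < vy * (z * c) ->
     ev (fun e => ~ S i (px f (e * vx) (e * vy)) (py f (e * vx) (e * vy)))) ->
  x0 = 0 /\ z <= (tau t)%:~R.
Proof.
move=> h x00 x0l hS.
have sh x y : (px (shift f (- x0)) (x0 + x) y = px f x y) *
    (py (shift f (- x0)) (x0 + x) y = py f x y).
  by rewrite px_shift py_shift addKr.
have x0E : x0 = 0.
  apply/eqP/negPn/negP => xn; have x0p : 0 < x0 by rewrite lt_def xn x00.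
  have hv : (z * c - 1) / s * s < 1 * (z * c) by rewrite divfK ?gt_eqF //; lra.
  have h1 := placed_inside ((z * c - 1) / s) h x0p x0l ltr01.
  apply: (ev_false h1); apply: (ev_imp (hS _ _ ltr01 hv)) => e e0.
  by rewrite !sh.
split=> //; rewrite leNgt; apply/negP => hz.
rewrite x0E oppr0 in h sh.
pose vx := (((tau t)%:~R + z) / 2 * c) / s.
have vs : vx * s = ((tau t)%:~R + z) / 2 * c by rewrite /vx divfK ?gt_eqF.
have tz : (tau t)%:~R * c < z * c by rewrite ltr_pM2r.
have h1 := placed_start (vx := vx) (vy := 1) h ltr01.
rewrite vs mul1r in h1.
have {}h1 := h1 ltac:(lra).
apply: (ev_false h1).
have hv : vx * s < 1 * (z * c) by rewrite vs; lra.
apply: (ev_imp (hS _ _ ltr01 hv)) => e e0.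
by have [e1 e2] := sh (e * vx) (e * 1); rewrite add0r in e1 e2; rewrite e1 e2.
Qed.

(** The dead points are those outside the figure or in tiles that are already
    known; the free tiles are the others. *)
Variables (Dead : R -> R -> Prop) (free : 'I_n -> Prop).
Hypothesis free_dead : forall i x y, free i -> S i x y -> ~ Dead x y.
Hypothesis dead_cover : forall x y, ~ Dead x y -> exists2 i, free i & T i x y.

Definition deadf f x y := Dead (px f x y) (py f x y).

(** Each tile contains or avoids a whole germ of the parabola [(e, e ^ 2)] by
    [ev_quad], and there are finitely many tiles. *)
Lemma germ_tile f : okf f -> ev (fun e => ~ deadf f e (e ^+ 2)) ->
  exists2 i, free i & ev (fun e => T i (px f e (e ^+ 2)) (py f e (e ^+ 2))).
Proof.
move=> fo hd; apply: contrapT => hn.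
have h i : ev (fun e => ~ (free i /\ T i (px f e (e ^+ 2)) (py f e (e ^+ 2)))).
  case: (EM (free i)) => fi; last by apply: ev_always => e _ [].
  have [h [_ hT]] := tile_sides sc1 (tiles i) fo.
  have dic k : ev (fun e => 0 <= py (h k) e (e ^+ 2)) \/ ev (fun e => ~ 0 <= py (h k) e (e ^+ 2)).
    exact: (ev_quad (fy (h k)) (fq (h k)) (fe (h k) * fp (h k))).
  case: (EM (forall k, ev (fun e => 0 <= py (h k) e (e ^+ 2)))) => [ha|/existsNP [k hk]].
    exfalso; apply: hn; exists i => //.
    apply: (ev_imp (ev_and (ev_and (ha Leg) (ha Vert)) (ev_and (ha Short) (ha Long)))).
    by move=> e e0 [[h1 h2] [h3 h4]]; apply/(proj1 (hT _ _)) => -[].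
  have {hk} : ev (fun e => ~ 0 <= py (h k) e (e ^+ 2)) by case: (dic k).
  by move=> hk; apply: (ev_imp hk) => e e0 h1 [_ /(proj1 (hT _ _))]; apply: contra_not h1.
have [e e0 [nd hi]] := ev_ex (ev_and hd (ev_allfin h)).
by have [i fi Ti] := dead_cover nd; apply: (hi i).
Qed.

(** The tile that contains a germ of the parabola contains a germ of its tangent,
    the axis. If it had a point below the axis, it would by convexity contain
    interior points just below it, which are dead. So [edge_placed] applies. *)
Lemma first_tile f x1 : okf f -> ev (fun e => ~ deadf f e (e ^+ 2)) -> 0 < x1 ->
  (forall x, 0 < x -> x < x1 -> ev (fun e => deadf f x (- e))) ->
  exists i t x0, [/\ free i, 0 <= x0, x0 < len t & placed i (shift f (- x0)) t].
Proof.
move=> fo hd x10 hb.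
have [i fi hi] := germ_tile fo hd.
have [h [ho hT]] := tile_sides sc1 (tiles i) fo.
have T0 : T i (px f 0 0) (py f 0 0).
  apply/(proj1 (hT _ _)) => k.
  have : ev (fun e => 0 <= fy (h k) + fq (h k) * e + (fe (h k) * fp (h k)) * e ^+ 2).
    by apply: (ev_imp hi) => e e0 /(proj1 (hT _ _))/(_ k).
  by case/ev_quad_lin => h0 _; rewrite /py; lra.
have Tl : ev (fun e => T i (px f e 0) (py f e 0)).
  have hk k : ev (fun e => 0 <= py (h k) e 0).
    have : ev (fun e => 0 <= fy (h k) + fq (h k) * e + (fe (h k) * fp (h k)) * e ^+ 2).
      by apply: (ev_imp hi) => e e0 /(proj1 (hT _ _))/(_ k).
    by case/ev_quad_lin => _ h1; apply: (ev_imp h1) => e _; rewrite /py; lra.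
  apply: (ev_imp (ev_and (ev_and (hk Leg) (hk Vert)) (ev_and (hk Short) (hk Long)))).
  by move=> e e0 [[h1 h2] [h3 h4]]; apply/(proj1 (hT _ _)) => -[].
have [e0 e00 he0] := Tl.
suff half x y : T i (px f x y) (py f x y) -> 0 <= y.
  have [//||t [x0 [? ? ?]]] := edge_placed s_gt0 c_gt0 a_gt0 sc1 (tiles i) fo (_ : 0 < e0 / 2) half T0.
  - by lra.
  - by apply: he0; lra.
  by exists i, t, x0.
move=> Tq; rewrite leNgt; apply/negP => y0.
pose m := Num.min e0 x1 / 2.
have [m0 me mx] : [/\ 0 < m, m < e0 & m < x1].
  have : 0 < Num.min e0 x1 by rewrite lt_min e00 x10.
  have h1 : Num.min e0 x1 <= e0 by rewrite ge_min lexx.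
  have h2 : Num.min e0 x1 <= x1 by rewrite ge_min lexx orbT.
  by rewrite /m => h0; split; lra.
pose e1 := (m + e0) / 2.
have T1 : T i (px f e1 0) (py f e1 0) by apply: he0; rewrite /e1; lra.
have Tm : T i (px f m 0) (py f m 0) by apply: he0.
have hk k : ev (fun e => 0 < py (h k) m (- e)).
  have k0 := (proj1 (hT _ _)).1 T0 k; have k1 := (proj1 (hT _ _)).1 T1 k.
  have km := (proj1 (hT _ _)).1 Tm k; have kq := (proj1 (hT _ _)).1 Tq k.
  have e2 : ev (fun e => 0 < py (h k) m 0 + (- (fe (h k) * fp (h k))) * e).
    apply: ev_lin; case: (ltgtP (py (h k) m 0) 0) km => // [? _|km _]; [by left|right].
    split=> //; move: k0 k1 km kq; rewrite /py => k0 k1 km kq.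
    have me1 : 0 < e1 - m by rewrite /e1; lra.
    have q1 : 0 <= fq (h k) * (e1 - m) by lra.
    rewrite (pmulr_lge0 _ me1) in q1.
    have q2 : 0 <= fq (h k) * m by rewrite mulr_ge0 // ltW.
    have q3 : fq (h k) * m = 0 by lra.
    have q4 : fq (h k) = 0 by move/eqP: q3; rewrite mulf_eq0 (gt_eqF m0) orbF => /eqP.
    have q5 : fy (h k) = 0 by rewrite q4 in km; lra.
    have q6 : 0 <= (- (fe (h k) * fp (h k))) * (- y) by move: kq; rewrite q4 q5; lra.
    rewrite pmulr_lge0 ?oppr_gt0 // in q6.
    rewrite lt_def q6 andbT oppr_eq0.
    have [p1 p2] := ho k; apply/eqP => z.
    have : (fe (h k) * fp (h k)) * (fe (h k) * fp (h k)) = 1.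
      by rewrite mulrACA p2; move: p1; rewrite q4; lra.
    by rewrite z; lra.
  by apply: (ev_imp e2) => e _; rewrite /py; lra.
have [e e'0 [[[h1 h2] [h3 h4]] d]] := ev_ex (ev_and (ev_and (ev_and (hk Leg) (hk Vert))
    (ev_and (hk Short) (hk Long))) (hb m m0 mx)).
apply: (@free_dead i _ _ fi _ d).
by apply/(proj2 (hT _ _)) => -[].
Qed.

(** Between the abscissas 0 and [l] of the axis the points just below are dead
    and those just above are not; the latter are approached along parabolas, which
    also settle the ends of the interval. *)
Definition front f l :=
  (forall x, 0 <= x -> x < l -> ev (fun e => ~ deadf f (x + e) (e ^+ 2))) /\
  (forall x, 0 < x -> x < l -> ev (fun e => deadf f x (- e))).

(** A free tile that lies above the axis of [f] and covers a half-disc around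
    the point of abscissa [l] of this axis. *)
Definition crosses f l i := [/\ free i,
  (forall x y, T i (px f x y) (py f x y) -> 0 <= y) &
  forall vx vy, 0 < vy -> ev (fun e => S i (px f (l + e * vx) (e * vy)) (py f (l + e * vx) (e * vy)))].

Lemma front_shift f l x : 0 <= x -> front f l -> front (shift f x) (l - x).
Proof.
move=> x0 [h1 h2]; split=> y y0 yl.
  have := h1 (x + y); rewrite addr_ge0 // -ltrBrDl => /(_ isT yl) h.
  by apply: (ev_imp h) => e e0; rewrite /deadf px_shift py_shift addrA.
have := h2 (x + y); rewrite ltr_wpDl // -ltrBrDl => /(_ isT yl) h.
by apply: (ev_imp h) => e e0; rewrite /deadf px_shift py_shift.
Qed.

Lemma front_first f l : okf f -> 0 < l -> front f l ->
  exists i t x0, [/\ free i, 0 <= x0, x0 < len t & placed i (shift f (- x0)) t].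
Proof.
move=> fo l0 [h1 h2]; apply: (first_tile fo _ l0 h2).
by apply: (ev_imp (h1 0 (lexx 0) l0)) => e e0; rewrite add0r.
Qed.

(** Each tile with a side on the axis is followed, at the end of this side, by
    another one, whose angle fits beside the last angle of the former by
    [corner]. Lengths are bounded below, so [l] is reached after finitely many
    steps, and exactly, since a side that passes [l] is excluded. *)
Lemma chain_from f l i t : 0 < l -> okf f -> front f l -> free i -> placed i f t ->
  (forall j, ~ crosses f l j) ->
  exists w i' t', [/\ admissible (- tau (rev t)) w, len t + wlen w = l, free i',
    placed i' (turn f l) t' & tau t' = - final (- tau (rev t)) w].
Proof.
move=> l0 fo; pose mn := Num.min (Num.min 1 s) a.
have mn0 : 0 < mn by rewrite !lt_min ltr01 s_gt0 a_gt0.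
have mnl u : mn <= len u.
  have h1 : mn <= 1 by rewrite !ge_min lexx.
  have h2 : mn <= s by rewrite !ge_min lexx orbT.
  have h3 : mn <= a by rewrite !ge_min lexx orbT.
  by move: (c_gt0) => ?; case: u => -[] b; rewrite /len /=; lra.
have [k hk] : exists k : nat, l < k%:R * mn.
  exists (Num.bound `|l / mn|); rewrite -ltr_pdivrMr //.
  exact: (le_lt_trans (ler_norm _) (archi_boundP (normr_ge0 _))).
elim: k f l i t l0 hk fo => [|k IH] f l i t l0 hk fo fr fi pl nc.
  by move: hk; rewrite mul0r ltNge (ltW l0).
case: (ltgtP (len t) l) => [ltl|lgt|<-]; last first.
- by exists [::], i, (rev t); rewrite /wlen big_nil addr0; split=> //; [exact: placed_rev|rewrite opprK].
- exfalso; apply: (nc i); split=> //.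
    by move=> x y /(placed_wedge pl)[].
  by move=> vx vy vy0; apply: (placed_inside _ pl).
have l1 : 0 < l - len t by rewrite subr_gt0.
have ff := front_shift (ltW (len_gt0 s_gt0 c_gt0 a_gt0 t)) fr.
have [i' [t' [x0 [fi' x00 x0l pl']]]] := front_first (okf_shift (len t) fo) l1 ff.
have ne : i <> i'.
  move=> ii'; rewrite -ii' in pl'.
  pose d := len t' - x0; have d0 : 0 < d by rewrite subr_gt0.
  have : T i (px f (len t + d / 2) 0) (py f (len t + d / 2) 0).
    have [hT _] := pl' (x0 + d / 2) 0; move: hT; rewrite !px_shift !py_shift.
    have -> : len t + (- x0 + (x0 + d / 2)) = len t + d / 2 by ring.
    move=> ->; apply: shape_edge; rewrite // /d; lra.
  move/(placed_wedge pl) => [_ _]; rewrite mul0r.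
  have -> : len t - (len t + d / 2) = - (d / 2) by ring.
  by rewrite mulNr oppr_ge0 leNgt mulr_gt0 ?divr_gt0.
have [] := corner (z := (- tau (rev t))%:~R) pl' x00 x0l.
  move=> vx vy vy0 hv.
  have h1 := placed_start (vx := - vx) (placed_rev pl) vy0.
  have {}h1 := h1 ltac:(rewrite rmorphN in hv; lra).
  apply: (ev_imp h1) => e e0 h2 h3; apply: ne; apply: disj (S_T h3).
  move: h2; rewrite px_turn py_turn px_shift py_shift.
  by have -> : len t - e * - vx = len t + e * vx by ring.
move=> x0E htau; rewrite x0E in pl'.
have {}pl' : placed i' (shift f (len t)) t'.
  by move=> x y; have := pl' x y; rewrite !px_shift !py_shift oppr0 add0r.
have [||w [j [u [h1 h2 h3 h4 h5]]]] := IH _ _ _ _ l1 _ (okf_shift (len t) fo) ff fi' pl' _.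
- have := mnl t; rewrite -natr1 mulrDl mul1r in hk; lra.
- move=> m [fm hm1 hm2]; apply: (nc m); split=> //.
    move=> x y; have := hm1 (x - len t) y; rewrite px_shift py_shift.
    by have -> : len t + (x - len t) = x by ring.
  move=> vx vy vy0; apply: (ev_imp (hm2 vx vy vy0)) => e e0.
  rewrite px_shift py_shift.
  by have -> : len t + (l - len t + e * vx) = l + e * vx by ring.
exists (t' :: w), j, u; split=> //=.
- by rewrite h1 andbT -(ler_int R).
- by rewrite /wlen big_cons -/(wlen w) h2; ring.
- move=> x y; have := h4 x y; rewrite !px_turn !py_turn !px_shift !py_shift.
  by have -> : len t + (l - len t - x) = l - x by ring.
Qed.

End Chain.

Section Closed.
Variables (R : archiRealFieldType) (s c a : R).
Hypotheses (s_gt0 : 0 < s) (c_gt0 : 0 < c) (a_gt0 : 0 < a) (sc1 : s * s + c * c = 1).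
Implicit Types (f g : frame R) (x y : R) (t : edge) (w : seq edge).
Notation len := (len s c a).
Notation wlen := (wlen s c a).
Variables (n : nat) (T S : 'I_n -> R -> R -> bool).
Hypothesis tiles : forall i, tile s c a (T i) (S i).
Hypothesis disj : forall i j x y, S i x y -> T j x y -> i = j.
Notation placed i f t := (placed s c a (T i) (S i) f t).
Variables (Dead : R -> R -> Prop) (free : 'I_n -> Prop).
Hypothesis free_dead : forall i x y, free i -> S i x y -> ~ Dead x y.
Hypothesis dead_cover : forall x y, ~ Dead x y -> exists2 i, free i & T i x y.
Notation deadf := (deadf Dead).
Notation front := (front Dead).
Notation crosses := (crosses T S free).

(** At the origin of [f], the directions beyond the angle of code [z] are dead;
    they enclose a tile that starts there. *)
Definition opening f (z : R) := forall vx vy, 0 < vy -> vx * s < vy * (z * c) ->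
  ev (fun e => deadf f (e * vx) (e * vy)).

Lemma open_corner f t x0 i z : free i -> placed i (shift f (- x0)) t -> 0 <= x0 -> x0 < len t ->
  opening f z -> x0 = 0 /\ z <= (tau t)%:~R.
Proof.
move=> fi pl x00 x0l hz; apply: (corner s_gt0 c_gt0 a_gt0 sc1 pl x00 x0l).
move=> vx vy vy0 hv; apply: (ev_imp (hz vx vy vy0 hv)) => e _ d sI.
exact: (free_dead fi sI d).
Qed.

Lemma start_tile f l z : okf f -> 0 < l -> front f l -> opening f z ->
  exists i t, [/\ free i, placed i f t & z <= (tau t)%:~R].
Proof.
move=> fo l0 fr op.
have [i [t [x0 [fi x00 x0l pl]]]] := front_first s_gt0 c_gt0 a_gt0 sc1 tiles free_dead dead_cover fo l0 fr.
have [x0E hz] := open_corner fi pl x00 x0l op.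
exists i, t; split=> // x y; have := pl x y.
by rewrite x0E px_shift py_shift oppr0 add0r.
Qed.

Lemma opening_nocross f l z : opening (turn f l) z -> forall j, ~ crosses f l j.
Proof.
move=> op j [fj _ h].
have hv : (z * c - 1) / s * s < 1 * (z * c) by rewrite divfK ?gt_eqF //; lra.
have := ev_and (op _ _ ltr01 hv) (h (- ((z * c - 1) / s)) 1 ltr01).
case/ev_ex => e e0 [d sI]; apply: (free_dead fj sI).
move: d; rewrite /deadf px_turn py_turn.
by have -> : l - e * ((z * c - 1) / s) = l + e * - ((z * c - 1) / s) by ring.
Qed.

(** Seen from the other end, the dead directions beyond [l] exclude a tile that
    passes it and bound the angle of the last one. *)
Lemma closed_chain f l i t z : 0 < l -> okf f -> front f l -> free i -> placed i f t ->
  opening (turn f l) z%:~R ->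
  exists w, [/\ admissible (- tau (rev t)) w, len t + wlen w = l &
    z <= - final (- tau (rev t)) w].
Proof.
move=> l0 fo fr fi pl op.
have [w [j [u [h1 h2 h3 h4 h5]]]] := chain_from s_gt0 c_gt0 a_gt0 sc1 tiles disj free_dead dead_cover
   l0 fo fr fi pl (opening_nocross op).
exists w; split=> //; rewrite -h5 -(ler_int R).
have pl' : placed j (shift (turn f l) (- 0)) u.
  by move=> x y; rewrite px_shift py_shift oppr0 add0r.
by have [] := open_corner h3 pl' (lexx 0) (len_gt0 s_gt0 c_gt0 a_gt0 u) op.
Qed.

Lemma closed_word f l z z' : 0 < l -> okf f -> front f l ->
  opening f z%:~R -> opening (turn f l) z'%:~R ->
  exists w, [/\ admissible z w, wlen w = l & z' <= - final z w].
Proof.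
move=> l0 fo fr op op'.
have [i [t [fi pl zt]]] := start_tile fo l0 fr op.
have [w [h1 h2 h3]] := closed_chain l0 fo fr fi pl op'.
exists (t :: w); split=> //=; last by rewrite /wlen big_cons.
by rewrite h1 andbT -(ler_int R).
Qed.

End Closed.

(** * The sides of a large trapezoid dissected into unit copies *)

Section Big.
Variables (R : archiRealFieldType) (s c a : R).
Hypotheses (s_gt0 : 0 < s) (c_gt0 : 0 < c) (a_gt0 : 0 < a) (sc1 : s * s + c * c = 1).
Implicit Types (f g : frame R) (x y : R) (t : edge) (w : seq edge).
Notation len := (len s c a).
Notation wlen := (wlen s c a).
Notation shape := (shape s c a).
Variables (n : nat) (T S : 'I_n -> R -> R -> bool).
Hypothesis tiles : forall i, tile s c a (T i) (S i).
Hypothesis disj : forall i j x y, S i x y -> T j x y -> i = j.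
Variable N : R.
Hypothesis N_gt0 : 0 < N.
Hypothesis cover : forall x y, trap s c a (x / N) (y / N) <-> exists i, T i x y.

(** All points outside the large trapezoid are dead. Each of its sides is thus a
    front, with dead directions at its two ends that have the codes of its own
    angles. *)
Lemma big_side t : exists w,
  [/\ admissible (tau t) w, wlen w = N * len t & tau (rev t) <= - final (tau t) w].
Proof.
pose E := eframe s c a t.
pose F := Frame (N * fx E) (N * fy E) (fp E) (fq E) (fe E).
have Nn : N != 0 by rewrite gt_eqF.
pose Dead x y := ~ trap s c a (x / N) (y / N).
have FE x y : trap s c a (px F x y / N) (py F x y / N) = shape t (x / N) (y / N).
  by rewrite /shape -/E; congr trap; rewrite /px /py /=; field.
have Eo : okf E by exact: (okf_eframe a sc1 t).
have l0 := len_gt0 s_gt0 c_gt0 a_gt0 t.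
have wedge x y : trap s c a (px F x y / N) (py F x y / N) ->
  [/\ 0 <= y, y * ((tau t)%:~R * c) <= x * s &
      y * ((tau (rev t))%:~R * c) <= (N * len t - x) * s].
  rewrite FE => /(shape_wedge sc1)[h1 h2 h3]; split.
  - by rewrite -(pmulr_lge0 y (_ : 0 < N^-1)) ?invr_gt0.
  - rewrite -(ler_pM2r (_ : 0 < N^-1)) ?invr_gt0 //; lra.
  - rewrite -(ler_pM2r (_ : 0 < N^-1)) ?invr_gt0 //.
    have -> : (N * len t - x) * s / N = (len t - x / N) * s by field.
    by lra.
have fd (i : 'I_n) x y : True -> S i x y -> ~ Dead x y.
  by move=> _ h; apply; apply/cover; exists i; exact: (S_T tiles).
have dc x y : ~ Dead x y -> exists2 i : 'I_n, True & T i x y.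
  by move=> /contrapT h; have [i Ti] := (cover x y).1 h; exists i.
have tb (u : edge) : - 1 <= (tau u)%:~R :> R /\ (tau u)%:~R <= 1 :> R.
  by case: u => -[] []; rewrite ?mulrN1z ?mulr1z ?mulr0z; lra.
apply: (closed_word s_gt0 c_gt0 a_gt0 sc1 tiles disj fd dc (f := F)) => //.
- by rewrite mulr_gt0.
- split=> x x0 xl; last first.
    by apply: ev_always => e e0; rewrite /deadf /Dead => /wedge[]; lra.
  have e1 : ev (fun e => 0 < s * N + (- 1) * e) by apply: ev_lin; left; rewrite mulr_gt0.
  have e2 : ev (fun e => 0 < a * s * N + (- 1) * e) by apply: ev_lin; left; rewrite !mulr_gt0.
  have e3 : ev (fun e => 0 < s + (- c) * e) by apply: ev_lin; left.
  have e4 : ev (fun e => 0 < (N * len t - x) * s + (- (s + c)) * e).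
    by apply: ev_lin; left; rewrite mulr_gt0 ?subr_gt0.
  apply: (ev_imp (ev_and (ev_and (ev_and e1 e2) (ev_and e3 e4)) (ev_lt ltr01))).
  move=> e e0 [[[q1 q2] [q3 q4]] q5]; rewrite /deadf /Dead => h; apply: h; rewrite FE.
  have ee : e ^+ 2 < e by rewrite expr2 gtr_pMr.
  have ep : 0 < e ^+ 2 by rewrite exprn_gt0.
  have Ni : 0 < N^-1 by rewrite invr_gt0.
  apply: shape_of_sshape; apply: wedge_sshape => //.
  + by rewrite mulr_gt0.
  + by rewrite ltr_pdivrMr //; lra.
  + by rewrite ltr_pdivrMr //; lra.
  + rewrite -(ltr_pM2r N_gt0).
    have -> : e ^+ 2 / N * ((tau t)%:~R * c) * N = e ^+ 2 * c * (tau t)%:~R by field.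
    have -> : (x + e) / N * s * N = (x + e) * s by field.
    have [_ t1] := tb t.
    have h1 : e ^+ 2 * c * (tau t)%:~R <= e ^+ 2 * c * 1 by rewrite ler_pM2l // mulr_gt0.
    have h2 : 0 < e * (s + (- c) * e) by rewrite mulr_gt0.
    have h3 : 0 <= x * s by rewrite mulr_ge0 // ltW.
    by move: h1 h2; rewrite expr2; lra.
  + rewrite -(ltr_pM2r N_gt0).
    have -> : e ^+ 2 / N * ((tau (rev t))%:~R * c) * N = e ^+ 2 * c * (tau (rev t))%:~R by field.
    have -> : (len t - (x + e) / N) * s * N = (N * len t - (x + e)) * s by field.
    have [_ t1] := tb (rev t).
    have h1 : e ^+ 2 * c * (tau (rev t))%:~R <= e ^+ 2 * c * 1 by rewrite ler_pM2l // mulr_gt0.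
    have h2 : e ^+ 2 * c < e * c by rewrite ltr_pM2r.
    by lra.
- move=> vx vy vy0 hv; apply: ev_always => e e0; rewrite /deadf /Dead => /wedge[_ h _].
  by have := ltr_pM2l e0 (vx * s) (vy * ((tau t)%:~R * c)); rewrite hv; lra.
- move=> vx vy vy0 hv; apply: ev_always => e e0; rewrite /deadf /Dead px_turn py_turn => /wedge[_ _ h].
  have h1 : e * (vx * s) < e * (vy * ((tau (rev t))%:~R * c)) by rewrite ltr_pM2l.
  by lra.
Qed.

End Big.

(** * The similarity ratio is an integer *)

Definition is_side (k : side) (t : edge) : bool :=
  match k, t.1 with
  | Leg, Leg | Vert, Vert | Short, Short | Long, Long => true
  | _, _ => false
  end.
Definition cnt (k : side) (w : seq edge) : nat := count (is_side k) w.

Lemma wlenE (R : archiRealFieldType) (s c a : R) w : wlen s c a w =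
  (cnt Leg w)%:R + (cnt Vert w)%:R * s + (cnt Short w)%:R * a + (cnt Long w)%:R * (a + c).
Proof.
rewrite /wlen /cnt; elim: w => [|[k b] w IH]; first by rewrite big_nil /=; ring.
by rewrite big_cons IH /len; case: k => /=; rewrite ?natrD ?add0n; ring.
Qed.

Section Words.
Implicit Types (w : seq edge) (z : int).

(** Only an acute angle fits beside an obtuse one. Without long bases it belongs
    to a leg, whose other end is obtuse again. *)
Lemma noLong_acute w : cnt Long w = 0%N -> admissible 1 w -> final 1 w = 1.
Proof.
elim: w => // -[[] []] w IH //=; rewrite /cnt /= ?add0n ?addSn //.
Qed.

Lemma noLong_right w : cnt Long w = 0%N -> admissible 0 w -> final 0 w <= 0 ->
  all (is_side Vert) w.
Proof.
elim: w => // -[[] []] w IH //=; rewrite /cnt /= ?add0n ?addSn //.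
- by move=> h h2; rewrite noLong_acute.
- by move=> h h2; rewrite noLong_acute.
Qed.

End Words.

(** Split the characteristic polynomial, which has integer coefficients, into its
    even and odd parts: its value at [N] is [e + o N] with integers [e] and [o].
    It vanishes with [N] irrational, so [o = 0], and its value at [- N] is the
    same. *)
Lemma conjugate_eigenvector (R : archiRealFieldType) m (A : 'M[int]_m) (n : nat) (N : R) (v : 'cV[R]_m) :
  N ^+ 2 = n%:R -> (forall x y : int, y != 0 -> N * y%:~R != x%:~R) ->
  v != 0 -> map_mx intr A *m v = N *: v ->
  exists2 v' : 'cV[R]_m, v' != 0 & map_mx intr A *m v' = - N *: v'.
Proof.
move=> Nn irr vn Av.
pose g : 'M[R]_m := (map_mx intr A)^T.
have ev1 : eigenvalue g N.
  apply/eigenvalueP; exists v^T; last by apply: contra_neq vn => h; rewrite -(trmxK v) h trmx0.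
  by rewrite -trmx_mul Av linearZ.
suff : eigenvalue g (- N).
  move/eigenvalueP => [u hu un]; exists u^T; first by apply: contra_neq un => h; rewrite -(trmxK u) h trmx0.
  by rewrite -[map_mx _ _]trmxK -trmx_mul hu linearZ.
move: ev1; rewrite !eigenvalue_root_char.
have -> : char_poly g = map_poly intr (char_poly A^T).
  by rewrite map_char_poly /g map_trmx.
set p := char_poly A^T; pose q : {poly R} := map_poly intr p.
rewrite -/q /root => /eqP h.
have qE x : q.[x] = (even_poly q).[x ^+ 2] + (odd_poly q).[x ^+ 2] * x.
  by rewrite -{1}(poly_even_odd q) hornerD hornerM !horner_comp hornerX hornerXn.
have int_even (r : {poly int}) : exists z : int, (map_poly intr r).[n%:R] = z%:~R :> R.
  exists r.[n%:R]; rewrite -(horner_map (intr : {rmorphism int -> R})) /=.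
  by rewrite rmorph_nat.
have [e He] : exists z : int, (even_poly q).[n%:R] = z%:~R.
  have -> : even_poly q = map_poly intr (even_poly p); last exact: int_even.
  by apply/polyP => i; rewrite coef_even_poly !coef_map /= coef_even_poly.
have [z Hz] : exists z : int, (odd_poly q).[n%:R] = z%:~R.
  have -> : odd_poly q = map_poly intr (odd_poly p); last exact: int_even.
  by apply/polyP => i; rewrite coef_odd_poly !coef_map /= coef_odd_poly.
rewrite qE sqrrN Nn He Hz; move: h; rewrite qE Nn He Hz => h.
have z0 : z = 0.
  apply/eqP/negPn/negP => on; have /negP := irr (- e) z on; apply.
  by rewrite rmorphN /= eq_sym -subr_eq0; apply/eqP; move: h; lra.
by move: h; rewrite z0 !mul0r => ->.
Qed.

Lemma rat_sqrt_nat (R : archiRealFieldType) (n : nat) (N : R) (x y : int) :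
  0 < N -> N ^+ 2 = n%:R -> y != 0 -> N * y%:~R = x%:~R -> exists M : nat, N = M%:R.
Proof.
move=> N0 Nn y0 h.
have e : (n * `|y| ^ 2 = `|x| ^ 2)%N.
  apply/eqP; rewrite -(eqr_nat R) natrM !natrX -Nn -exprMn !natr_absz !intr_norm.
  by rewrite -(ger0_norm (ltW N0)) -normrM h.
have dv : (`|y| %| `|x|)%N by rewrite -(dvdn_pexp2r _ _ (isT : (0 < 2)%N)) -e dvdn_mull.
exists (`|x| %/ `|y|)%N.
have yn : (`|y|%N)%:R != 0 :> R by rewrite pnatr_eq0 absz_eq0.
apply: (mulIf yn); rewrite -natrM divnK // !natr_absz !intr_norm.
by rewrite -{1}(ger0_norm (ltW N0)) -normrM h.
Qed.

Section Integral.
Variables (R : archiRealFieldType) (s c a N : R).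
Hypotheses (s_gt0 : 0 < s) (c_gt0 : 0 < c) (a_gt0 : 0 < a) (N_gt1 : 1 < N).
Hypothesis sides : forall t, exists w,
  [/\ admissible (tau t) w, wlen s c a w = N * len s c a t & tau (rev t) <= - final (tau t) w].

Let N_gt0 : 0 < N := lt_trans ltr01 N_gt1.

Lemma side_nonempty t w : wlen s c a w = N * len s c a t -> w <> [::].
Proof.
move=> + w0; rewrite w0 /wlen big_nil => /eqP; rewrite eq_sym gt_eqF //.
by rewrite mulr_gt0 // len_gt0.
Qed.

(** The shorter base is not covered by shorter bases alone: the obtuse end of
    one must be followed by an acute angle. *)
Lemma short_side : exists x y z w : nat,
  N * a = x%:R + y%:R * s + z%:R * a + w%:R * (a + c) /\ (0 < x + y + w)%N.
Proof.
have [w [h1 h2 h3]] := sides (Short, false).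
exists (cnt Leg w), (cnt Vert w), (cnt Short w), (cnt Long w); split.
  by rewrite -wlenE h2.
have := side_nonempty h2; case: w h1 h2 h3 => // -[[] []] w //= h1 h2 h3 _;
  rewrite /cnt /= ?add1n ?addnS ?addSn //.
case: w h1 h2 h3 => [|[[] []] w] //= _ h2 _; rewrite ?addnS ?addSn //.
move: h2; rewrite /wlen big_cons big_nil addr0 /len /= => /eqP.
by rewrite -{1}(mul1r a) -subr_eq0 -mulrBl mulf_eq0 subr_eq0 (lt_eqF N_gt1) gt_eqF.
Qed.

(** The words that [sides] gives for the four sides define a matrix of counts that
    multiplies the vector of lengths by [N]. If [N] were irrational, some vector
    [u] would be multiplied by [- N]. Take the set [I] of the sides for which
    [|u|] is largest in proportion to the length: equality must hold in the
    triangle inequality, so the word of a side in [I] contains only sides of [I],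
    where [u] has the opposite sign, and in particular not the side itself. The
    word of the long base contains a long base, that of the leg a leg or a long
    base, that of the short leg one of these or a short leg; this excludes them
    from [I] in turn. The word of the short base is then empty, which is absurd. *)
Lemma ratio_natural n : N ^+ 2 = n%:R -> exists M : nat, N = M%:R.
Proof.
move=> Nn; case: (EM (exists x y : int, y != 0 /\ N * y%:~R = x%:~R)) => [[x [y [yn h]]]|irr].
  exact: rat_sqrt_nat N_gt0 Nn yn h.
exfalso.
pose sd (i : 'I_4) : side := nth Leg [:: Leg; Vert; Short; Long] i.
have good k : exists w : seq edge,
    [/\ cnt Leg w = 0%N -> cnt Vert w = 0%N -> cnt Short w = 0%N ->
          cnt Long w = 0%N -> False,
      wlen s c a w = N * slen s c a k
      & match k with
        | Long => cnt Long w <> 0%N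
        | Leg => cnt Leg w = 0%N -> cnt Long w <> 0%N
        | Vert => ~ (cnt Leg w = 0%N /\ cnt Long w = 0%N /\ cnt Vert w = 0%N)
        | Short => True end].
  have ne w t : wlen s c a w = N * len s c a t -> cnt Leg w = 0%N -> cnt Vert w = 0%N ->
      cnt Short w = 0%N -> cnt Long w = 0%N -> False.
    move=> h h1 h2 h3 h4; move: h; rewrite wlenE h1 h2 h3 h4 => /eqP.
    rewrite eq_sym gt_eqF //; have := mulr_gt0 N_gt0 (len_gt0 s_gt0 c_gt0 a_gt0 t).
    by lra.
  case: k.
  - have [w [h1 h2 h3]] := sides (Leg, false); exists w; split=> //; first exact: ne h2.
    by move=> l0 l1; have := side_nonempty h2; case: w h1 h2 h3 l0 l1 => // -[[] []] w.
  - have [w [h1 h2 h3]] := sides (Vert, false); exists w; split=> //; first exact: ne h2.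
    move=> [l0 [l1 l2]]; have := side_nonempty h2; have := h3; have := h1; rewrite /= => h1' h3' _.
    have : all (is_side Vert) w by apply: noLong_right => //; rewrite -oppr_ge0.
    rewrite all_count -[count _ _]/(cnt Vert w) l2 => /eqP/esym/size0nil w0.
    by have := side_nonempty h2; rewrite w0.
  - have [w [h1 h2 h3]] := sides (Short, false); exists w; split=> //; exact: ne h2.
  - have [w [h1 h2 h3]] := sides (Long, true); exists w; split=> //; first exact: ne h2.
    by move=> l0; move: h3; rewrite /= (noLong_acute l0 h1).
have [word hw] := choice good.
pose A : 'M[int]_4 := \matrix_(i, j) (cnt (sd j) (word (sd i)))%:Z.
pose v : 'cV[R]_4 := \col_i slen s c a (sd i).
have AE (u : 'cV[R]_4) i : (map_mx intr A *m u) i 0 =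
    \sum_(j < 4) (cnt (sd j) (word (sd i)))%:R * u j 0.
  by rewrite mxE; apply: eq_bigr => j _; rewrite !mxE.
have sp k : 0 < slen s c a k := len_gt0 s_gt0 c_gt0 a_gt0 (k, false).
have Av : map_mx intr A *m v = N *: v.
  apply/colP => i; rewrite AE !mxE; have [_ <- _] := hw (sd i).
  by rewrite wlenE !big_ord_recl big_ord0 !mxE /=; ring.
have vn : v != 0.
  by apply/eqP => /matrixP/(_ 0 0); rewrite !mxE => /eqP; rewrite gt_eqF.
have irr' (x y : int) : y != 0 -> N * y%:~R != x%:~R.
  by move=> yn; apply/eqP => h; apply: irr; exists x, y.
have [u un Au] := conjugate_eigenvector Nn irr' vn Av.
pose r i := `|u i 0| / slen s c a (sd i).
have [k hk] : exists k, forall j, r j <= r k.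
  by exists [arg max_(i > (0 : 'I_4)) r i]%O; case: arg_maxP => // i _ h j; apply: h.
have rk0 : 0 < r k.
  have rk : 0 <= r k by rewrite /r divr_ge0 // ltW.
  rewrite lt_def rk andbT; apply: contra_neq un => r0.
  apply/colP => j; rewrite mxE; have := hk j; rewrite r0 /r pmulr_lle0 ?invr_gt0 //.
  by rewrite normr_le0 => /eqP.
pose I i := r i = r k.
have key i j : I i -> cnt (sd j) (word (sd i)) != 0%N -> i != j /\ I j.
  move=> Ii cn; pose sg : R := if 0 <= u i 0 then 1 else -1.
  have ui : u i 0 = sg * (r k * slen s c a (sd i)).
    rewrite -Ii /r divfK ?gt_eqF // /sg; case: leP => h; first by rewrite mul1r ger0_norm.
    by rewrite ltr0_norm // mulN1r opprK.
  have sg2 : sg * sg = 1 by rewrite /sg; case: ifP => _; lra.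
  have terms j' : 0 <= (cnt (sd j') (word (sd i)))%:R * (r k * slen s c a (sd j') + sg * u j' 0).
    rewrite mulr_ge0 ?ler0n //.
    have := hk j'; rewrite {1}/r ler_pdivrMr // => h1.
    have : - `|u j' 0| <= sg * u j' 0.
      by rewrite /sg; case: ifP => _; rewrite ?mul1r ?mulN1r ?lerN2 ?ler_norm // lerNl -normrN ler_norm.
    by lra.
  have tot : \sum_(j' < 4) (cnt (sd j') (word (sd i)))%:R * (r k * slen s c a (sd j') + sg * u j' 0) = 0.
    have e1 : \sum_(j' < 4) (cnt (sd j') (word (sd i)))%:R * slen s c a (sd j') = N * slen s c a (sd i).
      by have := AE v i; rewrite Av !mxE => ->; apply: eq_bigr => j' _; rewrite mxE.
    have e2 : \sum_(j' < 4) (cnt (sd j') (word (sd i)))%:R * u j' 0 = - N * u i 0.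
      by rewrite -AE Au mxE.
    transitivity (r k * (N * slen s c a (sd i)) + sg * (- N * u i 0)); last first.
      rewrite ui; transitivity ((1 - sg * sg) * (r k * (N * slen s c a (sd i)))); first by ring.
      by rewrite sg2 subrr mul0r.
    by rewrite -e1 -e2 !mulr_sumr -big_split; apply: eq_bigr => j' _ /=; ring.
  have := psumr_eq0P (fun j' _ => terms j') tot => /(_ j isT)/eqP.
  rewrite mulf_eq0 pnatr_eq0 (negbTE cn) /= addr_eq0 => /eqP h.
  have uj : u j 0 = - sg * (r k * slen s c a (sd j)).
    by rewrite h mulNr mulrN opprK mulrA sg2 mul1r.
  split.
    apply/eqP => ij; have := ui; rewrite ij uj => h2.
    have X0 := mulr_gt0 rk0 (sp (sd j)); set X := r k * _ in h2 X0.
    have e1 : sg * (sg * X) = X by rewrite mulrA sg2 mul1r.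
    have e2 : sg * (- sg * X) = - X by rewrite mulNr mulrN mulrA sg2 mul1r.
    by move: e2; rewrite h2 e1; lra.
  have sg1 : `|sg| = 1 by rewrite /sg; case: ifP; rewrite ?normrN normr1.
  have pos : 0 < r k * slen s c a (sd j) by rewrite mulr_gt0.
  rewrite /I {1}/r uj normrM normrN sg1 (gtr0_norm pos).
  by rewrite mul1r mulfK // gt_eqF.
pose row (j : nat) (h : (j < 4)%N) : 'I_4 := Ordinal h.
pose iLeg := @row 0%N isT; pose iVert := @row 1%N isT; pose iShort := @row 2%N isT; pose iLong := @row 3%N isT.
have nLong : ~ I iLong.
  by move=> hI; have [_ _ /eqP h2] := hw Long; have [/eqP] := key _ iLong hI h2.
have nLeg : ~ I iLeg.
  move=> h; have [_ _ h2] := hw Leg.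
  have [z|z] := eqVneq (cnt Leg (word Leg)) 0%N; last by have [/eqP] := key _ iLeg h z.
  by move/eqP: (h2 z) => h3; have [_ /nLong] := key _ iLong h h3.
have nVert : ~ I iVert.
  move=> h; have [_ _ []] := hw Vert; split; [|split]; apply/eqP/negPn/negP => z.
  - by have [_ /nLeg] := key _ iLeg h z.
  - by have [_ /nLong] := key _ iLong h z.
  - by have [/eqP] := key _ iVert h z.
have nShort : ~ I iShort.
  move=> h; have [hn _ _] := hw Short; apply: hn; apply/eqP/negPn/negP => z.
  - by have [_ /nLeg] := key _ iLeg h z.
  - by have [_ /nVert] := key _ iVert h z.
  - by have [/eqP] := key _ iShort h z.
  - by have [_ /nLong] := key _ iLong h z.
have Ik : I k by [].
have : [\/ k = iLeg, k = iVert, k = iShort | k = iLong].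
  case: (k) => -[|[|[|[|]]]] // hk'; [by apply: Or41; apply: val_inj|by apply: Or42; apply: val_inj|
    by apply: Or43; apply: val_inj|by apply: Or44; apply: val_inj].
by case=> e; rewrite e in Ik.
Qed.

End Integral.

(** * Strips of tiles along a leg *)

(** Possible slopes [d] and [d'] of the lines of two rows that meet, with [m] and
    [m'] tiles; the parity of the number of tiles decides which lines lean. *)
Section Slopes.
Variables (d d' : int) (m m' : nat).
Hypotheses (hd : [\/ d = -1, d = 0 | d = 1]) (hd' : [\/ d' = -1, d' = 0 | d' = 1]).

Lemma opposite_slopes : (d == 0) = (odd m == false) -> (d' == 0) = (odd m' == false) ->
  m%:Z - m'%:Z != 0 -> `|m%:Z - m'%:Z| < `|0 - d - d'| -> d' + d == 0.
Proof. by case: hd => ->; case: hd' => -> /=; clear; lia. Qed.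

Lemma extreme_slopes : 2 - d - d' = 0 -> d' = d /\ d != 0.
Proof. by case: hd => ->; case: hd' => -> /=; clear; lia. Qed.

Lemma equal_slopes : (d == 0) = (odd m == true) -> (d' == 0) = (odd m' == true) ->
  m%:Z - m'%:Z != 0 -> `|m%:Z - m'%:Z| < `|2 - d - d'| ->
  (m%:Z - m'%:Z = 1 -> 2 - d - d' = 3 -> False) -> 0 < m%:Z - m'%:Z -> d' = d /\ d != 0.
Proof. by case: hd => ->; case: hd' => -> /=; clear; lia. Qed.

End Slopes.

Section Strips.
Variables (R : archiRealFieldType) (s c a : R).
Hypotheses (s_gt0 : 0 < s) (c_gt0 : 0 < c) (a_gt0 : 0 < a) (sc1 : s * s + c * c = 1).
Implicit Types (f g : frame R) (x y r : R) (t : edge) (j m : nat) (d : int).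
Variables (n : nat) (T S : 'I_n -> R -> R -> bool).
Hypothesis tiles : forall i, tile s c a (T i) (S i).
Hypothesis disj : forall (i i' : 'I_n) x y, S i x y -> T i' x y -> i = i'.
Notation placed i f t := (placed s c a (T i) (S i) f t).
Variables (kap : bool) (M : nat).
Hypothesis M_gt1 : (1 < M)%N.
Let k : R := kap%:R.
Let W : R := M%:R * (a + c).
Let b : R := 2 * a + c.

(** The large trapezoid: for [kap = false] its short leg is on the vertical
    axis, for [kap = true] it is reflected and its long leg starts from the
    origin. *)
Definition big (kap : bool) (M : nat) (x y : R) := [&& 0 <= y, y <= M%:R * s, kap%:R * y * c <= x * s &
  x * s + (1 - kap%:R) * y * c <= M%:R * (a + c) * s].
Hypothesis cover : forall x y, big kap M x y <-> exists i, T i x y.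

Definition region j r d x y := [&& j%:R * s <= y, y <= j.+1%:R * s,
  k * y * c <= x * s & (x - r) * s <= d%:~R * c * (y - j%:R * s)].

(** The tiles selected by [J] fill the [j]th row, of height [s], from the wall
    to a line that starts from the point [(r, j s)] with inverse slope
    [d c / s]; [m] is their number, read off the length of the strip. *)
Definition strip j m r d (J : 'I_n -> Prop) :=
  [/\ [/\ -1 <= d, d <= 1, (d == 0) = (odd m == kap) & m = 0%N -> d = kap],
    2 * (r - k * j%:R * c) = m%:R * b + k * c - d%:~R * c,
    (forall i x y, J i -> T i x y -> region j r d x y) &
    (forall x y, region j r d x y -> k * y * c < x * s -> exists2 i, J i & T i x y)].

Lemma kE : k = 0 /\ kap = false \/ k = 1 /\ kap = true.
Proof. by rewrite /k; case: kap; [right|left]. Qed.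

Lemma dE d : -1 <= d -> d <= 1 -> [\/ d = -1, d = 0 | d = 1].
Proof.
move=> h1 h2; have : d = -1 \/ d = 0 \/ d = 1 by lia.
by case=> [|[]] ->; [exact: Or31|exact: Or32|exact: Or33].
Qed.

Lemma strip0 j : strip j 0 (k * j%:R * c) kap (fun _ => False).
Proof.
split=> //.
- by split=> //; case: kap.
- by rewrite /k; case: kap => /=; rewrite ?mulr1z ?mulr0z subrr !(mul0r, mulr0, mul1r) add0r subrr.
move=> x y /and4P[_ _ _ h] h'; exfalso; move: h h'; rewrite /k.
by case: kap => /=; rewrite ?mulr1z ?mulr0z ?mulr1n ?mulr0n; lra.
Qed.

Let b_gtc : c < b. Proof. by move: (a_gt0); rewrite /b; lra. Qed.

Lemma jsE j : j.+1%:R * s = j%:R * s + s.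
Proof. by rewrite -natr1; ring. Qed.

Lemma strip_margin j m r d J : strip j m r d J -> (0 < m)%N ->
  k * j%:R * c < r /\ k * j.+1%:R * c < r + d%:~R * c.
Proof.
move=> [[h1 h2 h3 _] h5 _ _] m0.
have m1 : 1 <= m%:R :> R by rewrite (ler_nat _ 1).
have q1 : b <= m%:R * b by rewrite ler_peMl //; move: b_gtc (c_gt0); lra.
rewrite -natr1; move: b_gtc (c_gt0) => g1 g2.
have [hd|hd] : (d%:~R = -1 :> R /\ d = -1) \/ (0 <= d%:~R :> R /\ (d%:~R <= 1 :> R)).
  by case: (dE h1 h2) => ->; [left|right|right]; rewrite ?mulrN1z ?mulr0z ?mulr1z //; lra.
- have [d1 d2] := hd; rewrite d1 in h5 *.
  have [[k0 kf]|[k1 kt]] := kE; first by rewrite k0 in h5 *; split; lra.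
  have m2 : 2 <= m%:R :> R.
    by rewrite (ler_nat _ 2); move: h3 m0; rewrite kt d2; case: (m) => [|[|]].
  have q2 : 2 * b <= m%:R * b by rewrite ler_pM2r //; lra.
  by rewrite k1 in h5 *; split; lra.
- have [d0 d1'] := hd; have q3 : 0 <= d%:~R * c by rewrite mulr_ge0 // ltW.
  have q4 : d%:~R * c <= 1 * c by rewrite ler_pM2r.
  have [[k0 kf]|[k1 kt]] := kE; [rewrite k0 in h5 *|rewrite k1 in h5 *]; split; lra.
Qed.

Lemma strip_in_big j m r d J : (j < M)%N -> strip j m r d J ->
  [/\ r <= W - (1 - k) * j%:R * c, r + d%:~R * c <= W - (1 - k) * j.+1%:R * c,
      k * j%:R * c <= r & k * j.+1%:R * c <= r + d%:~R * c].
Proof.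
move=> jM st; have [[h1 h2 h3 h4] h5 h6 h7] := st.
have jM' : j.+1%:R <= M%:R :> R by rewrite ler_nat.
have Mc : j.+1%:R * c <= M%:R * c by rewrite ler_pM2r.
have j0 : 0 <= j%:R * c by rewrite mulr_ge0 // ltW.
have Ma : 0 <= M%:R * a by rewrite mulr_ge0 // ltW.
rewrite -natr1 in Mc *; move: (c_gt0) (a_gt0) => cp ap.
have [m0|mp] := posnP m.
  have dk : d%:~R = k by rewrite (h4 m0) /k; case: kap; rewrite ?mulr1z ?mulr0z.
  move: h5; rewrite m0 mul0r dk /W.
  by have [[-> _]|[-> _]] := kE => h5; split; lra.
have [w1 w2] := strip_margin st mp; rewrite -natr1 in w2.
have reg1 : region j r d r (j%:R * s).
  rewrite /region jsE !subrr mul0r mulr0 !lexx /=; apply/and3P; split=> //.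
    by move: (s_gt0); lra.
  by have := ltr_pM2r s_gt0 (k * j%:R * c) r; rewrite w1; lra.
have reg2 : region j r d (r + d%:~R * c) (j.+1%:R * s).
  rewrite /region jsE; apply/and4P; split; rewrite ?lexx //; [by move: (s_gt0); lra| |lra].
  by have := ltr_pM2r s_gt0 (k * (j%:R + 1) * c) (r + d%:~R * c); rewrite w2; lra.
have [i1 _ T1] := h7 _ _ reg1 ltac:(have := ltr_pM2r s_gt0 (k * j%:R * c) r; rewrite w1; lra).
have [i2 _ T2] := h7 _ _ reg2 ltac:(rewrite jsE; have := ltr_pM2r s_gt0 (k * (j%:R + 1) * c) (r + d%:~R * c); rewrite w2; lra).
have /cover/and4P[_ _ _ B1] : exists i, T i r (j%:R * s) by exists i1.
have /cover/and4P[_ _ _ B2] : exists i, T i (r + d%:~R * c) (j.+1%:R * s) by exists i2.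
rewrite -/k jsE in B1 B2; split; try lra.
- by rewrite -(ler_pM2r s_gt0) /W; lra.
- by rewrite -(ler_pM2r s_gt0) /W; lra.
Qed.

(** A row has room for finitely many tiles, and the empty strip is a strip. *)
Lemma strip_max : exists (m : nat -> nat) (r : nat -> R) (d : nat -> int) (J : nat -> 'I_n -> Prop),
  forall j, (j < M)%N -> strip j (m j) (r j) (d j) (J j) /\
    forall m' r' d' J', strip j m' r' d' J' -> (m' <= m j)%N.
Proof.
have h j : exists p : nat * R * int * ('I_n -> Prop), (j < M)%N ->
    strip j p.1.1.1 p.1.1.2 p.1.2 p.2 /\
    forall m' r' d' J', strip j m' r' d' J' -> (m' <= p.1.1.1)%N.
  case: (ltnP j M) => jM; last by exists (0%N, 0, 0, fun _ => False).
  pose P m := `[< exists r d J, strip j m r d J >].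
  have eP : exists m, P m.
    by exists 0%N; apply/asboolP; exists (k * j%:R * c), kap%:Z, (fun _ => False); exact: strip0.
  have [u hu] : exists u : nat, (2 * W + c) / b < u%:R.
    exists (Num.bound `|(2 * W + c) / b|).
    exact: (le_lt_trans (ler_norm _) (archi_boundP (normr_ge0 _))).
  have b0 : 0 < b by exact: lt_trans c_gt0 b_gtc.
  have bP m : P m -> (m <= u)%N.
    move=> /asboolP [r [d [J st]]].
    have [h1 _ h2 _] := strip_in_big jM st; have [[_ d1 _ _] h5 _ _] := st.
    rewrite -(ler_nat R) ltW //; apply: le_lt_trans hu; rewrite ler_pdivlMr //.
    have d1' : d%:~R <= 1 :> R by rewrite -(ler_int R) in d1.
    have d2 : d%:~R * c <= 1 * c by rewrite ler_pM2r.
    have j0 : 0 <= j%:R * c by rewrite mulr_ge0 // ltW.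
    by move: h1 h2 h5 (c_gt0); have [[-> _]|[-> _]] := kE; lra.
  case: (ex_maxnP eP bP) => m /asboolP [r [d [J st]]] mx.
  exists (m, r, d, J) => _; split=> //= m' r' d' J' st'.
  by apply: mx; apply/asboolP; exists r', d', J'.
have [F hF] := choice h.
by exists (fun j => (F j).1.1.1), (fun j => (F j).1.1.2), (fun j => (F j).1.2), (fun j => (F j).2).
Qed.

(** ** The front of a maximal family of strips *)

Variables (m : nat -> nat) (r : nat -> R) (d : nat -> int) (J : nat -> 'I_n -> Prop).
Hypothesis st : forall j, (j < M)%N -> strip j (m j) (r j) (d j) (J j).
Hypothesis mx : forall j, (j < M)%N -> forall m' r' d' J', strip j m' r' d' J' -> (m' <= m j)%N.

Definition top j := r j + (d j)%:~R * c.
(** From here on the strips are the known tiles, and the others are free. *)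
Definition Dead x y := ~ big kap M x y \/ exists2 j, (j < M)%N & region j (r j) (d j) x y.
Definition free i := forall j, (j < M)%N -> ~ J j i.

(** A point of the wall is not inside a tile, which would reach beyond the wall.
    Any other point of a strip is in one of its tiles. *)
Lemma strips_dead i x y : free i -> S i x y -> ~ Dead x y.
Proof.
move=> fi Si; have Ti := S_T tiles Si.
case=> [h|[j jM hj]]; first by apply: h; apply/cover; exists i.
have [_ _ _ h7] := st jM.
have [h|h] := ltP (k * y * c) (x * s).
  have [i' Ji' Ti'] := h7 _ _ hj h; apply: (fi j jM).
  by rewrite (disj Si Ti').
pose f := Frame x y 1 0 (1 : R).
have fo : okf f by split=> /=; ring.
have [h' [ho hT]] := tile_sides sc1 (tiles i) fo.
have S0 : S i (px f 0 0) (py f 0 0).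
  have -> : px f 0 0 = x by rewrite /px /=; ring.
  by have -> : py f 0 0 = y by rewrite /py /=; ring.
have hk q : ev (fun e => 0 <= py (h' q) (- e) 0).
  have q0 := (proj2 (hT _ _)).1 S0 q.
  have := ev_lin (k := py (h' q) 0 0) (l := - fq (h' q)) (or_introl q0).
  by move=> hh; apply: (ev_imp hh) => e _; rewrite /py; lra.
have [e e0 [[h1 h2] [h3 h4]]] := ev_ex (ev_and (ev_and (hk Leg) (hk Vert)) (ev_and (hk Short) (hk Long))).
have /cover/and4P[_ _ B1 _] : exists i, T i (px f (- e) 0) (py f (- e) 0).
  by exists i; apply/(proj1 (hT _ _)) => -[].
have es := mulr_gt0 e0 s_gt0.
by move: B1; rewrite -/k /px /py /=; lra.
Qed.

Lemma strips_cover x y : ~ Dead x y -> exists2 i, free i & T i x y.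
Proof.
move=> nd; have [i Ti] : exists i, T i x y.
  by apply/cover; apply: contrapT => h; apply: nd; left.
exists i => // j jM Ji; apply: nd; right; exists j => //.
by have [_ _ h6 _] := st jM; exact: h6 Ji Ti.
Qed.

(** The line that bounds a strip is followed upwards, with the strip below it in
    the sense of frames: [hh] is the vertical component of its direction and
    [elen] its length in one row. *)
Definition hh (d : int) : R := if d == 0 then 1 else s.
Definition elen (d : int) : R := if d == 0 then s else 1.

Definition up j := Frame (r j) (j%:R * s) ((d j)%:~R * c) (hh (d j)) (-1).

(** The lines that bound the strips [l], ..., [j] are aligned. *)
Definition run l j := [/\ (l <= j)%N, (j < M)%N &
  forall i, (l <= i < j)%N -> d i.+1 = d i /\ r i.+1 = top i].

Definition rlen l j : R := (j - l).+1%:R * elen (d l).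

Lemma dP j : (j < M)%N -> [\/ d j = -1, d j = 0 | d j = 1].
Proof. by move=> /st [[h1 h2 _ _] _ _ _]; exact: dE. Qed.

Lemma hhE j : (j < M)%N -> [/\ 0 < hh (d j), hh (d j) * elen (d j) = s,
  0 < elen (d j) & (d j)%:~R * c * ((d j)%:~R * c) + hh (d j) * hh (d j) = 1] /\
  (d j)%:~R * elen (d j) = (d j)%:~R :> R /\
  0 < hh (d j) * s + (d j)%:~R * c * ((d j)%:~R * c).
Proof.
move=> jM; have ss := mulr_gt0 s_gt0 s_gt0; have cc := mulr_gt0 c_gt0 c_gt0.
by case: (dP jM) => ->; rewrite /hh /elen /= ?mulrN1z ?mulr0z ?mulr1z; move: (sc1) (s_gt0); split; try split; lra.
Qed.

Lemma up_ok j : (j < M)%N -> okf (up j).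
Proof. by move=> jM; have [[_ _ _ h] _] := hhE jM; split=> //=; ring. Qed.

Lemma runE l j i : run l j -> (l <= i <= j)%N ->
  d i = d l /\ r i = r l + (i - l)%:R * ((d l)%:~R * c).
Proof.
move=> [lj jM h]; elim: i => [|i IH] /andP[li ij].
  by have -> : l = 0%N by [lia]; rewrite subnn mul0r addr0.
have [->|ne] := eqVneq l i.+1; first by rewrite subnn mul0r addr0.
have li' : (l <= i)%N by lia.
have [e1 e2] := IH ltac:(lia); have [e3 e4] := h i ltac:(lia).
by rewrite e3 e1 e4 /top e1 e2 subSn // -natr1; split=> //; ring.
Qed.

(** The scaled distance to the line that bounds the strip [l], positive outside. *)
Definition right_of l x y := (x - r l) * s - (d l)%:~R * c * (y - l%:R * s).

Lemma right_of_up l x y : (l < M)%N -> right_of l (px (up l) x y) (py (up l) x y) =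
  y * (hh (d l) * s + (d l)%:~R * c * ((d l)%:~R * c)).
Proof.
move=> lM; rewrite /right_of /px /py /=.
by case: (dP lM) => ->; rewrite /hh /= ?mulrN1z ?mulr0z ?mulr1z; ring.
Qed.

Lemma run_region l j i x y : run l j -> (l <= i <= j)%N ->
  ((x - r i) * s <= (d i)%:~R * c * (y - i%:R * s)) = (right_of l x y <= 0).
Proof.
move=> rn lij; have [-> ->] := runE rn lij; rewrite /right_of -[RHS]subr_ge0 sub0r -[LHS]subr_ge0.
have li : (l <= i)%N by case/andP: lij.
have -> : i%:R = l%:R + (i - l)%:R :> R by rewrite -natrD subnKC.
by congr (0 <= _); ring.
Qed.

Lemma find_row l j y : (l <= j)%N -> l%:R * s <= y -> y <= j.+1%:R * s ->
  exists2 i, (l <= i <= j)%N & i%:R * s <= y /\ y <= i.+1%:R * s.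
Proof.
move=> lj; rewrite -(subnKC lj); elim: (j - l)%N => [|q IH] y1 y2.
  by exists l; rewrite ?addn0 ?leqnn //; move: y2; rewrite addn0.
have [h|h] := leP y ((l + q).+1%:R * s).
  by have [i /andP[i1 i2] hi] := IH y1 h; exists i => //; rewrite i1 addnS leqW.
exists (l + q.+1)%N; first by rewrite leq_addr leqnn.
by split=> //; rewrite addnS ltW.
Qed.

Lemma run_dead l j x y : run l j -> l%:R * s <= y -> y <= j.+1%:R * s ->
  right_of l x y <= 0 -> Dead x y.
Proof.
move=> rn y1 y2 hr; have [lj jM _] := rn.
have [B|B] := boolP (big kap M x y); last by left; apply/negP.
have [i lij [i1 i2]] := find_row lj y1 y2; right; exists i.
  by case/andP: lij => _ /leq_ltn_trans; apply.
by case/and4P: B => _ _ Bw _; rewrite /region i1 i2 (run_region _ _ rn lij) hr andbT.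
Qed.

Lemma run_alive l j x y : run l j -> l%:R * s < y -> y < j.+1%:R * s ->
  0 < right_of l x y -> x * s + (1 - k) * y * c < W * s -> ~ Dead x y.
Proof.
move=> rn y1 y2 hr hB; have [lj jM _] := rn.
have jM' : j.+1%:R * s <= M%:R * s by rewrite ler_pM2r // ler_nat.
have l0 : 0 <= l%:R * s by rewrite mulr_ge0 // ltW.
have [d1 d2 _ _] : [/\ k * l%:R * c <= r l, k * j.+1%:R * c <= top j, true & true].
  have lM : (l < M)%N by exact: leq_ltn_trans jM.
  have [_ _ h1 _] := strip_in_big lM (st lM); have [_ _ _ h2] := strip_in_big jM (st jM).
  by split.
case=> [|[i iM /and4P[h1 h2 _ h4]]].
  apply; apply/and4P; split; try by rewrite -/k -/W; lra.
  rewrite -/k; have [e1 e2] := runE rn (i := j) ltac:(by rewrite lj leqnn).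
  pose q : R := (j - l).+1%:R; have q0 : 0 < q by rewrite ltr0n.
  have jq : j.+1%:R = l%:R + q :> R by rewrite -natrD addnS subnKC.
  have tq : top j = r l + q * ((d l)%:~R * c).
    by rewrite /top e1 e2 /q -natr1; ring.
  rewrite jq tq in d2 y2; pose y' := y - l%:R * s.
  have f1 : 0 <= (q * s - y') * (r l - k * l%:R * c).
    by rewrite mulr_ge0 // ?subr_ge0 // /y'; lra.
  have f2 : 0 <= y' * (r l + q * ((d l)%:~R * c) - k * (l%:R + q) * c).
    by rewrite mulr_ge0 // ?subr_ge0 // /y'; lra.
  have f3 : 0 < q * right_of l x y by rewrite mulr_gt0.
  rewrite -subr_ge0 -(pmulr_rge0 _ q0).
  have -> : q * (x * s - k * y * c) = q * right_of l x y +
     ((q * s - y') * (r l - k * l%:R * c) +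
     y' * (r l + q * ((d l)%:~R * c) - k * (l%:R + q) * c)).
    by rewrite /right_of /y'; ring.
  lra.
have li : (l <= i <= j)%N.
  have : i%:R * s < j.+1%:R * s by lra.
  have : l%:R * s < i.+1%:R * s by lra.
  by rewrite !ltr_pM2r // !ltr_nat !ltnS => -> ->.
by move: h4; rewrite (run_region _ _ rn li); lra.
Qed.

(** The aligned lines lie on the other leg of the large trapezoid. *)
Definition onborder l j := r l = W - (1 - k) * l%:R * c /\ top j = W - (1 - k) * j.+1%:R * c.
(** At its lower end the line meets the bottom of the large trapezoid or a strip
    that goes further: there a tile has to fit into the angle. *)
Definition closed_below l := (l == 0)%N \/ (0 < l)%N /\ r l < top l.-1.
Definition closed_above j := (j.+1 == M)%N \/ (j.+1 < M)%N /\ top j < r j.+1.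

Lemma rlenE l j : run l j -> [/\ 0 < rlen l j, py (up l) (rlen l j) 0 = j.+1%:R * s &
  px (up l) (rlen l j) 0 = top j].
Proof.
move=> rn; have [lj jM _] := rn; have lM : (l < M)%N by exact: leq_ltn_trans jM.
have [[h1 h2 h3 h4] [h5 _]] := hhE lM.
have [e1 e2] := runE rn (i := j) ltac:(by rewrite lj leqnn).
split; first by rewrite /rlen mulr_gt0 // ltr0n.
  rewrite /py /= /rlen mulr0 addr0 mulrCA h2 -mulrDl -natrD; congr (_%:R * _); lia.
rewrite /px /top /= /rlen mulr0 subr0 e1 e2 -natr1.
transitivity (r l + ((j - l)%:R + 1) * ((d l)%:~R * elen (d l)) * c); first by ring.
by rewrite h5; ring.
Qed.

Section Run.
Variables (l j : nat).
Hypothesis rn : run l j.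
Let F := up l.
Let L := rlen l j.
Let lj : (l <= j)%N. Proof. by case: rn. Qed.
Let jM : (j < M)%N. Proof. by case: rn. Qed.
Let lM : (l < M)%N. Proof. exact: leq_ltn_trans jM. Qed.

(** The scaled distance from a point of the line to the other leg of the large
    trapezoid. *)
Let slack x := W * s - px F x 0 * s - (1 - k) * py F x 0 * c.

Lemma slackE x : slack x = slack 0 + x * (- ((d l)%:~R * c * s) - (1 - k) * hh (d l) * c).
Proof. by rewrite /slack /px /py /=; ring. Qed.

Hypothesis nb : ~ onborder l j.

Lemma slack_pos : [/\ 0 <= slack 0, 0 <= slack L & forall x, 0 < x -> x < L -> 0 < slack x].
Proof.
have [L0 L1 L2] := rlenE rn.
have [h1 _ _ _] := strip_in_big lM (st lM); have [_ h2 _ _] := strip_in_big jM (st jM).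
have s0 : slack 0 = (W - (1 - k) * l%:R * c - r l) * s by rewrite /slack /px /py /=; ring.
have sL : slack L = (W - (1 - k) * j.+1%:R * c - top j) * s by rewrite /slack L1 L2; ring.
have p0 : 0 <= slack 0 by rewrite s0 mulr_ge0 ?subr_ge0 // ltW.
have pL : 0 <= slack L by rewrite sL mulr_ge0 ?subr_ge0 // ltW.
have pp : 0 < slack 0 \/ 0 < slack L.
  apply: contrapT => /not_orP[/negP n1 /negP n2]; apply: nb.
  move: n1 n2; rewrite s0 sL !pmulr_lgt0 // !subr_gt0 -!leNgt => n1 n2.
  by split; apply/eqP; rewrite eq_le ?h1 ?h2 ?n1 ?n2.
split=> // x x0 xL.
have e : L * slack x = (L - x) * slack 0 + x * slack L by rewrite (slackE x) (slackE L); ring.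
have xL' : 0 < L - x by rewrite subr_gt0.
rewrite -(pmulr_rgt0 _ L0) e; case: pp => h.
  by apply: ltr_wpDr; [rewrite mulr_ge0 // ltW|rewrite mulr_gt0].
by apply: ltr_wpDl; [rewrite mulr_ge0 // ltW|rewrite mulr_gt0].
Qed.

Lemma run_alive_at x y : 0 < y -> l%:R * s < py F x y -> py F x y < j.+1%:R * s ->
  0 < slack x - y * (hh (d l) * s - (1 - k) * (d l)%:~R * c * c) -> ~ deadf Dead F x y.
Proof.
move=> y0 y1 y2 h; apply: (run_alive rn) => //.
  by rewrite right_of_up // mulr_gt0 //; have [_ []] := hhE lM.
by move: h; rewrite /slack /px /py /=; lra.
Qed.

(** Off the border, the points next to the line on its outer side are in the large
    trapezoid and in no strip. *)
Lemma front_up : front Dead F L.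
Proof.
have [L0 L1 L2] := rlenE rn; have [p0 pL pi] := slack_pos.
have [[h1 h2 h3 h4] [h5 h6]] := hhE lM.
split=> x x0 xL.
  pose D := (d l)%:~R * c; pose g := - (D * s) - (1 - k) * hh (d l) * c.
  have e1 : ev (fun e => 0 < hh (d l) * x + hh (d l) * e + (- D) * e ^+ 2).
    apply: ev_quad_pos; move: x0; rewrite le_eqVlt => /orP[/eqP<-|x0]; [right|left].
      by rewrite mulr0.
    by rewrite mulr_gt0.
  have e2 : ev (fun e => 0 < hh (d l) * (L - x) + (- hh (d l)) * e + D * e ^+ 2).
    by apply: ev_quad_pos; left; rewrite mulr_gt0 ?subr_gt0.
  have e3 : ev (fun e => 0 < slack x + g * e + (- (hh (d l) * s - (1 - k) * D * c)) * e ^+ 2).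
    apply: ev_quad_pos; have [s0|s0] := ltP 0 (slack x); [by left|right].
    have x00 : x = 0.
      apply/eqP; rewrite eq_le x0 andbT leNgt; apply/negP => xp.
      by have := pi x xp xL; lra.
    rewrite x00 in s0 *; have sz : slack 0 = 0 by lra.
    split=> //; have hL : 0 < L / 2 by lra.
    by have := pi (L / 2) hL ltac:(lra); rewrite slackE sz add0r pmulr_rgt0.
  apply: (ev_imp (ev_and (ev_and e1 e2) e3)) => e e0 [[q1 q2] q3].
  apply: run_alive_at; rewrite ?exprn_gt0 //.
  - by move: q1; rewrite /py /= /D; lra.
  - by move: q2; rewrite -L1 /py /= -/L /D; lra.
  - by move: q3; rewrite (slackE (x + e)) (slackE x) /g /D; lra.
have e1 : ev (fun e => 0 < hh (d l) * x + (d l)%:~R * c * e).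
  by apply: ev_lin; left; rewrite mulr_gt0.
have e2 : ev (fun e => 0 < hh (d l) * (L - x) + (- ((d l)%:~R * c)) * e).
  by apply: ev_lin; left; rewrite mulr_gt0 ?subr_gt0.
apply: (ev_imp (ev_and e1 e2)) => e e0 [q1 q2]; apply: (run_dead rn).
- by move: q1; rewrite /py /=; lra.
- by move: q2; rewrite -L1 /py /= -/L; lra.
- by rewrite right_of_up // mulNr oppr_le0 mulr_ge0 // ltW.
Qed.

Lemma front_down : front Dead (turn F L) L.
Proof.
have [L0 L1 L2] := rlenE rn; have [p0 pL pi] := slack_pos.
have [[h1 h2 h3 h4] [h5 h6]] := hhE lM.
split=> x x0 xL; last first.
  have [_ h] := front_up; have := h (L - x); rewrite subr_gt0 gtrBl => /(_ xL x0) hh'.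
  by apply: (ev_imp hh') => e e0; rewrite /deadf px_turn py_turn.
pose D := (d l)%:~R * c; pose g := - (D * s) - (1 - k) * hh (d l) * c.
have e1 : ev (fun e => 0 < hh (d l) * x + hh (d l) * e + D * e ^+ 2).
  apply: ev_quad_pos; move: x0; rewrite le_eqVlt => /orP[/eqP<-|x0]; [right|left].
    by rewrite mulr0.
  by rewrite mulr_gt0.
have e2 : ev (fun e => 0 < hh (d l) * (L - x) + (- hh (d l)) * e + (- D) * e ^+ 2).
  by apply: ev_quad_pos; left; rewrite mulr_gt0 ?subr_gt0.
have e3 : ev (fun e => 0 < slack (L - x) + (- g) * e + (- (hh (d l) * s - (1 - k) * D * c)) * e ^+ 2).
  apply: ev_quad_pos; have [s0|s0] := ltP 0 (slack (L - x)); [by left|right].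
  have x00 : x = 0.
    apply/eqP; rewrite eq_le x0 andbT leNgt; apply/negP => xp.
    by have := pi (L - x) ltac:(lra) ltac:(lra); lra.
  rewrite x00 subr0 in s0 *; have sz : slack L = 0 by lra.
  split=> //; have hL : 0 < L / 2 by lra.
  have := pi (L / 2) hL ltac:(lra); rewrite slackE -/g => h.
  have : slack L = slack 0 + L * g by rewrite slackE.
  rewrite sz => h'; have : 0 < L / 2 * - g by lra.
  by rewrite pmulr_rgt0.
apply: (ev_imp (ev_and (ev_and e1 e2) e3)) => e e0 [[q1 q2] q3].
rewrite /deadf px_turn py_turn; apply: run_alive_at; rewrite ?exprn_gt0 //.
- by move: q2; rewrite /py /= /D; lra.
- by move: q1; rewrite -L1 /py /= -/L /D; lra.
- by move: q3; rewrite (slackE (L - (x + e))) (slackE (L - x)) /g /D; lra.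
Qed.

End Run.

Lemma open_below l : (l < M)%N -> closed_below l -> opening s c Dead (up l) (d l)%:~R.
Proof.
move=> lM cl vx vy vy0 hv.
have hneg : hh (d l) * vx - (d l)%:~R * c * vy < 0.
  by move: hv; case: (dP lM) => ->; rewrite /hh /= ?mulrN1z ?mulr0z ?mulr1z => h; try lra;
    rewrite -(pmulr_llt0 _ s_gt0); lra.
have pyE e : py (up l) (e * vx) (e * vy) = l%:R * s + e * (hh (d l) * vx - (d l)%:~R * c * vy).
  by rewrite /py /=; ring.
case: l lM cl hv hneg pyE => [|l'] lM cl hv hneg pyE.
  apply: ev_always => e e0; left; rewrite /big pyE => /andP[+ _].
  by rewrite mul0r add0r pmulr_rge0 // leNgt hneg.
case: cl => //= -[_ cl]; have l'M : (l' < M)%N by exact: ltnW.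
set V := hh _ * vx - _ in hneg pyE.
have e1 : ev (fun e => 0 < s + V * e) by apply: ev_lin; left.
have e2 : ev (fun e => 0 < (top l' - r l'.+1) * s + ((d l')%:~R * c * V -
    ((d l'.+1)%:~R * c * vx + hh (d l'.+1) * vy) * s) * e).
  by apply: ev_lin; left; rewrite mulr_gt0 ?subr_gt0.
apply: (ev_imp (ev_and e1 e2)) => e e0 [q1 q2].
have [B|B] := boolP (big kap M (px (up l'.+1) (e * vx) (e * vy)) (py (up l'.+1) (e * vx) (e * vy))); last by left; apply/negP.
right; exists l' => //; case/and4P: B => _ _ B _.
have eV : e * V < 0 by rewrite pmulr_rlt0.
rewrite /region B pyE jsE /=; apply/and3P; split; [lra|lra|].
by move: q2; rewrite /top /px /=; lra.
Qed.

Lemma open_above l j : run l j -> closed_above j ->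
  opening s c Dead (turn (up l) (rlen l j)) (- d l)%:~R.
Proof.
move=> rn cl vx vy vy0 hv; have [lj jM _] := rn; have lM : (l < M)%N by exact: leq_ltn_trans jM.
have [L0 L1 L2] := rlenE rn.
have hpos : 0 < - (hh (d l) * vx + (d l)%:~R * c * vy).
  by move: hv; case: (dP lM) => ->; rewrite /hh /= ?rmorphN ?opprK ?mulrN1z ?mulr0z ?mulr1z => h; try lra;
    rewrite -(pmulr_lgt0 _ s_gt0); lra.
set V := - _ in hpos.
have pyE e : py (up l) (rlen l j - e * vx) (e * vy) = j.+1%:R * s + e * V.
  by rewrite -L1 /py /V /=; ring.
have pxE e : px (up l) (rlen l j - e * vx) (e * vy) = top j + e * (hh (d l) * vy - (d l)%:~R * c * vx).
  by rewrite -L2 /px /=; ring.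
have [jl|jl] := eqVneq j.+1 M.
  apply: ev_always => e e0; left; rewrite px_turn py_turn /big pyE => /andP[_ /andP[+ _]].
  by have := mulr_gt0 e0 hpos; rewrite jl; lra.
have j1M : (j.+1 < M)%N by rewrite ltn_neqAle jl.
case: cl => [/eqP|[_ cl]]; first by move/eqP: jl.
have e1 : ev (fun e => 0 < s + (- V) * e) by apply: ev_lin; left.
have e2 : ev (fun e => 0 < (r j.+1 - top j) * s + ((d j.+1)%:~R * c * V -
    (hh (d l) * vy - (d l)%:~R * c * vx) * s) * e).
  by apply: ev_lin; left; rewrite mulr_gt0 ?subr_gt0.
apply: (ev_imp (ev_and e1 e2)) => e e0 [q1 q2]; rewrite /deadf px_turn py_turn.
have [B|B] := boolP (big kap M (px (up l) (rlen l j - e * vx) (e * vy)) (py (up l) (rlen l j - e * vx) (e * vy))); last by left; apply/negP.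
right; exists j.+1 => //; case/and4P: B => _ _ B _.
have eV : 0 < e * V by rewrite mulr_gt0.
rewrite /region B pyE pxE (jsE j.+1) /=; apply/and3P; split; [lra|lra|].
by move: q2; lra.
Qed.

(** The end of a strip depends on the number of tiles and on the slope of the
    last line, so that a common point of two consecutive lines relates these
    numbers. *)
Lemma tie_eq j : (j.+1 < M)%N -> r j.+1 = top j ->
  ((m j)%:Z - (m j.+1)%:Z)%:~R * b = (2 * (kap : int) - d j - d j.+1)%:~R * c.
Proof.
move=> jM e; have [_ h1 _ _] := st (ltnW jM); have [_ h2 _ _] := st jM.
rewrite !intrD !intrM !rmorphN /= -!pmulrn -/k; rewrite e /top -natr1 in h2.
by lra.
Qed.

(** Since [c < b], the numbers of tiles differ by less than [|d j + d j.+1|];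
    parity excludes a difference of one tile. *)
Lemma tie_upright j : (j.+1 < M)%N -> r j.+1 = top j -> kap = false -> d j.+1 = - d j.
Proof.
move=> jM e kf; have h := tie_eq jM e.
have [[_ _ p1 _] _ _ _] := st (ltnW jM); have [[_ _ p2 _] _ _ _] := st jM.
apply/eqP; rewrite -subr_eq0 opprK; apply/negPn/negP => dn.
have := b_gtc; have := c_gt0 => c0 bc.
have hz : ((m j)%:Z - (m j.+1)%:Z) != 0.
  apply: contraNneq dn => z; move: h; rewrite z mul0r kf /= => /esym/eqP.
  by rewrite mulf_eq0 (gt_eqF c0) orbF intr_eq0 => /eqP; lia.
set A : int := _ - _ in h hz; set B : int := _ - _ - _ in h.
have lt : `|A| < `|B|.
  rewrite -(ltr_int R) !intr_norm.
  have e1 : `|A%:~R| * b = `|B%:~R| * c.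
    by rewrite -[X in _ * X = _](gtr0_norm (lt_trans c0 bc)) -[X in _ = _ * X](gtr0_norm c0) -!normrM h.
  have A0 : 0 < `|A%:~R| :> R by rewrite normr_gt0 intr_eq0.
  by rewrite -(ltr_pM2r c0) -e1 ltr_pM2l.
move: lt hz p1 p2; rewrite /A /B kf mulr0 => lt hz p1 p2.
by have := opposite_slopes (dP (ltnW jM)) (dP jM) p1 p2 hz lt; rewrite (negbTE dn).
Qed.

(** As in [tie_upright]; here the slopes 0 and [-1] would allow a difference of one
    tile, but only for [b = 3 c], that is [a = c]. *)
Lemma tie_slanted j : (j.+1 < M)%N -> r j.+1 = top j -> kap = true -> a != c ->
  d j.+1 = d j /\ d j != 0.
Proof.
move=> jM e kt ac; have h := tie_eq jM e.
have [[_ _ p1 _] _ _ _] := st (ltnW jM); have [[_ _ p2 _] _ _ _] := st jM.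
have := b_gtc; have := c_gt0 => c0 bc.
apply: contrapT => dn.
have hz : ((m j)%:Z - (m j.+1)%:Z) != 0.
  apply/negP => /eqP z; apply: dn; move: h; rewrite z mul0r kt /= => /esym/eqP.
  rewrite mulf_eq0 (gt_eqF c0) orbF intr_eq0 mulr1 => /eqP.
  exact: extreme_slopes (dP (ltnW jM)) (dP jM).
have h3 : ((m j)%:Z - (m j.+1)%:Z) = 1 -> (2 * (kap : int) - d j - d j.+1) = 3 -> False.
  by move=> h1 h2; move: h; rewrite h1 h2 /b => hh'; move/eqP: ac; lra.
set A : int := _ - _ in h hz h3; set B : int := _ - _ - _ in h h3.
have lt : `|A| < `|B|.
  rewrite -(ltr_int R) !intr_norm.
  have e1 : `|A%:~R| * b = `|B%:~R| * c.
    by rewrite -[X in _ * X = _](gtr0_norm (lt_trans c0 bc)) -[X in _ = _ * X](gtr0_norm c0) -!normrM h.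
  have A0 : 0 < `|A%:~R| :> R by rewrite normr_gt0 intr_eq0.
  by rewrite -(ltr_pM2r c0) -e1 ltr_pM2l.
have A0 : 0 < A.
  rewrite -(ltr_int R) -(pmulr_lgt0 _ (lt_trans c0 bc)) h mulr_gt0 // ltr0z.
  have B0 : 0 <= B by rewrite /B kt; case: (dP (ltnW jM)) => ->; case: (dP jM) => ->.
  by rewrite lt_def B0 andbT; apply: contraTneq lt => ->; rewrite normr0 ltNge normr_ge0.
move: lt hz p1 p2 h3 A0; rewrite /A /B kt mulr1 => lt hz p1 p2 h3 A0; apply: dn.
exact: equal_slopes (dP (ltnW jM)) (dP jM) p1 p2 hz lt h3 A0.
Qed.

(** A tile that continues the [j]th strip contradicts its maximality. *)
Lemma no_extension j i d' r' : (j < M)%N -> -1 <= d' -> d' <= 1 ->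
  (d' == 0) = ~~ (d j == 0) ->
  2 * r' = 2 * r j + b + ((d j)%:~R - d'%:~R) * c ->
  (forall x y, T i x y = [&& j%:R * s <= y, y <= j.+1%:R * s,
    (d j)%:~R * c * (y - j%:R * s) <= (x - r j) * s &
    (x - r') * s <= d'%:~R * c * (y - j%:R * s)]) -> False.
Proof.
move=> jM d1 d2 dd rr hT; have [[h1 h2 h3 h4] h5 h6 h7] := st jM.
(* The new line does not pass to the left of the old one. *)
have step y : j%:R * s <= y -> y <= j.+1%:R * s ->
    0 <= (r' - r j) * s + (d'%:~R - (d j)%:~R) * c * (y - j%:R * s).
  rewrite jsE => y1 y2; pose y' := y - j%:R * s.
  have q0 : 0 <= y' by rewrite /y'; lra.
  have q1 : 0 <= s - y' by rewrite /y'; lra.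
  have bc := b_gtc; have c0 := c_gt0.
  have bp : 0 < b by exact: lt_trans bc.
  have f1 := mulr_ge0 q0 (_ : 0 <= b - c); have f2 := mulr_ge0 q1 (_ : 0 <= b - c).
  have {}f1 := f1 ltac:(lra); have {}f2 := f2 ltac:(lra).
  have f3 := mulr_ge0 q0 (ltW c0); have f4 := mulr_ge0 q1 (ltW c0).
  have r'E : r' = r j + (b + ((d j)%:~R - d'%:~R) * c) / 2 by lra.
  rewrite -/y' r'E; move: dd; case: (dE d1 d2) => ->; case: (dP jM) => -> //= _;
    rewrite ?mulrN1z ?mulr0z ?mulr1z; lra.
have := mx jM (J' := fun i' => J j i' \/ i' = i) (r' := r') (d' := d') (m' := (m j).+1).
move=> /(_ _)/wrap[]; last by rewrite ltnn.
split=> //.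
- by split=> //=; rewrite dd h3; case: (odd (m j)); case: (kap).
- by rewrite -natr1; lra.
- move=> i' x y [Ji|->] Ti.
    have /and4P[g1 g2 g3 g4] := h6 _ _ _ Ji Ti.
    by apply/and4P; split=> //; have := step y g1 g2; lra.
  have := Ti; rewrite hT => /and4P[g1 g2 g3 g4].
  have /cover/and4P[_ _ Bw _] : exists i, T i x y by exists i.
  by apply/and4P; split.
move=> x y /and4P[g1 g2 g3 g4] g5.
have [q|q] := leP ((x - r j) * s) ((d j)%:~R * c * (y - j%:R * s)).
  have [|i' Ji' Ti'] := h7 x y _ g5; first by apply/and4P; split.
  by exists i' => //; left.
by exists i; [right|rewrite hT g1 g2 g4 ltW].
Qed.

Lemma tile_in_frame f i t x y : okf f -> placed i f t ->
  T i x y = shape s c a t (px (invf f) x y) (py (invf f) x y).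
Proof. by move=> fo pl; have [<- _] := pl (px (invf f) x y) (py (invf f) x y); rewrite px_inv // py_inv. Qed.

(** With a leg on a slanted line, the bases of a tile are horizontal and the tile
    occupies exactly one row: it continues the strip. *)
Lemma no_leg_up j i : (j < M)%N -> d j = 1 -> ~ placed i (up j) (Leg, false).
Proof.
move=> jM dj pl; apply: (@no_extension j i 0 (r j + (a + c))) => //.
- by rewrite dj.
- by rewrite dj /b; lra.
move=> x y; rewrite (tile_in_frame _ _ (up_ok jM) pl) /shape.
have -> : px (eframe s c a (Leg, false)) (px (invf (up j)) x y) (py (invf (up j)) x y) =
   a + c - (x - r j).
  rewrite /px /py /= dj /hh /= mulr1z.
  have h : s * s = 1 - c * c by move: (sc1); lra.
  ring: h.
have -> : py (eframe s c a (Leg, false)) (px (invf (up j)) x y) (py (invf (up j)) x y) =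
   y - j%:R * s.
  rewrite /px /py /= dj /hh /= mulr1z.
  have h : s * s = 1 - c * c by move: (sc1); lra.
  ring: h.
rewrite /trap jsE dj mulr0z mulr1z; apply/and4P/and4P => -[h1 h2 h3 h4]; split; try lra.
  by rewrite -(pmulr_lge0 _ s_gt0) in h3; lra.
by rewrite -(pmulr_lge0 _ s_gt0); lra.
Qed.

Lemma no_leg_down j i : (j < M)%N -> d j = -1 -> ~ placed i (turn (up j) 1) (Leg, false).
Proof.
move=> jM dj pl; apply: (@no_extension j i 0 (r j + a)) => //.
- by rewrite dj.
- by rewrite dj /b; lra.
move=> x y; rewrite (tile_in_frame _ _ (okf_turn 1 (up_ok jM)) pl) /shape.
have -> : px (eframe s c a (Leg, false)) (px (invf (turn (up j) 1)) x y) (py (invf (turn (up j) 1)) x y) =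
   a - (x - r j).
  rewrite /px /py /= /px /py /= dj /hh /= mulrN1z.
  have h : s * s = 1 - c * c by move: (sc1); lra.
  ring: h.
have -> : py (eframe s c a (Leg, false)) (px (invf (turn (up j) 1)) x y) (py (invf (turn (up j) 1)) x y) =
   s - (y - j%:R * s).
  rewrite /px /py /= /px /py /= dj /hh /= mulrN1z.
  have h : s * s = 1 - c * c by move: (sc1); lra.
  ring: h.
rewrite /trap jsE dj mulr0z mulrN1z; apply/and4P/and4P => -[h1 h2 h3 h4]; split; try lra.
  by rewrite -(pmulr_lge0 _ s_gt0) in h3; lra.
by rewrite -(pmulr_lge0 _ s_gt0); lra.
Qed.

Lemma no_vert_up j i t : (j < M)%N -> d j = 0 -> is_true (if t.1 is Vert then true else false) ->
  ~ placed i (up j) t.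
Proof.
case: t => -[] // b' jM dj _ pl.
have e1 x y : px (sframe s c a Vert) (px (invf (up j)) x y) (py (invf (up j)) x y) = x - r j.
  by rewrite /px /py /= dj /hh /= mulr0z; ring.
have e2 x y : py (sframe s c a Vert) (px (invf (up j)) x y) (py (invf (up j)) x y) = y - j%:R * s.
  by rewrite /px /py /= dj /hh /= mulr0z; ring.
case: b' pl => pl.
  apply: (@no_extension j i 1 (r j + a)) => //; first by rewrite dj.
    by rewrite dj /b; lra.
  move=> x y; rewrite (tile_in_frame _ _ (up_ok jM) pl) /shape /eframe /= px_turn py_turn.
  have -> : px (sframe s c a Vert) (len s c a (Vert, true) - px (invf (up j)) x y) (py (invf (up j)) x y) = x - r j.
    by rewrite -(e1 x y) /px /py /=; ring.
  have -> : py (sframe s c a Vert) (len s c a (Vert, true) - px (invf (up j)) x y) (py (invf (up j)) x y) = s - (y - j%:R * s).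
    by rewrite -(e2 x y) /px /py /len /=; ring.
  rewrite /trap jsE dj mulr0z mulr1z; apply/and4P/and4P => -[h1 h2 h3 h4]; split; try lra.
    by rewrite -(pmulr_lge0 _ s_gt0) in h3; lra.
  by rewrite -(pmulr_lge0 _ s_gt0); lra.
apply: (@no_extension j i (-1) (r j + (a + c))) => //; first by rewrite dj.
  by rewrite dj /b; lra.
move=> x y; rewrite (tile_in_frame _ _ (up_ok jM) pl) /shape /eframe /= e1 e2.
rewrite /trap jsE dj mulr0z mulrN1z; apply/and4P/and4P => -[h1 h2 h3 h4]; split; try lra.
  by rewrite -(pmulr_lge0 _ s_gt0) in h3; lra.
by rewrite -(pmulr_lge0 _ s_gt0); lra.
Qed.

(** ** Impossibility along the long leg *)

Lemma turnK f l : turn (turn f l) l = f.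
Proof. by case: f => x y p q e; rewrite /turn /px /py /= !opprK; congr Frame; ring. Qed.

Lemma run1 j : (j < M)%N -> run j j.
Proof. by move=> jM; split=> // i /andP[h1 h2]; move: (leq_ltn_trans h1 h2); rewrite ltnn. Qed.

Lemma rlen1 j : rlen j j = elen (d j).
Proof. by rewrite /rlen subnn mul1r. Qed.

Lemma run_frame l j : run l j -> turn (up l) (rlen l j) = turn (up j) (rlen j j).
Proof.
move=> rn; have [lj jM _] := rn; have [_ e1 e2] := rlenE rn; have [_ e3 e4] := rlenE (run1 jM).
have [dd _] := runE rn (i := j) ltac:(by rewrite lj leqnn).
by rewrite /turn e1 e2 e3 e4 /= dd.
Qed.

Lemma s_lt1 : s < 1.
Proof.
have c2 := mulr_gt0 c_gt0 c_gt0; rewrite ltNge; apply/negP => h.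
by move: sc1 c2 (ler_pM ler01 ler01 h h) => e1 e2 e3; lra.
Qed.

(** The other leg is now vertical. A line on it occupies one row, which is the
    first and the last one because a strip that goes further would leave the
    large trapezoid; but there are several rows. *)
Lemma run_noborder l j : kap = true -> run l j -> closed_below l -> closed_above j ->
  (d l = 0 -> l = j) -> ~ onborder l j.
Proof.
move=> kt rn cb ca dl [b1 b2]; have [lj jM _] := rn; have lM : (l < M)%N := leq_ltn_trans lj jM.
have k1 : k = 1 by rewrite /k kt.
have [e1 e2] := runE rn (i := j) ltac:(by rewrite lj leqnn).
rewrite k1 subrr !mul0r !subr0 in b1 b2.
have top_le i : (i < M)%N -> top i <= W.
  by move=> iM; have [_ h _ _] := strip_in_big iM (st iM); move: h; rewrite k1 subrr !mul0r subr0.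
have r_le i : (i < M)%N -> r i <= W.
  by move=> iM; have [h _ _ _] := strip_in_big iM (st iM); move: h; rewrite k1 subrr !mul0r subr0.
case: ca => [/eqP jM1|[jM1 ca]]; last by move: (r_le _ jM1); rewrite -b2 leNgt ca.
case: cb => [/eqP l0|[l0 cb]]; last first.
  by move: (top_le l.-1 ltac:(lia)); rewrite -b1 leNgt cb.
have lj0 : l = j.
  apply: dl; have q0 : 0 < (j - l)%:R + 1 :> R by rewrite natr1 ltr0n.
  have /eqP : ((j - l)%:R + 1) * ((d l)%:~R * c) = 0.
    by move: b2; rewrite /top e1 e2 b1; lra.
  by rewrite !mulf_eq0 (gt_eqF q0) (gt_eqF c_gt0) orbF /= intr_eq0 => /eqP.
by move: M_gt1; rewrite -jM1 -lj0 l0.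
Qed.

Lemma wlen_ge0 w : 0 <= wlen s c a w.
Proof. by rewrite /wlen; apply: sumr_ge0 => t _; rewrite ltW // len_gt0. Qed.

Lemma open_below_run l j : run l j -> closed_below l ->
  opening s c Dead (turn (turn (up l) (rlen l j)) (rlen l j)) (d l)%:~R.
Proof.
by move=> rn cb; have [lj jM _] := rn; rewrite turnK; apply: open_below => //; exact: leq_ltn_trans jM.
Qed.

(** The first tile on an enclosed line would continue a strip, or the tiles on the
    line would not have its length. *)
Lemma slanted_run l j : kap = true -> a != c -> s = c ->
  (forall w (t : nat), (0 < cnt Long w)%N -> wlen s c a w <> t%:R) ->
  run l j -> closed_below l -> closed_above j -> False.
Proof.
move=> kt ac sc hw rn cb ca; have [lj jM hr] := rn; have lM : (l < M)%N := leq_ltn_trans lj jM.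
have [L0 L1 L2] := rlenE rn.
have dl : d l = 0 -> l = j.
  move=> d0; apply/eqP; rewrite eqn_leq lj leqNgt; apply/negP => ltlj.
  have [_ e] := hr l ltac:(by rewrite leqnn ltlj).
  by have [] := tie_slanted (leq_ltn_trans ltlj jM) e kt ac; rewrite d0.
have nb := run_noborder kt rn cb ca dl.
have rE : d l != 0 -> rlen l j = (j - l).+1%:R.
  by move=> d0; rewrite /rlen /elen (negbTE d0) mulr1.
have longw t w : t.1 = Long -> d l != 0 -> len s c a t + wlen s c a w = rlen l j -> False.
  move=> tl d0 h; apply: (hw (t :: w) (j - l).+1); rewrite -?rE // /wlen ?big_cons //.
  by case: t tl {h} => -[].
(* On a slanted line the end with an acute angle is the start of a leg, which
   continues a strip, or of a long base, excluded by the length of the line. *)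
case: (dP lM) => dE1.
- have d0 : d l != 0 by rewrite dE1.
  have ob := open_above rn ca; have ob' := open_below_run rn cb.
  have fr := front_down rn nb.
  have fo : okf (turn (up l) (rlen l j)) by apply: okf_turn; exact: up_ok.
  have [i [t [fi pl tt]]] := start_tile s_gt0 c_gt0 a_gt0 sc1 tiles strips_dead strips_cover fo L0 fr ob.
  have [w [_ h _]] := closed_chain s_gt0 c_gt0 a_gt0 sc1 tiles disj strips_dead strips_cover L0 fo fr fi pl ob'.
  move: tt; rewrite dE1 opprK ler_int.
  case: t pl h => -[] [] //= pl h _; last exact: (longw _ _ _ d0 h).
  have [dd _] := runE rn (i := j) ltac:(by rewrite lj leqnn).
  apply: (@no_leg_down j i jM); first by rewrite dd.
  by move: pl; rewrite (run_frame rn) rlen1 dd /elen dE1.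
(* A vertical line has length [s = c], less than a leg, than a long base and than
   a short base with a side that fits beside its obtuse angle. *)
- have lj0 := dl dE1; have ob := open_below lM cb; have ob' := open_above rn ca.
  have fr := front_up rn nb.
  have [i [t [fi pl tt]]] := start_tile s_gt0 c_gt0 a_gt0 sc1 tiles strips_dead strips_cover (up_ok lM) L0 fr ob.
  have [w [h1 h h2]] := closed_chain s_gt0 c_gt0 a_gt0 sc1 tiles disj strips_dead strips_cover L0 (up_ok lM) fr fi pl ob'.
  have rs : rlen l j = s by rewrite -lj0 rlen1 dE1.
  have w0 := wlen_ge0 w; have s1 := s_lt1; move: h; rewrite rs => h.
  move: tt; rewrite dE1 ler_int; move: (a_gt0) => ap.
  case: t pl h h1 h2 => -[] [] //= pl; rewrite /len /= => h h1 h2 _; try by lra.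
  + exact: (no_vert_up lM dE1 _ pl).
  + exact: (no_vert_up lM dE1 _ pl).
  case: w w0 h h1 h2 => [|t' w] w0 h h1 h2; first by move: h2; rewrite dE1.
  have w1 := wlen_ge0 w; move: h h1; rewrite /wlen big_cons -/(wlen s c a w).
  by case: t' {w0 h2} => -[] [] //=; rewrite /len /= => h _; lra.
- have d0 : d l != 0 by rewrite dE1.
  have ob := open_below lM cb; have ob' := open_above rn ca.
  have fr := front_up rn nb.
  have [i [t [fi pl tt]]] := start_tile s_gt0 c_gt0 a_gt0 sc1 tiles strips_dead strips_cover (up_ok lM) L0 fr ob.
  have [w [_ h _]] := closed_chain s_gt0 c_gt0 a_gt0 sc1 tiles disj strips_dead strips_cover L0 (up_ok lM) fr fi pl ob'.
  move: tt; rewrite dE1 ler_int.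
  case: t pl h => -[] [] //= pl h _; last exact: (longw _ _ _ d0 h).
  exact: (no_leg_up lM dE1 pl).
Qed.

(** Consecutive lines that meet are aligned by [tie_slanted]. Going up the rows,
    each line thus continues a run enclosed from below or starts one, and the top
    of the large trapezoid encloses the last run from above. *)
Lemma slanted_impossible : kap = true -> a != c -> s = c ->
  (forall w (t : nat), (0 < cnt Long w)%N -> wlen s c a w <> t%:R) -> False.
Proof.
move=> kt ac sc hw.
have h j : (j < M)%N -> exists2 l, run l j & closed_below l.
  elim: j => [|j IH] jM; first by exists 0%N; [exact: run1|left].
  have [l rn cb] := IH (ltnW jM); have [lj _ hr] := rn.
  case: (ltgtP (r j.+1) (top j)) => e.
  - by exists j.+1; [exact: run1|right].
  - by exfalso; apply: (slanted_run kt ac sc hw rn cb); right.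
  exists l => //; split=> //; first exact: leqW.
  move=> i /andP[li ij]; have [->|ne] := eqVneq i j.
    by split=> //; have [] := tie_slanted jM e kt ac.
  by apply: hr; lia.
have MM : (M.-1 < M)%N by lia.
have [l rn cb] := h _ MM; apply: (slanted_run kt ac sc hw rn cb).
by left; rewrite prednK //; lia.
Qed.

(** ** Impossibility along the short leg *)

Lemma upE j x y : d j = 1 -> px (up j) x y = r j + c * x + s * y /\
  py (up j) x y = j%:R * s + s * x - c * y.
Proof. by move=> dj; rewrite /px /py /= dj /hh /= mulr1z; split; ring. Qed.

Lemma downE j x y : d j = -1 -> px (turn (up j) 1) x y = top j + c * x + s * y /\
  py (turn (up j) 1) x y = j.+1%:R * s - s * x + c * y.
Proof.
move=> dj; rewrite px_turn py_turn /px /py /top /= dj /hh /= mulrN1z jsE.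
by split; ring.
Qed.

(** The notch between a line that leans to the left and, above it, one that
    leans to the right has the angle [2 theta].  Two tiles that start there
    along its two sides with angles that are not acute overlap, and a single
    tile fits in it only if [2 theta] is one of its angles. *)
Lemma notch_acute i i' t t' j : d j = -1 -> d j.+1 = 1 -> r j.+1 = top j ->
  placed i (up j.+1) t -> placed i' (turn (up j) 1) t' -> tau t <= 0 -> tau t' <= 0 ->
  c = s \/ 2 * c = 1.
Proof.
move=> dj dj1 rj pl pl' t0 t0'.
have tR u : tau u <= 0 -> (tau u)%:~R <= 0 :> R by rewrite -(ler_int R).
have cs := mulr_gt0 c_gt0 s_gt0.
have dir u : tau u <= 0 -> s * ((tau u)%:~R * c) < c * s.
  move=> /tR u0; have : s * ((tau u)%:~R * c) <= 0.
    by rewrite pmulr_rle0 // pmulr_lle0.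
  lra.
have same x y : (px (turn (up j) 1) x y = px (up j.+1) ((c * c - s * s) * x + 2 * s * c * y)
      (2 * s * c * x + (s * s - c * c) * y)) /\
    (py (turn (up j) 1) x y = py (up j.+1) ((c * c - s * s) * x + 2 * s * c * y)
      (2 * s * c * x + (s * s - c * c) * y)).
  have [-> ->] := downE x y dj.
  have [-> ->] := upE ((c * c - s * s) * x + 2 * s * c * y) (2 * s * c * x + (s * s - c * c) * y) dj1.
  rewrite rj; have h : s * s = 1 - c * c by move: (sc1); lra.
  by split; ring: h.
have ii : i = i'.
  have [e e0 [h1 h2]] := ev_ex (ev_and (placed_start s_gt0 c_gt0 a_gt0 sc1 pl s_gt0 (dir _ t0))
    (placed_start s_gt0 c_gt0 a_gt0 sc1 pl' s_gt0 (dir _ t0'))).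
  apply: (disj h1); move: (S_T tiles h2); have [-> ->] := same (e * c) (e * s).
  have h : s * s = 1 - c * c by move: (sc1); lra.
  have -> : (c * c - s * s) * (e * c) + 2 * s * c * (e * s) = e * c by ring: h.
  by have -> : 2 * s * c * (e * c) + (s * s - c * c) * (e * s) = e * s by ring: h.
rewrite -ii in pl'.
have up1 : 2 * (c * c) * (tau t)%:~R <= c * c - s * s.
  have l0 := len_gt0 s_gt0 c_gt0 a_gt0 t'.
  have : T i (px (turn (up j) 1) (len s c a t') 0) (py (turn (up j) 1) (len s c a t') 0).
    by have [-> _] := pl' (len s c a t') 0; apply: shape_edge => //; exact: ltW.
  have [-> ->] := same (len s c a t') 0 => /(placed_wedge sc1 pl)[_ h _].
  have ls : 0 < len s c a t' * s by rewrite mulr_gt0.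
  by rewrite -(ler_pM2l ls); lra.
have lo1 : c * c - s * s <= 2 * (c * c) * (tau t)%:~R.
  rewrite leNgt; apply/negP => h.
  pose q := c * c - s * s - 2 * (c * c) * (tau t)%:~R; have q0 : 0 < q by rewrite /q; lra.
  pose vx := ((tau t)%:~R * c + q / (4 * c)) / s.
  have vs : vx * s = (tau t)%:~R * c + q / (4 * c) by rewrite /vx divfK ?gt_eqF.
  have hv : 1 * ((tau t)%:~R * c) < vx * s.
    by rewrite vs mul1r ltrDl divr_gt0 ?mulr_gt0.
  have [e e0 Si] := ev_ex (placed_start s_gt0 c_gt0 a_gt0 sc1 pl ltr01 hv).
  have := placed_wedge sc1 pl' (x := (c * c - s * s) * (e * vx) + 2 * s * c * (e * 1))
     (y := 2 * s * c * (e * vx) + (s * s - c * c) * (e * 1)).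
  have [-> ->] := same ((c * c - s * s) * (e * vx) + 2 * s * c * (e * 1))
     (2 * s * c * (e * vx) + (s * s - c * c) * (e * 1)).
  have hh : s * s = 1 - c * c by move: (sc1); lra.
  have -> : (c * c - s * s) * ((c * c - s * s) * (e * vx) + 2 * s * c * (e * 1)) +
    2 * s * c * (2 * s * c * (e * vx) + (s * s - c * c) * (e * 1)) = e * vx by ring: hh.
  have -> : 2 * s * c * ((c * c - s * s) * (e * vx) + 2 * s * c * (e * 1)) +
    (s * s - c * c) * (2 * s * c * (e * vx) + (s * s - c * c) * (e * 1)) = e * 1 by ring: hh.
  move=> /(_ (S_T tiles Si))[h1 _ _].
  have : 0 <= e * (2 * c * (vx * s) + (s * s - c * c)) by lra.
  rewrite pmulr_rge0 // vs.
  have -> : 2 * c * ((tau t)%:~R * c + q / (4 * c)) = 2 * (c * c) * (tau t)%:~R + q / 2.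
    by field; rewrite gt_eqF.
  by rewrite /q; lra.
have : tau t = 0 \/ tau t = -1 by case: (t) t0 => -[] [] //= _; (by left) || (by right).
have c0 := c_gt0; have s0 := s_gt0; have e1 := sc1.
case=> tt; rewrite tt ?mulr0z ?mulrN1z in up1 lo1; [left|right].
  have : (c - s) * (c + s) = 0 by lra.
  by move/eqP; rewrite mulf_eq0 => /orP[] /eqP ?; lra.
have : (2 * c - 1) * (2 * c + 1) = 0 by lra.
by move/eqP; rewrite mulf_eq0 => /orP[] /eqP ?; lra.
Qed.

(** For [theta = pi / 3] the notch has the size of the obtuse angle of a tile,
    which lies between its leg and its short base. *)
Lemma notch_third i j : d j = -1 -> d j.+1 = 1 -> r j.+1 = top j ->
  2 * c = 1 -> placed i (up j.+1) (Leg, true) -> placed i (turn (up j) 1) (Short, true).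
Proof.
move=> dj dj1 rj c2 pl x y.
have cE : c = 2^-1 by lra.
have ss z : s * (s * z) = 3 / 4 * z.
  by rewrite mulrA; congr (_ * _); move: (sc1); rewrite cE; lra.
have [ssx ssy] := (ss x, ss y).
have := pl (- x / 2 + s * y) (s * x + y / 2).
have [-> ->] := downE x y dj.
have [-> ->] := upE (- x / 2 + s * y) (s * x + y / 2) dj1.
have -> : r j.+1 + c * (- x / 2 + s * y) + s * (s * x + y / 2) = top j + c * x + s * y.
  by rewrite rj cE; lra.
have -> : j.+1%:R * s + s * (- x / 2 + s * y) - c * (s * x + y / 2) = j.+1%:R * s - s * x + c * y.
  by rewrite cE; lra.
move=> [-> ->]; rewrite /shape /sshape /eframe /= !px_turn !py_turn /px /py /len /= cE.
by split; (congr trap || congr strap); lra.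
Qed.

Section Upright.
Hypothesis kf : kap = false.
(** A unit line that starts with a [good] side is the desired contradiction, or
    yields the desired conclusion [G]. *)
Variables (good : edge -> bool) (G : Prop).
Hypothesis good_long : good (Long, true).
Hypothesis exact_word : forall t w, good t -> admissible (- tau (rev t)) w ->
  len s c a t + wlen s c a w = 1 -> G.
Hypothesis vert_word : forall w (t : nat), wlen s c a w = t%:R * s -> cnt Long w = 0%N.

(** At a notch some tile starts with a good side, or continues a strip. *)
Hypothesis notch : forall i i' t t' j, (j.+1 < M)%N -> d j = -1 -> d j.+1 = 1 ->
  r j.+1 = top j -> free i -> free i' -> placed i (up j.+1) t -> placed i' (turn (up j) 1) t' ->
  [\/ exists i, placed i (up j.+1) (Leg, false), exists i, placed i (turn (up j) 1) (Leg, false),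
      exists i t, [/\ free i, placed i (up j.+1) t & good t] |
      exists i t, [/\ free i, placed i (turn (up j) 1) t & good t]].

Let k0 : k = 0. Proof. by rewrite /k kf. Qed.

Lemma top_le j : (j < M)%N -> top j <= W - j.+1%:R * c.
Proof. by move=> jM; have [_ h _ _] := strip_in_big jM (st jM); move: h; rewrite k0 subr0 mul1r. Qed.

Lemma r_le j : (j < M)%N -> r j <= W - j%:R * c.
Proof. by move=> jM; have [h _ _ _] := strip_in_big jM (st jM); move: h; rewrite k0 subr0 mul1r. Qed.

(** This line is on the slanted leg of the large trapezoid, so that no free tile is
    beyond it. *)
Definition bordering j := d j = -1 /\ r j = W - j%:R * c.

Lemma border1 l j : run l j -> onborder l j -> l = j -> bordering j.
Proof.
move=> [_ jM _]; rewrite /onborder k0 subr0 !mul1r /top -natr1 => -[b1 b2] e; rewrite e in b1.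
have h : ((d j)%:~R + 1) * c = 0 by rewrite b1 in b2; lra.
move/eqP: h; rewrite mulf_eq0 (gt_eqF c_gt0) orbF addr_eq0 => /eqP h; split=> //.
by apply/eqP; rewrite -(eqr_int R) h rmorphN.
Qed.

(** A line that leans has length 1, and so has the chain along it. *)
Lemma chain_up i t j : (j < M)%N -> d j = 1 -> free i -> placed i (up j) t -> good t ->
  (forall i', ~ crosses T S free (up j) 1 i') -> G.
Proof.
move=> jM dj fi pl gt nc; have rn := run1 jM.
have nb : ~ onborder j j by move=> /(border1 rn)/(_ erefl)[]; rewrite dj.
have L1 : rlen j j = 1 by rewrite rlen1 dj.
have fr := front_up rn nb; rewrite L1 in fr.
have [w [i' [t' [h1 h2 _ _ _]]]] := chain_from s_gt0 c_gt0 a_gt0 sc1 tiles disj strips_dead strips_cover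
  ltr01 (up_ok jM) fr fi pl nc.
exact: exact_word h1 h2.
Qed.

Lemma chain_down i t j : (j < M)%N -> d j = -1 -> ~ bordering j -> free i ->
  placed i (turn (up j) 1) t -> good t ->
  (forall i', ~ crosses T S free (turn (up j) 1) 1 i') -> G.
Proof.
move=> jM dj nbj fi pl gt nc; have rn := run1 jM.
have nb : ~ onborder j j by move=> /(border1 rn)/(_ erefl).
have L1 : rlen j j = 1 by rewrite rlen1 dj.
have fr := front_down rn nb; rewrite L1 in fr.
have fo : okf (turn (up j) 1) by apply: okf_turn; exact: up_ok.
have [w [i' [t' [h1 h2 _ _ _]]]] := chain_from s_gt0 c_gt0 a_gt0 sc1 tiles disj strips_dead strips_cover
  ltr01 fo fr fi pl nc.
exact: exact_word h1 h2.
Qed.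

(** What is known at the bottom of the row [j]: either a vertical run that is
    enclosed from below (possibly empty, when the row itself is), or a notch
    with a tile that starts along the side of the row, or a peak that a tile
    placed along the side of the previous row overhangs. *)
Definition status j :=
  [\/ exists2 l, run l j & closed_below l,
      d j = 1 /\ exists i t, [/\ free i, placed i (up j) t & good t] |
      exists j', [/\ j = j'.+1, d j' = 1, d j = -1, r j = top j' &
        exists i, crosses T S free (up j') 1 i]].

(** In two rows that meet, the lines lean in opposite directions. *)
Lemma run_slanted l j : run l j -> d j != 0 -> l = j.
Proof.
move=> [lj jM h] dn; apply/eqP; rewrite eqn_leq lj leqNgt; apply/negP => ltlj.
have := h j.-1 ltac:(lia); rewrite prednK; last by lia.
case=> e1 e2; have := tie_upright (j := j.-1); rewrite prednK; last by lia.
by move=> /(_ jM e2 kf); rewrite -e1 => e3; move: dn; lia.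
Qed.

Lemma status_border j : (j < M)%N -> status j -> bordering j -> j = 0%N.
Proof.
move=> jM sj [dj rj]; case: sj => [[l rn cb]|[dj1 _]|[j' [e d1 _ r1 [i cr]]]].
- have lj := run_slanted rn ltac:(by rewrite dj); rewrite lj in cb.
  case: cb => [/eqP //|[j0 cb]]; have := top_le (j := j.-1) ltac:(lia).
  by rewrite prednK // -rj leNgt cb.
- by rewrite dj in dj1.
have [fi _ hS] := cr.
have [e' e0 Si] := ev_ex (hS c s s_gt0).
have [e1 e2] := upE (1 + e' * c) (e' * s) d1.
have /cover/and4P[_ _ _] : exists i, T i (px (up j') (1 + e' * c) (e' * s)) (py (up j') (1 + e' * c) (e' * s)).
  by exists i; exact: (S_T tiles).
rewrite e1 e2 -/W kf subr0 mul1r => hB; exfalso.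
have q : r j' + c = W - j%:R * c by rewrite -rj r1 /top d1 mulr1z mul1r.
have js : j%:R * s = j'%:R * s + s by rewrite e jsE.
have es : 0 < e' * s by rewrite mulr_gt0.
have hW : W * s = (r j' + c) * s + j%:R * s * c by rewrite q; ring.
rewrite hW js in hB.
have hh1 : e' * s * (s * s + c * c) <= 0 by lra.
by move: hh1; rewrite sc1 mulr1; lra.
Qed.

Lemma notch_first j : (j.+1 < M)%N -> d j = -1 -> d j.+1 = 1 -> r j.+1 = top j -> ~ bordering j ->
  exists i i' t t', [/\ free i, free i', placed i (up j.+1) t & placed i' (turn (up j) 1) t'].
Proof.
move=> jM dj dj1 rj nbj; have jM' := ltnW jM.
have rn := run1 jM'; have rn1 := run1 jM.
have nb : ~ onborder j j by move=> /(border1 rn)/(_ erefl).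
have nb1 : ~ onborder j.+1 j.+1 by move=> /(border1 rn1)/(_ erefl)[]; rewrite dj1.
have L1 : rlen j j = 1 by rewrite rlen1 dj.
have L2 : rlen j.+1 j.+1 = 1 by rewrite rlen1 dj1.
have fr := front_down rn nb; rewrite L1 in fr.
have fr1 := front_up rn1 nb1; rewrite L2 in fr1.
have fo : okf (turn (up j) 1) by apply: okf_turn; exact: up_ok.
(* A code lower than that of the angle of the notch, so that the directions
   beyond it are those of the other strip. *)
pose z : R := - (2 * (c * c))^-1.
have zE : z * (2 * (c * c)) = -1 by rewrite mulNr mulVf // gt_eqF // !mulr_gt0.
have key vx vy : 0 < vy -> vx * s < vy * (z * c) ->
   vx < 0 /\ vx * (2 * s * c) + vy * (s * s - c * c) <= 0.
  move=> vy0 hv; have z0 : z < 0 by rewrite oppr_lt0 invr_gt0 !mulr_gt0.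
  have h1 : vy * (z * c) < 0 by rewrite pmulr_rlt0 // pmulr_llt0.
  split; first by rewrite -(pmulr_llt0 _ s_gt0); lra.
  have h2 : 2 * c * (vx * s) <= 2 * c * (vy * (z * c)) by rewrite ler_pM2l ?mulr_gt0 // ltW.
  have h3 : 2 * c * (vy * (z * c)) = - vy by transitivity (vy * (z * (2 * (c * c)))); [ring|rewrite zE mulrN1].
  have h4 : 0 < vy * (c * c) by rewrite !mulr_gt0.
  have h5 : vy * (s * s + c * c) = vy by rewrite sc1 mulr1.
  by lra.
have ob1 : opening s c Dead (up j.+1) z.
  move=> vx vy vy0 hv; have [k1 k2] := key vx vy vy0 hv.
  have e1 : ev (fun e => 0 < s + (s * vx - c * vy) * e) by apply: ev_lin; left.
  apply: (ev_imp e1) => e e0 q; rewrite /deadf.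
  have [-> ->] := upE (e * vx) (e * vy) dj1; rewrite rj jsE.
  have h0 : s * (e * vx) - c * (e * vy) <= 0.
    have : 0 <= e * (s * - vx + c * vy).
      by rewrite mulr_ge0 ?ltW // addr_gt0 // mulr_gt0 // oppr_gt0.
    by lra.
  apply: (run_dead rn); rewrite ?jsE; [lra|lra|].
  rewrite /right_of dj mulrN1z /top dj mulrN1z.
  have : e * (vx * (2 * s * c) + vy * (s * s - c * c)) <= 0 by rewrite pmulr_rle0.
  by lra.
have ob2 : opening s c Dead (turn (up j) 1) z.
  move=> vx vy vy0 hv; have [k1 k2] := key vx vy vy0 hv.
  have e1 : ev (fun e => 0 < s + (s * vx - c * vy) * e) by apply: ev_lin; left.
  apply: (ev_imp e1) => e e0 q; rewrite /deadf.
  have [-> ->] := downE (e * vx) (e * vy) dj.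
  have h0 : s * (e * vx) - c * (e * vy) <= 0.
    have : 0 <= e * (s * - vx + c * vy).
      by rewrite mulr_ge0 ?ltW // addr_gt0 // mulr_gt0 // oppr_gt0.
    by lra.
  apply: (run_dead rn1); rewrite ?(jsE j.+1); [lra|lra|].
  rewrite /right_of dj1 mulr1z rj.
  have : e * (vx * (2 * s * c) + vy * (s * s - c * c)) <= 0 by rewrite pmulr_rle0.
  by lra.
have [i [t [fi pl _]]] := start_tile s_gt0 c_gt0 a_gt0 sc1 tiles strips_dead strips_cover (up_ok jM) ltr01 fr1 ob1.
have [i' [t' [fi' pl' _]]] := start_tile s_gt0 c_gt0 a_gt0 sc1 tiles strips_dead strips_cover fo ltr01 fr ob2.
by exists i, i', t, t'.
Qed.

(** The first tile has an acute angle at the lower end, hence starts with a leg or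
    with a long base; the leg would continue the strip. *)
Lemma good_up j : (j < M)%N -> d j = 1 -> closed_below j ->
  exists i t, [/\ free i, placed i (up j) t & good t].
Proof.
move=> jM dj cb; have rn := run1 jM.
have nb : ~ onborder j j by move=> /(border1 rn)/(_ erefl)[]; rewrite dj.
have [L0 _ _] := rlenE rn.
have [i [t [fi pl tt]]] := start_tile s_gt0 c_gt0 a_gt0 sc1 tiles strips_dead strips_cover (up_ok jM) L0
  (front_up rn nb) (open_below jM cb).
exists i, t; split=> //; move: tt; rewrite dj ler_int.
by case: t pl => -[] [] // pl _; have := no_leg_up jM dj pl.
Qed.

Lemma good_down j : (j < M)%N -> d j = -1 -> ~ bordering j -> closed_above j ->
  exists i t, [/\ free i, placed i (turn (up j) 1) t & good t].
Proof.
move=> jM dj nbj ca; have rn := run1 jM.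
have nb : ~ onborder j j by move=> /(border1 rn)/(_ erefl).
have fo : okf (turn (up j) (rlen j j)) by apply: okf_turn; exact: up_ok.
have [L0 _ _] := rlenE rn.
have [i [t [fi pl tt]]] := start_tile s_gt0 c_gt0 a_gt0 sc1 tiles strips_dead strips_cover fo L0
  (front_down rn nb) (open_above rn ca).
rewrite rlen1 dj in pl; exists i, t; split=> //; move: tt; rewrite dj opprK ler_int.
by case: t pl => -[] [] // pl _; have := no_leg_down jM dj pl.
Qed.

(** At a peak, a tile that overhangs along one line and a tile that overhangs along
    the other have common interior points, so they are the same; but this tile
    lies beyond the first line and has points on both sides of it. *)
Lemma status_nocross j : (j < M)%N -> d j = -1 -> status j ->
  forall i, ~ crosses T S free (turn (up j) 1) 1 i.
Proof.
move=> jM dj; case=> [[l rn cb]|[dj1 _]|[j' [e d1 _ r1 [i' cr]]]].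
- have lj := run_slanted rn ltac:(by rewrite dj); rewrite lj in cb.
  apply: (opening_nocross s_gt0 strips_dead (z := (d j)%:~R)).
  by rewrite turnK; exact: open_below.
- by rewrite dj in dj1.
move=> i cr'; have [fi' hT hS] := cr; have [fi hT' hS'] := cr'.
have V : r j + c * 0 + s * 0 = r j by ring.
have tj : top j + c = r j by rewrite /top dj mulrN1z; ring.
have tj' : r j' + c = r j by rewrite r1 /top d1 mulr1z; ring.
have yj : j'%:R * s + s = j%:R * s by rewrite e jsE.
have [x x0 [Sx [Sx' Sy]]] := ev_ex (ev_and (hS c s s_gt0) (ev_and (hS' c s s_gt0) (hS' (- s) c c_gt0))).
have ii : i' = i.
  apply: (disj Sx); move: (S_T tiles Sx').
  have [-> ->] := downE (1 + x * c) (x * s) dj; have [-> ->] := upE (1 + x * c) (x * s) d1.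
  have -> : top j + c * (1 + x * c) + s * (x * s) = r j' + c * (1 + x * c) + s * (x * s) by lra.
  have -> // : j.+1%:R * s - s * (1 + x * c) + c * (x * s) = j'%:R * s + s * (1 + x * c) - c * (x * s).
  by rewrite jsE; lra.
have := hT (1 + x * s) (- (x * c)).
have [-> ->] := upE (1 + x * s) (- (x * c)) d1.
have := S_T tiles Sy; have [-> ->] := downE (1 + x * - s) (x * c) dj; rewrite -ii.
have -> : top j + c * (1 + x * - s) + s * (x * c) = r j' + c * (1 + x * s) + s * - (x * c) by lra.
have -> : j.+1%:R * s - s * (1 + x * - s) + c * (x * c) = j'%:R * s + s * (1 + x * s) - c * - (x * c).
  by rewrite jsE; lra.
move=> Ti /(_ Ti); have := mulr_gt0 x0 c_gt0; lra.
Qed.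

(** No long base occurs on a vertical line, whose length is a multiple of [s]. So
    the first side is a short leg, and its tile continues the strip. *)
Lemma vertical_run l j : run l j -> d l = 0 -> closed_below l -> closed_above j -> False.
Proof.
move=> rn dl cb ca; have [lj jM _] := rn; have lM : (l < M)%N := leq_ltn_trans lj jM.
have [L0 L1 L2] := rlenE rn.
have [e1 e2] := runE rn (i := j) ltac:(by rewrite lj leqnn).
have nb : ~ onborder l j.
  rewrite /onborder k0 subr0 !mul1r /top e1 e2 dl mulr0z !(mul0r, mulr0, addr0) => -[-> h].
  have : (l%:R : R) * c < j.+1%:R * c by rewrite ltr_pM2r // ltr_nat ltnS.
  by lra.
have ob := open_below lM cb; have ob' := open_above rn ca; rewrite dl in ob ob'.
have fr := front_up rn nb.
have [i [t [fi pl tt]]] := start_tile s_gt0 c_gt0 a_gt0 sc1 tiles strips_dead strips_cover (up_ok lM) L0 fr ob.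
have [w [h1 h2 h3]] := closed_chain s_gt0 c_gt0 a_gt0 sc1 tiles disj strips_dead strips_cover L0 (up_ok lM) fr fi pl ob'.
have hl : wlen s c a (t :: w) = (j - l).+1%:R * s.
  by rewrite /wlen big_cons -/(wlen s c a w) h2 /rlen /elen dl.
have nl := vert_word hl.
have tt' : 0 <= tau t by move: tt; rewrite ler_int.
have := noLong_right nl _ _; rewrite /= tt' h1 => /(_ isT).
rewrite -oppr_ge0 => /(_ h3)/andP[tv _].
by apply: (no_vert_up (i := i) (t := t) lM dl) => //; case: (t) tv => -[].
Qed.

(** Going up by one row. A line that is enclosed from above gives a unit chain that
    starts with a good side, at one end or at the other according to the way it
    leans. If the next line starts where it ends, the two form a vertical run, a
    notch or a peak; at a peak either nothing overhangs and there is again a unit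
    chain, or a tile does, which settles the next row. *)
Lemma upright_step j : (j < M)%N -> status j ->
  (closed_above j -> G) /\ ((j.+1 < M)%N -> r j.+1 = top j -> G \/ status j.+1).
Proof.
move=> jM sj; case: (dP jM) => dj.
- case: (EM (bordering j)) => bj.
    have j0 := status_border jM sj bj; have [_ rj] := bj.
    have tj : top j = W - j.+1%:R * c by rewrite /top dj rj mulrN1z -natr1; ring.
    split.
      case=> [/eqP jM1|[jM1 h]]; first by move: M_gt1; rewrite -jM1 j0.
      by have := r_le jM1; rewrite leNgt -tj h.
    move=> jM1 e; have := tie_upright jM1 e kf; rewrite dj opprK => d1; exfalso.
    have := top_le jM1; rewrite /top d1 mulr1z e tj -natr1; move: (c_gt0); lra.
  have nc := status_nocross jM dj sj.
  split; first by move=> ca; have [i [t [fi pl gt]]] := good_down jM dj bj ca; exact: (chain_down jM dj bj fi pl gt).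
  move=> jM1 e; have := tie_upright jM1 e kf; rewrite dj opprK => d1.
  have [i [i' [t [t' [fi fi' pl pl']]]]] := notch_first jM1 dj d1 e bj.
  case: (notch jM1 dj d1 e fi fi' pl pl') => [[q pq]|[q pq]|h|[q [u [fq pq gq]]]].
  + by have := no_leg_up jM1 d1 pq.
  + by have := no_leg_down jM dj pq.
  + by right; apply: Or32.
  + by left; exact: (chain_down jM dj bj fq pq gq).
- have [l rn cb] : exists2 l, run l j & closed_below l.
    by case: sj => // [[dj1 _]|[j' [_ _ dj1 _ _]]]; rewrite dj in dj1.
  have [lj _ hr] := rn; have [e1 _] := runE rn (i := j) ltac:(by rewrite lj leqnn).
  have dl : d l = 0 by rewrite -e1.
  split; first by move=> ca; exfalso; exact: (vertical_run rn dl cb ca).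
  move=> jM1 e; have := tie_upright jM1 e kf; rewrite dj oppr0 => d1.
  right; apply: Or31; exists l => //; split=> //; first exact: leqW.
  move=> i /andP[li ij]; have [->|ne] := eqVneq i j; first by rewrite d1 dj.
  by apply: hr; lia.
have [i [t [fi pl gt]]] : exists i t, [/\ free i, placed i (up j) t & good t].
  case: sj => [[l rn cb]|[_ h] //|[j' [_ _ dj1 _ _]]]; last by rewrite dj in dj1.
  have lj := run_slanted rn ltac:(by rewrite dj); rewrite lj in cb.
  exact: good_up.
have L1 : rlen j j = 1 by rewrite rlen1 dj.
split.
  move=> ca; apply: (chain_up jM dj fi pl gt).
  by have := open_above (run1 jM) ca; rewrite L1; exact: (opening_nocross s_gt0 strips_dead).
move=> jM1 e; have := tie_upright jM1 e kf; rewrite dj => d1.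
case: (EM (exists i', crosses T S free (up j) 1 i')) => [h|h]; last first.
  by left; apply: (chain_up jM dj fi pl gt) => i' hi; apply: h; exists i'.
by right; apply: Or33; exists j; split.
Qed.

(** The bottom of the large trapezoid encloses the first line from below, and its
    top encloses the last one from above. *)
Lemma upright_forces : G.
Proof.
suff h j : (j < M)%N -> G \/ status j.
  have MM : (M.-1 < M)%N by lia.
  have [//|sj] := h _ MM; apply: (proj1 (upright_step MM sj)).
  by left; rewrite prednK //; lia.
elim: j => [|j IH] jM; first by right; apply: Or31; exists 0%N; [exact: run1|left].
have [//|sj] := IH (ltnW jM); first by left.
have [h1 h2] := upright_step (ltnW jM) sj.
case: (ltgtP (r j.+1) (top j)) => e; last exact: h2.
- by right; apply: Or31; exists j.+1; [exact: run1|right].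
- by left; apply: h1; right.
Qed.

End Upright.

End Strips.

(** * Angles with independent sine and cosine, [pi / 3] and [pi / 4] *)

Lemma square_prime (p : nat) (x y : int) : prime p -> x ^+ 2 = p%:Z * y ^+ 2 -> y = 0.
Proof.
move=> pp h; apply/eqP/negPn/negP => y0.
have e : (`|x| ^ 2 = p * `|y| ^ 2)%N by rewrite -!abszX h abszM.
have x0 : (0 < `|x|)%N.
  by have : (0 < `|x| ^ 2)%N; [rewrite e muln_gt0 prime_gt0 // expn_gt0 absz_gt0 y0|rewrite expn_gt0 orbF].
have y2 : (0 < `|y| ^ 2)%N by rewrite expn_gt0 absz_gt0 y0.
have := congr1 (logn p) e; rewrite lognX (lognM _ (prime_gt0 pp) y2).
have lp : logn p p = 1%N by rewrite logn_prime // eqxx.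
by rewrite lognX lp; lia.
Qed.

Lemma irrational_combination (R : archiRealFieldType) (s : R) (x y : int) (p q : nat) :
  prime p -> (0 < q)%N -> (q%:R * s) ^+ 2 = p%:R -> x%:~R + y%:~R * s = 0 -> y = 0.
Proof.
move=> pp q0 sq h; apply: (@square_prime p (q%:Z * x) y pp).
have xs : x%:~R = - (y%:~R * s) :> R by lra.
apply/eqP; rewrite -(eqr_int R) !expr2 !rmorphM /= -!pmulrn -sq xs; apply/eqP.
by rewrite expr2; ring.
Qed.

(** A short base has an obtuse angle, beside which only the acute angle of a long
    base fits, unless it is at an end of the word; the code [z] accounts for the
    first end. *)
Lemma count_short w (z : int) : cnt Leg w = 0%N -> cnt Vert w = 0%N -> -1 <= z -> z <= 1 ->
  admissible z w -> (cnt Short w)%:Z <= 1 - z + (cnt Long w)%:Z.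
Proof.
elim: w z => [|[[] []] w IH] z; rewrite /cnt /= ?add1n ?add0n //; try lia.
all: move=> l0 v0 z1 z2 /andP[zt ad].
all: have := IH _ l0 v0 _ _ ad => /(_ isT isT); rewrite /cnt; lia.
Qed.

Section Cases.
Variables (R : archiRealFieldType) (s c a N : R).
Hypotheses (s_gt0 : 0 < s) (c_gt0 : 0 < c) (a_gt0 : 0 < a) (sc1 : s * s + c * c = 1).
Hypothesis N_gt1 : 1 < N.
Variables (n : nat) (T S : 'I_n -> R -> R -> bool).
Hypothesis tiles : forall i, tile s c a (T i) (S i).
Hypothesis disj : forall (i i' : 'I_n) x y, S i x y -> T i' x y -> i = i'.
Hypothesis cover : forall x y, trap s c a (x / N) (y / N) <-> exists i, T i x y.
Hypothesis Nn : N ^+ 2 = n%:R.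

Let N_gt0 : 0 < N := lt_trans ltr01 N_gt1.

Lemma natural_ratio : exists2 M : nat, (1 < M)%N & N = M%:R.
Proof.
have [M NM] := ratio_natural s_gt0 c_gt0 a_gt0 N_gt1
  (big_side s_gt0 c_gt0 a_gt0 sc1 tiles disj N_gt0 cover) Nn.
by exists M => //; rewrite -(ltr_nat R) -NM.
Qed.

(** The equation of [short_side] solved for [a], where [N] is now an integer. *)
Lemma short_base : exists D x y w : nat, (0 < D)%N /\
  D%:R * a = x%:R + y%:R * s + w%:R * c.
Proof.
have [M M1 NM] := natural_ratio.
have [x [y [z [w [h pos]]]]] := short_side s_gt0 c_gt0 a_gt0 N_gt1
  (big_side s_gt0 c_gt0 a_gt0 sc1 tiles disj N_gt0 cover).
have p : 0 < x%:R + y%:R * s + w%:R * c.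
  have x0 : 0 <= x%:R :> R by [].
  have y0 : 0 <= y%:R * s by rewrite mulr_ge0 // ltW.
  have w0 : 0 <= w%:R * c by rewrite mulr_ge0 // ltW.
  case: (posnP x) => hx; last by have : 0 < x%:R :> R by [rewrite ltr0n]; lra.
  case: (posnP y) => hy; last by have : 0 < y%:R * s by [rewrite mulr_gt0 ?ltr0n]; lra.
  have : 0 < w%:R * c by rewrite mulr_gt0 // ltr0n; move: pos; rewrite hx hy.
  lra.
have e : (M%:R - (z + w)%:R) * a = x%:R + y%:R * s + w%:R * c.
  by rewrite natrD -NM; lra.
have zw : (z + w < M)%N.
  rewrite -(ltr_nat R) -subr_gt0 -(pmulr_lgt0 _ a_gt0) e //.
exists (M - (z + w))%N, x, y, w; rewrite subn_gt0; split=> //.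
by rewrite natrB ?(ltnW zw).
Qed.

(** The rows are those of a large trapezoid whose size [M] is an integer. *)
Lemma big_upright M x y : N = M%:R -> big s c a false M x y <-> exists i, T i x y.
Proof.
move=> NM; rewrite -cover NM /big /trap.
have M0 : 0 < M%:R :> R by rewrite -NM.
have Mi : 0 < M%:R^-1 :> R by rewrite invr_gt0.
have e1 : (0 <= y / M%:R) = (0 <= y) by rewrite pmulr_lge0.
have e2 : (y / M%:R <= s) = (y <= M%:R * s) by rewrite ler_pdivrMr // mulrC.
have e3 : (0 <= x / M%:R) = (0 * y * c <= x * s) by rewrite pmulr_lge0 // !mul0r pmulr_lge0.
have e4 : (x / M%:R * s + y / M%:R * c <= (a + c) * s) =
    (x * s + (1 - 0) * y * c <= M%:R * (a + c) * s).
  rewrite -(ler_pM2r M0); congr (_ <= _); last by ring.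
  by field; rewrite gt_eqF.
by rewrite e1 e2 e3 e4.
Qed.

(** The notch is settled by [notch_acute]: one of the two tiles has an acute angle
    there, with a leg or a long base, or the angle is [pi / 3] and the obtuse
    angle of a leg is also that of a short base. *)
Lemma upright_case (good : edge -> bool) (G : Prop) :
  good (Long, true) ->
  (forall t w, good t -> admissible (- tau (rev t)) w -> len s c a t + wlen s c a w = 1 -> G) ->
  (forall w (t : nat), wlen s c a w = t%:R * s -> cnt Long w = 0%N) ->
  (2 * c = 1 /\ (forall t, t.1 <> Leg -> good t) \/
   [/\ 2 * c <> 1, c <> s & forall b, good (Long, b)]) -> G.
Proof.
move=> g1 g2 g3 g4; have [M M1 NM] := natural_ratio.
have cov x y := big_upright x y NM.
have [m [r [d [J h]]]] := strip_max s_gt0 c_gt0 a_gt0 M1 cov.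
have st j jM := proj1 (h j jM); have mx j jM := proj2 (h j jM).
apply: (upright_forces s_gt0 c_gt0 a_gt0 sc1 tiles disj M1 cov st mx erefl g1 g2 g3).
move=> i i' t t' j jM dj dj1 rj fi fi' pl pl'.
case: g4 => [[c2 gl]|[nc2 ncs gl]].
  case: t pl => -[] b pl; try by apply: Or43; exists i; eexists; split; [|exact: pl|exact: gl].
  case: b pl => pl; last by apply: Or41; exists i.
  apply: Or44; exists i, (Short, true); split=> //; last exact: gl.
  exact: (notch_third sc1 dj dj1 rj c2 pl).
have [gt|gt] := boolP (good t); first by apply: Or43; exists i, t.
have [gt'|gt'] := boolP (good t'); first by apply: Or44; exists i', t'.
case et : t pl gt => [k b] pl gt; case et' : t' pl' gt' => [k' b'] pl' gt'.
have [t0|t0] := leP (tau t) 0; last first.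
  move: t0; rewrite et; case: k b gt pl {et} => -[] // gt pl _; last by move: gt; rewrite gl.
  by apply: Or41; exists i.
have [t0'|t0'] := leP (tau t') 0; last first.
  move: t0'; rewrite et'; case: k' b' gt' pl' {et'} => -[] // gt' pl' _; last by move: gt'; rewrite gl.
  by apply: Or42; exists i'.
rewrite -et in pl; rewrite -et' in pl'.
by case: (notch_acute s_gt0 c_gt0 a_gt0 sc1 tiles disj dj dj1 rj pl pl' t0 t0').
Qed.

(** Substituting [short_base] for [a], a long base contributes a positive multiple
    of [c]. *)
Lemma long_dependent w (t t' : nat) : (0 < cnt Long w)%N ->
  wlen s c a w = t%:R + t'%:R * s ->
  exists x y z : int, z != 0 /\ z%:~R * c = x%:~R + y%:~R * s.
Proof.
rewrite wlenE => l0 h; have [D [x [y [v [D0 e]]]]] := short_base.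
pose p := cnt Leg w; pose q := cnt Vert w; pose u := (cnt Short w + cnt Long w)%N.
exists (D%:Z * (t%:Z - p%:Z) - u%:Z * x%:Z), (D%:Z * (t'%:Z - q%:Z) - u%:Z * y%:Z),
  (u * v + D * cnt Long w)%N%:Z; split.
  by rewrite eqz_nat -lt0n addn_gt0 [(0 < D * _)%N]muln_gt0 D0 l0 orbT.
have h' : D%:R * (p%:R + q%:R * s + u%:R * a + (cnt Long w)%:R * c) = D%:R * (t%:R + t'%:R * s).
  by rewrite -h /p /q /u natrD; ring.
have e' : u%:R * (D%:R * a) = u%:R * (x%:R + y%:R * s + v%:R * c) by rewrite e.
move: h' e'; rewrite /u natrD !(rmorphB, rmorphM, rmorphD) /= -!pmulrn.
by lra.
Qed.

(** By [long_dependent], a word with a long base has a length that is neither 1 nor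
    a multiple of [s]; take the long bases as good sides. *)
Lemma independent_case :
  (forall x y z : int, z != 0 -> z%:~R * c <> x%:~R + y%:~R * s) -> False.
Proof.
move=> ind; apply: (@upright_case (fun t => is_side Long t) False) => //.
- move=> t w gt _ h.
  have l0 : (0 < cnt Long (t :: w))%N by rewrite /cnt -[count _ _]/(is_side Long t + cnt Long w)%N (gt : is_side Long t).
  have h' : wlen s c a (t :: w) = 1%:R + 0%:R * s.
    by rewrite /wlen big_cons -/(wlen s c a w) h mul0r addr0.
  by have [x [y [z [z0 e]]]] := long_dependent l0 h'; exact: (ind _ _ _ z0 e).
- move=> w t h; apply/eqP; rewrite eqn0Ngt; apply/negP => l0.
  have h' : wlen s c a w = 0%:R + t%:R * s by rewrite h add0r.
  by have [x [y [z [z0 e]]]] := long_dependent l0 h'; exact: (ind _ _ _ z0 e).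
right; split=> [e|e|b].
- by apply: (ind 1 0 2%:Z) => //; rewrite mul0r addr0.
- by apply: (ind 0 1 1) => //; rewrite e add0r.
- by [].
Qed.

(** Take the bases and the short leg as good sides. By irrationality of [s], a word
    of length 1 contains no short leg; there is no room for a leg beside a good
    side. So the word consists of bases, at most one of them long, and
    [count_short] leaves few possibilities, each of which determines [a]. *)
Lemma third_case : 2 * c = 1 -> a \in [:: 1; 1 / 2; 1 / 4; 1 / 6; 1 / 8].
Proof.
move=> c2; have [D [x [y [v [D0 e]]]]] := short_base.
have cE : c = 1 / 2 by lra.
have ss : (2%:R * s) ^+ 2 = 3%:R by rewrite expr2; have := sc1; rewrite cE; lra.
have irr p q : p%:~R + q%:~R * s = 0 -> q = 0 := @irrational_combination R s p q 3 2 isT isT ss.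
have De : 2 * D%:R * a = 2 * x%:R + v%:R + 2 * y%:R * s by move: e; rewrite cE; lra.
have coeff w (t t' : nat) : wlen s c a w = t%:R + t'%:R * s ->
    (2 * D * cnt Vert w + (cnt Short w + cnt Long w) * (2 * y) = 2 * D * t')%N /\
    (2 * D * cnt Leg w + (cnt Short w + cnt Long w) * (2 * x + v) + D * cnt Long w = 2 * D * t)%N.
  rewrite wlenE => hw; pose u := (cnt Short w + cnt Long w)%N; rewrite -/u.
  have h' : 2 * D%:R * ((cnt Leg w)%:R + (cnt Vert w)%:R * s + u%:R * a + (cnt Long w)%:R / 2) =
      2 * D%:R * (t%:R + t'%:R * s).
    by rewrite -hw /u natrD cE; field.
  have e' : u%:R * (2 * D%:R * a) = u%:R * (2 * x%:R + v%:R + 2 * y%:R * s) by rewrite De.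
  have z : (2 * D * cnt Vert w + u * (2 * y))%N%:Z - (2 * D * t')%N%:Z = 0.
    apply: (irr ((2 * D * cnt Leg w + u * (2 * x + v) + D * cnt Long w)%N%:Z - (2 * D * t)%N%:Z)).
    rewrite !rmorphB /= -!pmulrn !(natrD, natrM); move: h' e'; rewrite /u natrD; lra.
  have z' : (2 * D * cnt Vert w + u * (2 * y))%N = (2 * D * t')%N by lia.
  split=> //; apply/eqP; rewrite -(eqr_nat R); apply/eqP.
  have zR : (2 * D * cnt Vert w + u * (2 * y))%N%:R = (2 * D * t')%N%:R :> R by rewrite z'.
  move: zR h' e'; rewrite /u !(natrD, natrM) => zR.
  by have := congr1 (fun q => q * s) zR; lra.
apply: (@upright_case (fun t => ~~ is_side Leg t)) => //.
- move=> t w gt ad h.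
  have hw : wlen s c a (t :: w) = 1%:R + 0%:R * s.
    by rewrite /wlen big_cons -/(wlen s c a w) h mul0r addr0.
  have [h1 _] := coeff _ _ _ hw.
  have v0 : cnt Vert (t :: w) = 0%N by move: D0 h1; nia.
  have lt := len_gt0 s_gt0 c_gt0 a_gt0 t.
  have pos k : 0 <= (cnt k w)%:R :> R by [].
  have l0 : cnt Leg (t :: w) = 0%N.
    rewrite /cnt -[count _ _]/(is_side Leg t + cnt Leg w)%N (negbTE gt) add0n.
    have : wlen s c a w < 1 by lra.
    rewrite wlenE => hl; apply/eqP; rewrite -leqn0 -ltnS -(ltr_nat R).
    have := mulr_ge0 (pos Vert) (ltW s_gt0); have := mulr_ge0 (pos Short) (ltW a_gt0).
    have := mulr_ge0 (pos Long) (ltW (addr_gt0 a_gt0 c_gt0)); lra.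
  have t1 : -1 <= tau t by case: (t) => -[] [].
  have ad1 : admissible (-1) (t :: w) by rewrite /= t1.
  have := count_short (z := -1) l0 v0 isT isT ad1.
  move: hw; rewrite wlenE l0 v0 !mul0r !add0r addr0.
  rewrite cE; move: (cnt Short _) (cnt Long _) => p q hw hc.
  have a0 := a_gt0; have p0 : 0 <= p%:R * a by rewrite mulr_ge0 // ltW.
  have q1 : (q <= 1)%N.
    rewrite -ltnS -(ltr_nat R) ltNge; apply/negP => q2.
    have : 2 * (a + 1 / 2) <= q%:R * (a + 1 / 2) by rewrite ler_pM2r //; lra.
    by lra.
  have {hc} hp : (p <= 2 + q)%N by move: hc; clear; lia.
  have : [\/ a = 1, a = 1 / 2, a = 1 / 4 | a = 1 / 6 \/ a = 1 / 8].
    case: q q1 hp hw {p0} => [|[|]] // _; case: p => [|[|[|[|]]]] // _ hw; try by exfalso; lra.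
    - by apply: Or41; lra.
    - by apply: Or42; lra.
    - by apply: Or42; lra.
    - by apply: Or43; lra.
    - by apply: Or44; left; lra.
    - by apply: Or44; right; lra.
  by case=> [->|->|->|[->|->]]; rewrite !inE eqxx ?orbT.
- move=> w t h.
  have hw : wlen s c a w = 0%:R + t%:R * s by rewrite h add0r.
  by have [_ h2] := coeff _ _ _ hw; move: D0 h2; nia.
by left; split=> // -[[] b].
Qed.

(** Use the strips along the long leg, in the reflected dissection. A word with a
    long base has an irrational length, since the coefficients in [short_base] are
    nonnegative. *)
Lemma quarter_case : c = s -> a = c.
Proof.
move=> cs; apply/eqP/negPn/negP => ac; have [D [x [y [v [D0 e]]]]] := short_base.
have [M M1 NM] := natural_ratio.
have ss : (2%:R * s) ^+ 2 = 2%:R by rewrite expr2; have := sc1; rewrite cs; lra.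
pose T' i x y := T i (M%:R * (a + c) - x) y; pose S' i x y := S i (M%:R * (a + c) - x) y.
have tiles' i : tile s c a (T' i) (S' i).
  have [g [go hg]] := tiles i.
  pose f := Frame (M%:R * (a + c)) 0 (-1) 0 (-1 : R).
  have fo : okf f by split=> /=; ring.
  exists (compf g f); split; first exact: okf_comp.
  move=> u w; rewrite (px_comp f u w go) (py_comp f u w go).
  have -> : px f u w = M%:R * (a + c) - u by rewrite /px /=; ring.
  by have -> : py f u w = w by [rewrite /py /=; ring]; exact: hg.
have disj' (i i' : 'I_n) u w : S' i u w -> T' i' u w -> i = i' by exact: disj.
have cov' u w : big s c a true M u w <-> exists i, T' i u w.
  rewrite -(big_upright _ _ NM) /big /=.
  have -> : (0 * w * c <= (M%:R * (a + c) - u) * s) =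
     (u * s + (1 - 1) * w * c <= M%:R * (a + c) * s).
    by rewrite -subr_ge0 -[RHS]subr_ge0; congr (0 <= _); ring.
  have -> : ((M%:R * (a + c) - u) * s + (1 - 0) * w * c <= M%:R * (a + c) * s) =
     (1 * w * c <= u * s).
    by rewrite -subr_ge0 -[RHS]subr_ge0; congr (0 <= _); ring.
  by split=> /and4P[h1 h2 h3 h4]; apply/and4P.
have [m [r [d [J h]]]] := strip_max s_gt0 c_gt0 a_gt0 M1 cov'.
have st j jM := proj1 (h j jM); have mx j jM := proj2 (h j jM).
apply: (slanted_impossible s_gt0 c_gt0 a_gt0 sc1 tiles' disj' M1 cov' st mx erefl ac (esym cs)).
move=> w t l0; rewrite wlenE => hw.
pose p := cnt Leg w; pose q := cnt Vert w; pose u := (cnt Short w + cnt Long w)%N.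
have : (u%:Z * x%:Z + D%:Z * p%:Z - D%:Z * t%:Z)%:~R +
    (D * q + u * (y + v) + D * cnt Long w)%N%:Z%:~R * s = 0.
  have h' : D%:R * (p%:R + q%:R * s + u%:R * a + (cnt Long w)%:R * c) = D%:R * t%:R.
    by rewrite -hw /p /q /u natrD; ring.
  have e' : u%:R * (D%:R * a) = u%:R * (x%:R + y%:R * s + v%:R * c) by rewrite e.
  move: h' e'; rewrite cs /u natrD !(rmorphB, rmorphM, rmorphD) /= -!pmulrn.
  by lra.
move/(@irrational_combination R s _ _ 2 2 isT isT ss); apply/eqP.
by rewrite eqz_nat -lt0n !addn_gt0 [(0 < D * cnt Long w)%N]muln_gt0 D0 l0 !orbT.
Qed.

End Cases.

(** * Rational angles with dependent sine and cosine *)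

Section RationalAngle.
Variable R : rcfType.
Implicit Types (c s x y : R) (p q : rat).
Local Open Scope complex_scope.

Lemma complex_eqP x y x' y' : x +i* y = x' +i* y' -> x = x' /\ y = y'.
Proof. by case. Qed.

(** A root of unity with a rational real part [r]: the real parts of its powers
    satisfy a linear recurrence whose numerators, over the powers of the
    denominator of [2 r], stay prime to it; periodicity makes it 1. *)
Lemma niven m x y q : (0 < m)%N -> x ^+ 2 + y ^+ 2 = 1 -> (x +i* y) ^+ m = 1 ->
  2 * x = ratr q -> exists z : int, 2 * x = z%:~R.
Proof.
move=> m0 xy wm xq; set w := x +i* y in wm.
have w2 : w ^+ 2 = (2 * x)%:C * w - 1.
  apply/eqP; rewrite expr2 /w eq_complex /=; apply/andP; split; apply/eqP; last by ring.
  by move: xy; rewrite !expr2; lra.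
pose C k := complex.Re (w ^+ k).
have rec k : C k.+2 = 2 * x * C k.+1 - C k.
  rewrite /C !exprS mulrA -expr2 w2 mulrBl mul1r -mulrA.
  by move: (w * w ^+ k) (w ^+ k) => [u v] [u' v'] /=; ring.
pose den := denq q; pose nu := numq q.
have dn : (den%:~R : R) != 0 by rewrite intr_eq0 denq_neq0.
have xE : 2 * x * den%:~R = nu%:~R.
  rewrite xq -(ratr_int R) -rmorphM /= -[in RHS](ratr_int R); congr ratr.
  by rewrite /den /nu -[X in X * _]divq_num_den divfK // intr_eq0 denq_neq0.
have num k : exists z z' : int, [/\ 2 * C k * den%:~R ^+ k = z%:~R,
    2 * C k.+1 * den%:~R ^+ k.+1 = z'%:~R, 
    (0 < k)%N -> coprimez z den & coprimez z' den].
  elim: k => [|k [z [z' [h1 h2 h3 h4]]]].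
    exists 2, nu; split=> //.
    - by rewrite /C expr0 /= expr0 !mulr1.
    - by rewrite /coprimez /gcdz -[_ == 1]/(coprime `|nu| `|den|) /nu /den coprime_num_den.
  exists z', (nu * z' - den ^+ 2 * z); split=> //.
    rewrite rec expr2 rmorphB !rmorphM /= -h1 -h2 -xE !exprS; ring.
  have cd : coprimez nu den.
    by rewrite /coprimez /gcdz -[_ == 1]/(coprime `|nu| `|den|) /nu /den coprime_num_den.
  have -> : nu * z' - den ^+ 2 * z = - (den * z) * den + nu * z' by ring.
  by rewrite coprimez_sym /coprimez gcdzMDl -/(coprimez _ _) coprimezMr !(coprimez_sym den) cd h4.
have [z [_ [h1 _ h2 _]]] := num m.
have Cm : C m = 1 by rewrite /C wm.
have zE : z = 2 * den ^+ m by apply/eqP; rewrite -(eqr_int R) -h1 Cm rmorphM rmorphXn /= mulr1.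
have : coprimez (den ^+ m) den.
  by have := h2 m0; rewrite zE coprimezMl => /andP[].
rewrite coprimez_pexpl // /coprimez gcdzz => /eqP d1.
exists nu; rewrite -xE /den -[denq q]absz_denq.
by move: d1; rewrite /den => ->; rewrite mulr1.
Qed.

(** The exponents of 2 on the two sides have different parities. *)
Lemma odd_twice_square (k : nat) q : odd k -> 2 * q ^+ 2 <> k%:R.
Proof.
move=> ko h; have dn : denq q != 0 by rewrite denq_neq0.
have e : (2 * `|numq q| ^ 2 = k * `|denq q| ^ 2)%N.
  apply/eqP; rewrite -(eqr_nat rat) !natrM !natr_absz !intr_norm -!normrM.
  rewrite !ger0_norm -?expr2 ?sqr_ge0 // -h -{2}(divq_num_den q).
  by apply/eqP; field; rewrite intr_eq0.
have k0 : (0 < k)%N by case: (k) ko.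
have d0 : (0 < `|denq q| ^ 2)%N by rewrite expn_gt0 absz_gt0 dn.
have n0 : (0 < `|numq q| ^ 2)%N.
  have : (0 < 2 * `|numq q| ^ 2)%N by rewrite e muln_gt0 k0.
  by rewrite muln_gt0.
have := congr1 (logn 2) e; rewrite (lognM _ (isT : 0 < 2)%N n0) (lognM _ k0 d0) !lognX.
have -> : logn 2 k = 0%N by rewrite lognE dvdn2 ko /= andbF.
have -> : logn 2 2 = 1%N by [].
by move: (logn 2 _) (logn 2 _) => u v; lia.
Qed.

(** ** Sine and cosine linearly dependent over the rationals *)

(** If [c] is irrational, so is [s], and [s] is quadratic over the rationals. Let
    [s'] be its conjugate and [c' = p + q s']: then [c' + i s'] is a root of unity
    too. The product of [c + i s] and [c' + i s'] is a root of unity with rational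
    coordinates [u] and [v], so that [u] or [v] is 0 by [niven]. If [v = 0], then
    [q = 0] and [c] is rational, hence 1/2. If [u = 0], then [q] is 1 or [-1] and
    [2 s c], the sine of the double angle, is rational; it is thus 1, which means
    [c = s], or 1/2, where [2 p ^ 2] would be an odd integer. *)
Lemma dependent_angle m c s p q : (0 < m)%N -> 0 < c -> 0 < s -> s * s + c * c = 1 ->
  (c +i* s) ^+ m = 1 -> c = ratr p + ratr q * s -> 2 * c = 1 \/ c = s.
Proof.
move=> m0 c0 s0 sc wm cE.
have cs1 : c ^+ 2 + s ^+ 2 = 1 by rewrite !expr2; lra.
have c1 : c < 1.
  have ss := mulr_gt0 s0 s0; rewrite ltNge; apply/negP => h.
  by have := ler_pM ler01 ler01 h h; lra.
have crat r : c = ratr r -> 2 * c = 1.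
  move=> cr; have [|z zE] := niven (q := 2 * r) m0 cs1 wm; first by rewrite rmorphM /= rmorph_nat -cr.
  have z1 : 0 < z by rewrite -(ltr_int R) -zE mulr_gt0.
  have z2 : z < 2 by rewrite -(ltr_int R) -zE; lra.
  by rewrite zE; have -> : z = 1 by lia.
have [[r sr]|irr] := EM (exists r, s = ratr r).
  by left; apply: (crat (p + q * r)); rewrite cE sr rmorphD rmorphM.
have lin u v : ratr u + ratr v * s = 0 -> v = 0 /\ u = 0.
  move=> h; have v0 : v = 0.
    apply/eqP/negPn/negP => vn; apply: irr; exists (- u / v).
    have vR : ratr v != 0 :> R by rewrite fmorph_eq0.
    by rewrite fmorph_div rmorphN; apply: (mulIf vR); rewrite divfK //; lra.
  by split=> //; move: h; rewrite v0 rmorph0 mul0r addr0 => /eqP; rewrite fmorph_eq0 => /eqP.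
pose Q := 1 + q ^+ 2; have Q0 : 0 < Q by rewrite ltr_pwDl // sqr_ge0.
pose al := - (2 * p * q) / Q; pose be := (1 - p ^+ 2) / Q.
have QR : ratr Q != 0 :> R by rewrite fmorph_eq0 gt_eqF.
have QE : ratr Q = 1 + ratr q * ratr q :> R by rewrite rmorphD rmorph1 rmorphXn expr2.
have alE : ratr al * ratr Q = - (2 * ratr p * ratr q) :> R.
  by rewrite -rmorphM divfK ?gt_eqF // rmorphN !rmorphM rmorph_nat.
have beE : ratr be * ratr Q = 1 - ratr p * ratr p :> R.
  by rewrite -rmorphM divfK ?gt_eqF // rmorphB rmorph1 rmorphXn expr2.
clearbody al be.
have s2 : s * s = ratr al * s + ratr be.
  apply: (mulfI QR); have : ratr Q * (s * s) = - (2 * ratr p * ratr q) * s + (1 - ratr p * ratr p).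
    by rewrite QE; move: sc; rewrite cE; lra.
  by rewrite -alE -beE => ->; ring.
pose s' := ratr al - s; pose c' := ratr p + ratr q * s'.
have s2' : s' * s' = ratr al * s' + ratr be by rewrite /s'; move: s2; lra.
have pows k : exists a b a' b' : rat,
   (c +i* s) ^+ k = (ratr a + ratr b * s) +i* (ratr a' + ratr b' * s) /\
   (c' +i* s') ^+ k = (ratr a + ratr b * s') +i* (ratr a' + ratr b' * s').
  elim: k => [|k [a [b [a' [b' [h1 h2]]]]]].
    by exists 1, 0, 0, 0; rewrite !expr0 !rmorph0 rmorph1 !mul0r !addr0.
  exists (p * a + (q * b - b') * be), (p * b + q * a - a' + (q * b - b') * al),
    (p * a' + (q * b' + b) * be), (p * b' + q * a' + a + (q * b' + b) * al).
  rewrite !exprS h1 h2 !(rmorphB, rmorphD, rmorphM) /=.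
  have key x y : x = ratr p + ratr q * y -> y * y = ratr al * y + ratr be ->
    (x +i* y) * ((ratr a + ratr b * y) +i* (ratr a' + ratr b' * y)) =
    (ratr p * ratr a + (ratr q * ratr b - ratr b') * ratr be +
      (ratr p * ratr b + ratr q * ratr a - ratr a' + (ratr q * ratr b - ratr b') * ratr al) * y) +i*
    (ratr p * ratr a' + (ratr q * ratr b' + ratr b) * ratr be +
      (ratr p * ratr b' + ratr q * ratr a' + ratr a + (ratr q * ratr b' + ratr b) * ratr al) * y).
    move=> -> h; apply/eqP; rewrite eq_complex /=; apply/andP; split; apply/eqP; ring: h.
  by split; apply: key.
have wm' : (c' +i* s') ^+ m = 1.
  have [a [b [a' [b' [h1 h2]]]]] := pows m; rewrite wm in h1; rewrite h2.
  have [r1 r2] := complex_eqP (x := 1) (y := 0) h1.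
  have [b0 a0] : b = 0 /\ a - 1 = 0 by apply: lin; rewrite rmorphB rmorph1; lra.
  have [b0' a0'] : b' = 0 /\ a' = 0 by apply: lin; lra.
  by rewrite b0 b0' a0' (_ : a = 1) ?rmorph1 ?rmorph0 ?mul0r ?addr0 //; lra.
pose u := (1 - q ^+ 2) / Q; pose v := - (2 * q) / Q.
have uE : ratr u * ratr Q = 1 - ratr q * ratr q :> R.
  by rewrite -rmorphM divfK ?gt_eqF // rmorphB rmorph1 rmorphXn expr2.
have vE : ratr v * ratr Q = - (2 * ratr q) :> R.
  by rewrite -rmorphM divfK ?gt_eqF // rmorphN rmorphM rmorph_nat.
clearbody u v.
have ss' : s * s' = - ratr be :> R by rewrite /s'; move: s2; lra.
have ssum : s + s' = ratr al by rewrite /s'; ring.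
have reE : c * c' - s * s' = ratr u.
  apply: (mulIf QR); rewrite uE /c' cE.
  transitivity ((ratr p * ratr p + ratr p * ratr q * (s + s') + (ratr q * ratr q - 1) * (s * s')) * ratr Q : R); first by ring.
  rewrite ss' ssum; transitivity (ratr p * ratr p * ratr Q + ratr p * ratr q * (ratr al * ratr Q) -
     (ratr q * ratr q - 1) * (ratr be * ratr Q) : R); first by ring.
  by rewrite alE beE QE; ring.
have imE : c * s' + s * c' = ratr v.
  apply: (mulIf QR); rewrite vE /c' cE.
  transitivity ((ratr p * (s + s') + 2 * ratr q * (s * s')) * ratr Q : R); first by ring.
  rewrite ss' ssum; transitivity (ratr p * (ratr al * ratr Q) - 2 * ratr q * (ratr be * ratr Q) : R); first by ring.
  by rewrite alE beE; ring.
have prodE : (c +i* s) * (c' +i* s') = ratr u +i* ratr v.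
  by rewrite -reE -imE; apply/eqP; rewrite eq_complex /=; apply/andP; split; apply/eqP; ring.
have wuv : (ratr u +i* ratr v : R[i]) ^+ m = 1 by rewrite -prodE exprMn wm wm' mulr1.
have uv1 : ratr u ^+ 2 + ratr v ^+ 2 = 1 :> R.
  apply: (mulIf QR); apply: (mulIf QR).
  transitivity ((ratr u * ratr Q) ^+ 2 + (ratr v * ratr Q) ^+ 2 : R); first by ring.
  by rewrite uE vE QE; ring.
(* Multiplying by [- i] exchanges the two coordinates for [niven]. *)
have turned x y : x ^+ 2 + y ^+ 2 = 1 -> (x +i* y) ^+ m = 1 ->
    y ^+ 2 + (- x) ^+ 2 = 1 /\ (y +i* (- x)) ^+ (4 * m) = 1.
  move=> h1 h2; split; first by rewrite sqrrN addrC.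
  have -> : y +i* (- x) = (x +i* y) * (0 +i* (-1)).
    by apply/eqP; rewrite eq_complex /=; apply/andP; split; apply/eqP; ring.
  rewrite exprMn mulnC exprM h2 expr1n mul1r mulnC exprM.
  have -> : (0 +i* (-1) : R[i]) ^+ 4 = 1; last by rewrite expr1n.
  have i2 : (0 +i* (-1) : R[i]) ^+ 2 = -1.
    by apply/eqP; rewrite expr2 eq_complex /=; apply/andP; split; apply/eqP; ring.
  by rewrite (exprM _ 2 2) i2 sqrrN expr1n.
have [|z1 z1E] := niven (q := 2 * u) m0 uv1 wuv; first by rewrite rmorphM /= rmorph_nat.
have [h1 h2] := turned _ _ uv1 wuv.
have m4 : (0 < 4 * m)%N by rewrite muln_gt0.
have [|z2 z2E] := niven (q := 2 * v) m4 h1 h2; first by rewrite rmorphM /= rmorph_nat.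
have z12 : z1 ^+ 2 + z2 ^+ 2 = 4.
  apply/eqP; rewrite -(eqr_int R) rmorphD !expr2 !rmorphM /= -z1E -z2E; apply/eqP.
  by move: uv1; rewrite !expr2; lra.
have z0 : z1 = 0 \/ z2 = 0.
  have b1 : -2 <= z1 <= 2 by apply/andP; split; nia.
  have b2 : -2 <= z2 <= 2 by apply/andP; split; nia.
  have : (z1 = -2 \/ z1 = -1 \/ z1 = 0 \/ z1 = 1 \/ z1 = 2) by lia.
  by case=> [|[|[|[|]]]] e; move: z12; rewrite e; nia.
case: z0 => z0; last first.
  left; apply: (crat p); rewrite cE.
  have v0 : ratr v = 0 :> R by move: z2E; rewrite z0; lra.
  by have -> : ratr q = 0 :> R; [move: vE; rewrite v0 mul0r; lra|rewrite mul0r addr0].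
have u0 : ratr u = 0 :> R by move: z1E; rewrite z0; lra.
have q2 : ratr q * ratr q = 1 :> R by move: uE; rewrite u0 mul0r; lra.
have qq : ratr q = 1 :> R \/ ratr q = -1 :> R.
  have : (ratr q - 1) * (ratr q + 1) = 0 :> R by move: q2; lra.
  by move/eqP; rewrite mulf_eq0 => /orP[] /eqP ?; [left|right]; lra.
have sc2 : 2 * (s * c) * ratr q = 1 - ratr p * ratr p.
  have : (c - ratr q * s) * (c - ratr q * s) = ratr p * ratr p by rewrite cE; ring.
  move: sc q2 => e1 e2 e3.
  have : ratr q * ratr q * (s * s) = s * s by rewrite e2 mul1r.
  lra.
have sc3 : 2 * (s * c) = ratr (q * (1 - p ^+ 2)).
  rewrite rmorphM rmorphB rmorph1 rmorphXn expr2 /= -sc2.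
  by transitivity (2 * (s * c) * (ratr q * ratr q)); [rewrite q2 mulr1|ring].
have w2 : ((c * c - s * s) +i* (2 * (s * c))) ^+ m = 1.
  have -> : (c * c - s * s) +i* (2 * (s * c)) = (c +i* s) ^+ 2.
    by apply/eqP; rewrite expr2 eq_complex /=; apply/andP; split; apply/eqP; ring.
  by rewrite -exprM mulnC exprM wm expr1n.
have n2 : (c * c - s * s) ^+ 2 + (2 * (s * c)) ^+ 2 = 1.
  by transitivity ((s * s + c * c) ^+ 2); [ring|rewrite sc expr1n].
have [h3 h4] := turned _ _ n2 w2.
have [|z zE] := niven (q := 2 * (q * (1 - p ^+ 2))) m4 h3 h4.
  by rewrite rmorphM /= rmorph_nat -sc3.
have p0 := mulr_gt0 s0 c0.
have csq : 0 <= (c - s) * (c - s) by rewrite -expr2 sqr_ge0.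
have z1' : 0 < z by rewrite -(ltr_int R) -zE; lra.
have z2' : z <= 2 by rewrite -(ler_int R) -zE; lra.
have : z = 1 \/ z = 2 by lia.
case=> e; rewrite e in zE; last first.
  right; have /eqP : (c - s) * (c - s) = 0 by lra.
  by rewrite mulf_eq0 orbb subr_eq0 => /eqP.
exfalso; have inj : injective (ratr : rat -> R) by exact: fmorph_inj.
case: qq => qE.
  apply: (@odd_twice_square 1 p) => //; apply: inj.
  by rewrite rmorphM rmorphXn !rmorph_nat expr2 /=; rewrite qE in sc2; lra.
apply: (@odd_twice_square 3 p) => //; apply: inj.
by rewrite rmorphM rmorphXn !rmorph_nat expr2 /=; rewrite qE in sc2; lra.
Qed.

End RationalAngle.

(** * The area of a dissected figure *)

Definition dist2 (R : realFieldType) (p q : R * R) := (p.1 - q.1) ^+ 2 + (p.2 - q.2) ^+ 2.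

Lemma dist2C (R : realFieldType) (p q : R * R) : dist2 p q = dist2 q p.
Proof. by rewrite /dist2; ring. Qed.

(** Bernoulli's inequality. *)
Lemma le1_bounded_powers (R : archiRealFieldType) (x C : R) : (forall j, x ^+ j <= C) -> x <= 1.
Proof.
move=> h; rewrite leNgt; apply/negP => x1; have e0 : 0 < x - 1 by rewrite subr_gt0.
have bern j : 1 + (x - 1) * j%:R <= x ^+ j.
  elim: j => [|j ih]; first by rewrite mulr0 addr0 expr0.
  have j0 : 0 <= j%:R :> R by exact: ler0n.
  have := mulr_ge0 (mulr_ge0 (ltW e0) (ltW e0)) j0.
  have := ler_wpM2l (ltW (lt_trans ltr01 x1)) ih.
  by rewrite exprS -natr1; lra.
have /andP[_] := truncn_itv (divr_ge0 (normr_ge0 C) (ltW e0)).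
move: _.+1 => j; rewrite ltr_pdivrMr // mulrC => h1.
have h2 := le_lt_trans (ler_norm C) h1.
have := lt_le_trans h2 (le_trans _ (le_trans (bern j) (h j))).
by rewrite lerDr ler01 ltxx => /(_ isT).
Qed.

Section SelfSimilar.
Variables (R : archiRealFieldType) (n : nat) (P : R * R -> Prop) (f : 'I_n -> R * R -> R * R).
Variables (k A r : R) (z0 : R * R).
Hypotheses (k_gt0 : 0 < k) (k_le1 : k <= 1) (A_gt0 : 0 < A) (r_gt0 : 0 < r) (n_gt0 : (0 < n)%N).
Hypothesis box : forall z, P z -> [/\ 0 <= z.1, z.1 <= A, 0 <= z.2 & z.2 <= A].
Hypothesis disc : forall z, dist2 z z0 < r ^+ 2 -> P z.
Hypothesis sim : forall i p q, dist2 (f i p) (f i q) = k ^+ 2 * dist2 p q.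
Hypothesis surj : forall i z, exists z', f i z' = z.
Hypothesis parts : forall z, P z <-> exists i z', P z' /\ z = f i z'.
(** The interiors of the images are disjoint; intersections of two discs are open
    sets enough. *)
Hypothesis inner_disjoint : forall i i' p q x z, dist2 z p < x -> dist2 z q < x ->
  (forall u, dist2 u p < x -> dist2 u q < x ->
     (exists u', P u' /\ u = f i u') /\ (exists u', P u' /\ u = f i' u')) -> i = i'.

(** The tiles of level [j] are the images of [P] under the words of length [j]. *)
Let along (w : seq 'I_n) z := foldr f z w.

Lemma along_sim w p q : dist2 (along w p) (along w q) = (k ^+ size w) ^+ 2 * dist2 p q.
Proof.
elim: w => [|i w ih] /=; first by rewrite expr0 expr1n mul1r.
by rewrite sim ih mulrA [k ^+ (size w).+1]exprS exprMn.
Qed.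

Lemma along_in w z : P z -> P (along w z).
Proof. by move=> h; elim: w => [|i w ih] //=; apply/parts; exists i, (along w z). Qed.

Lemma inner_disc i w u : dist2 u (along (i :: w) z0) < (r * k ^+ (size w).+1) ^+ 2 ->
  exists u', P u' /\ u = f i u'.
Proof.
have k2 := exprn_gt0 2 k_gt0.
elim: w i u => [|j w ih] i u /=; have [u' <-] := surj i u; rewrite sim => h; exists u'.
  split=> //; apply: disc; move: h; rewrite expr1 exprMn mulrC.
  by rewrite ltr_pM2r.
split=> //; apply/parts; have [|u'' [h1 h2]] := ih j u'; last by exists j, u''.
by move: h; rewrite [k ^+ (size w).+2]exprS mulrCA exprMn ltr_pM2l.
Qed.

Lemma along_separated w w' : size w = size w' -> w <> w' ->
  (r * k ^+ size w) ^+ 2 <= dist2 (along w z0) (along w' z0).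
Proof.
elim: w w' => [|i w ih] [|i' w'] //= [e] ne; rewrite leNgt; apply/negP => h.
have k2 := exprn_gt0 2 k_gt0.
have ii : i = i'.
  apply: (inner_disjoint (p := along (i :: w) z0) (q := along (i' :: w') z0)
    (x := (r * k ^+ (size w).+1) ^+ 2) (z := along (i' :: w') z0)).
  - by rewrite dist2C.
  - by rewrite /dist2 !subrr expr0n addr0 exprn_gt0 ?mulr_gt0 ?exprn_gt0.
  move=> u h1 h2; split; [exact: inner_disc h1|apply: (inner_disc (w := w'))].
  by rewrite -e.
subst i'; have ww : w <> w' by move=> ew; apply: ne; rewrite ew.
move: h; rewrite sim [k ^+ (size w).+1]exprS mulrCA exprMn ltr_pM2l // => h.
by have := ih _ e ww; rewrite leNgt h.
Qed.

(** The centres of the [n ^ j] tiles of level [j] are [r k ^ j] apart, so a grid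
    of cells of half this size separates them. *)
Lemma packing j : (n%:R * k ^+ 2) ^+ j <= ((2 * A + r) / r) ^+ 2.
Proof.
pose d := r * k ^+ j; have d0 : 0 < d by rewrite mulr_gt0 ?exprn_gt0.
have P0 : P z0 by apply: disc; rewrite /dist2 !subrr expr0n addr0 exprn_gt0.
pose m := Num.truncn (2 * A / d).
pose cell x := inord (Num.truncn (x * 2 / d)) : 'I_m.+1.
have cellE x : 0 <= x -> x <= A -> (cell x)%:R <= x * 2 / d < (cell x)%:R + 1.
  move=> x0 xA; have y0 : 0 <= x * 2 / d by apply: divr_ge0; [apply: mulr_ge0|exact: ltW].
  rewrite /cell inordK; last first.
    by rewrite ltnS /m; apply: le_truncn; rewrite ler_pM2r ?invr_gt0 //; lra.
  by rewrite natr1; exact: truncn_itv.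
pose g (w : j.-tuple 'I_n) := (cell (along w z0).1, cell (along w z0).2).
have gi : injective g.
  move=> w w' [e1 e2]; apply: contrapT => ne.
  have [x1 x2 y1 y2] := box (along_in w P0); have [x1' x2' y1' y2'] := box (along_in w' P0).
  have := @along_separated w w'; rewrite !size_tuple => /(_ erefl) h.
  have {}h : d ^+ 2 <= dist2 (along w z0) (along w' z0) by apply: h => e; apply: ne; exact: val_inj.
  move: h; rewrite leNgt => /negP; apply.
  have close x x' : 0 <= x -> x <= A -> 0 <= x' -> x' <= A -> cell x = cell x' ->
      (x - x') ^+ 2 < (d / 2) ^+ 2.
    move=> h1 h2 h3 h4 e; have := cellE _ h1 h2; have := cellE _ h3 h4; rewrite e.
    move: (_%:R) => v; rewrite !ler_pdivlMr // !ltr_pdivrMr // => /andP[h5 h6] /andP[h7 h8].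
    by rewrite -subr_gt0 subr_sqr mulr_gt0 //; lra.
  have := close _ _ x1 x2 x1' x2' e1.
  have := close _ _ y1 y2 y1' y2' e2.
  have := exprn_gt0 2 d0; rewrite /dist2 !expr2; lra.
have := leq_card g gi; rewrite card_tuple card_prod !card_ord => h.
have {}h : (n ^ j)%:R <= (m.+1%:R) ^+ 2 :> R by rewrite -natrX ler_nat expnS expn1.
have mE : m.+1%:R <= (2 * A + r) / d.
  have /andP[+ _] := truncn_itv (divr_ge0 (mulr_ge0 (ler0n R 2) (ltW A_gt0)) (ltW d0)).
  rewrite -/m ler_pdivlMr // => h1; rewrite -natr1 ler_pdivlMr // mulrDl mul1r.
  apply: lerD => //.
  by rewrite /d -{2}(mulr1 r) ler_pM2l // exprn_ile1 // ltW.
have := le_trans h (ler_pM (ler0n _ _) (ler0n _ _) mE mE).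
rewrite natrX -expr2 => h'; rewrite exprMn -exprM mulnC exprM.
have kj : 0 < k ^+ j by rewrite exprn_gt0.
apply: le_trans (ler_wpM2r (sqr_ge0 (k ^+ j)) h') _.
by rewrite -exprMn /d invfM mulrA divfK // gt_eqF.
Qed.

Lemma along_onto j z : P z -> exists (w : j.-tuple 'I_n) z', P z' /\ z = along w z'.
Proof.
elim: j z => [|j ih] z Pz; first by exists [tuple], z.
have /parts[i [z' [h1 ->]]] := Pz; have [w [z'' [h2 ->]]] := ih _ h1.
by exists [tuple of i :: w], z''.
Qed.

(** A square grid in the disc whose mesh exceeds the diameter of the tiles of
    level [j] has no two nodes in one of them. *)
Lemma covering j : (n%:R * k ^+ 2)^-1 ^+ j <= 4 * (2 * A) ^+ 2 / (r / 2) ^+ 2.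
Proof.
pose e := 2 * A * k ^+ j; have e0 : 0 < e by rewrite !mulr_gt0 ?exprn_gt0.
pose L := r / 2; have L0 : 0 < L by rewrite divr_gt0.
pose m := Num.truncn (L / e); have := truncn_itv (divr_ge0 (ltW L0) (ltW e0)).
rewrite -/m ler_pdivlMr // ltr_pdivrMr // => /andP[mL Lm].
pose node (p : 'I_m * 'I_m) := (z0.1 + p.1%:R * e, z0.2 + p.2%:R * e).
have nodeP p : P (node p).
  apply: disc; rewrite /dist2 /node /= !(addrC _.1) !(addrC _.2) !addrK.
  have small (q : 'I_m) : (q%:R * e) ^+ 2 <= L ^+ 2.
    rewrite -subr_ge0 subr_sqr mulr_ge0 ?subr_ge0 //; last first.
      by apply: addr_ge0; [exact: ltW|apply: mulr_ge0 => //; exact: ltW].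
    by apply: le_trans mL; rewrite ler_pM2r // ler_nat ltnW.
  have := small p.1; have := small p.2; have := exprn_gt0 2 r_gt0.
  by rewrite /L !expr2; lra.
have [g gP] := boolp.choice (fun p => along_onto j (nodeP p)).
have gi : injective g.
  move=> p q; have [z [Pz hz]] := gP p; have [z' [Pz' hz']] := gP q => E.
  have : dist2 (node p) (node q) < e ^+ 2.
    rewrite hz hz' E along_sim size_tuple /e mulrC exprMn ltr_pM2r ?exprn_gt0 //.
    have [x1 x2 y1 y2] := box Pz; have [x1' x2' y1' y2'] := box Pz'.
    have sq x x' : 0 <= x -> x <= A -> 0 <= x' -> x' <= A -> (x - x') ^+ 2 <= A ^+ 2.
      by move=> *; rewrite -subr_ge0 subr_sqr mulr_ge0 //; lra.
    have := sq _ _ x1 x2 x1' x2'; have := sq _ _ y1 y2 y1' y2'; have := exprn_gt0 2 A_gt0.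
    by rewrite /dist2 !expr2; lra.
  rewrite /dist2 /node /= => h.
  have far (u v : 'I_m) : u != v -> e ^+ 2 <= (u%:R * e - v%:R * e) ^+ 2.
    move=> uv; rewrite -mulrBl [leRHS]exprMn -{1}(mul1r (e ^+ 2)) ler_pM2r ?exprn_gt0 //.
    have : (1 <= `|u%:Z - v%:Z|)%R by move: uv; rewrite -val_eqE /=; lia.
    rewrite -(ler_int R) intr_norm rmorphB /= -!pmulrn => h1.
    by rewrite -real_normK ?num_real // -{1}(expr1n _ 2) ler_pXn2r ?nnegrE.
  have dE (v x y : R) : v + x - (v + y) = x - y by ring.
  rewrite !dE in h; move: p q {hz hz' E} h => [u v] [u' v'] /= h.
  have [uu|/far h1] := eqVneq u u'; last first.
    by have := le_lt_trans h1 (le_lt_trans _ h); rewrite lerDl sqr_ge0 ltxx => /(_ isT).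
  have [vv|/far h1] := eqVneq v v'; first by rewrite uu vv.
  by have := le_lt_trans h1 (le_lt_trans _ h); rewrite lerDr sqr_ge0 ltxx => /(_ isT).
have := leq_card g gi; rewrite card_tuple card_prod !card_ord => h.
have nj : (0 < n ^ j)%N by rewrite expn_gt0 n_gt0.
have m2 : (m.+1 ^ 2 <= 4 * n ^ j)%N by rewrite expnS expn1; nia.
have {}m2 : (m.+1)%:R ^+ 2 <= 4 * n%:R ^+ j :> R by rewrite -!natrX -natrM ler_nat.
have h2 : L ^+ 2 <= 4 * (n%:R * k ^+ 2) ^+ j * (2 * A) ^+ 2.
  have h3 : L ^+ 2 <= (m.+1)%:R ^+ 2 * e ^+ 2.
    rewrite -exprMn ler_pXn2r // ?nnegrE; [exact: ltW|exact: ltW|exact: mulr_ge0 (ler0n _ _) (ltW e0)].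
  apply: le_trans h3 _; apply: le_trans (ler_wpM2r (sqr_ge0 e) m2) _.
  rewrite /e exprMn -exprM mulnC exprM [(n%:R * _) ^+ j]exprMn.
  by set u := k ^+ 2 ^+ j; set v := _ ^+ j; move: u v => u v; rewrite !expr2; lra.
have x0 : 0 < (n%:R * k ^+ 2) ^+ j by rewrite exprn_gt0 // mulr_gt0 ?exprn_gt0 ?ltr0n.
rewrite exprVn ler_pdivlMr ?exprn_gt0 // mulrC ler_pdivrMr //.
by move: h2; rewrite /L; lra.
Qed.

(** Packing bounds the powers of [n k ^ 2], and covering those of its inverse. *)
Lemma dissection_ratio : n%:R * k ^+ 2 = 1.
Proof.
have x0 : 0 < n%:R * k ^+ 2 by rewrite mulr_gt0 ?exprn_gt0 ?ltr0n.
apply/le_anti/andP; split; first exact: le1_bounded_powers packing.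
by rewrite -invf_le1 //; exact: le1_bounded_powers covering.
Qed.

End SelfSimilar.

(** * From plane sets to frames *)

(** The images of the basis vectors, relative to that of the origin and divided by
    [k], are orthonormal, and the distances to the three images determine the
    coordinates of any other one. *)
Lemma similarity_frame (R : realFieldType) (k : R) (f : R * R -> R * R) : 0 < k ->
  (forall p q, dist2 (f p) (f q) = k ^+ 2 * dist2 p q) ->
  exists g : frame R, okf g /\ forall z, f z = (k * px g z.1 z.2, k * py g z.1 z.2).
Proof.
move=> k0 sim; have kn : k != 0 by rewrite gt_eqF.
pose h z : R * R := (((f z).1 - (f (0, 0)).1) / k, ((f z).2 - (f (0, 0)).2) / k).
have hs p q : dist2 (h p) (h q) = dist2 p q.
  apply: (mulfI (expf_neq0 2 kn)); rewrite -(sim p q) /dist2 /h /=; field.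
  by [].
have h0 : h (0, 0) = (0, 0) by rewrite /h !subrr !mul0r.
have fE z : f z = (k * (h z).1 + (f (0, 0)).1, k * (h z).2 + (f (0, 0)).2).
  by rewrite /h /= !(mulrC k) !divfK // !subrK -surjective_pairing.
clearbody h; pose p := (h (1, 0)).1; pose q := (h (1, 0)).2.
pose u := (h (0, 1)).1; pose v := (h (0, 1)).2.
have e1 := hs (1, 0) (0, 0); have e2 := hs (0, 1) (0, 0); have e3 := hs (1, 0) (0, 1).
rewrite h0 in e1 e2; rewrite /dist2 /= -/p -/q -/u -/v !expr2 in e1 e2 e3.
have {}e1 : p * p + q * q = 1 by lra.
have {}e2 : u * u + v * v = 1 by lra.
have {}e3 : p * u + q * v = 0 by lra.
pose e := p * v - q * u.
have ee : e * e = 1.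
  have -> : e * e = (p * p + q * q) * (u * u + v * v) - (p * u + q * v) * (p * u + q * v).
    by rewrite /e; ring.
  by rewrite e1 e2 e3 mulr1 mul0r subr0.
have uE : u = - (e * q).
  have -> : - (e * q) = (p * p + q * q) * u - p * (p * u + q * v) by rewrite /e; ring.
  by rewrite e1 e3 mul1r mulr0 subr0.
have vE : v = e * p.
  have -> : e * p = (p * p + q * q) * v - q * (p * u + q * v) by rewrite /e; ring.
  by rewrite e1 e3 mul1r mulr0 subr0.
exists (Frame ((f (0, 0)).1 / k) ((f (0, 0)).2 / k) p q e); split=> // z.
have d0 := hs z (0, 0); have d1 := hs z (1, 0); have d2 := hs z (0, 1).
rewrite h0 in d0; rewrite /dist2 /= -/p -/q -/u -/v !expr2 in d0 d1 d2.
rewrite (fE z); move: d0 d1 d2; move: (h z) => [x y] /= d0 d1 d2.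
have dx : x * p + y * q = z.1 by lra.
have dy : x * u + y * v = z.2 by lra.
rewrite /px /py /= -dx -dy uE vE.
have px : p * (x * p + y * q) - e * q * (x * - (e * q) + y * (e * p)) = x.
  transitivity (x * (p * p) + x * (q * q) * (e * e) + p * q * y * (1 - e * e)); first by ring.
  by rewrite ee subrr mulr0 addr0 mulr1 -mulrDr e1 mulr1.
have py : q * (x * p + y * q) + e * p * (x * - (e * q) + y * (e * p)) = y.
  transitivity (y * (q * q) + y * (p * p) * (e * e) + p * q * x * (1 - e * e)); first by ring.
  by rewrite ee subrr mulr0 addr0 mulr1 -mulrDr addrC e1 mulr1.
by congr pair; rewrite -?addrA ?px ?py mulrDr mulrCA divff // mulr1 addrC // addrA px.
Qed.

Section Hull.
Local Open Scope classical_set_scope.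
Variable R : realType.
Implicit Types (x y s c a t : R).

Lemma convex_segment (A : set (plane R)) (p q : plane R) t : convex_set A -> A p -> A q ->
  0 <= t -> t <= 1 -> A (t * p.1 + (1 - t) * q.1, t * p.2 + (1 - t) * q.2).
Proof.
move=> cA Ap Aq t0 t1; have := cA p q (Itv01 t0 t1); rewrite !inE => /(_ Ap Aq).
by [].
Qed.

(** A point of the trapezoid is on a horizontal segment whose ends are on the two
    legs. *)
Lemma hull_trap s c a : 0 < s -> 0 < c -> 0 < a ->
  @convex_hull R [set (0, 0); (a + c, 0); (a, s); (0, s)] =
  [set z : plane R | trap s c a z.1 z.2].
Proof.
move=> s0 c0 a0; apply/seteqP; split.
  apply: smallest_sub.
    move=> p q l; rewrite !inE /= /trap => /and4P[h1 h2 h3 h4] /and4P[h5 h6 h7 h8].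
    have t0 : 0 <= l%:num by [].
    have t1 : 0 <= 1 - l%:num by rewrite subr_ge0.
    have scE (u v : R) : u *: (v : R^o) = u * v by [].
    rewrite /unstable.onem !scE; move: (l%:num) t0 t1 => t t0 t1.
    apply/and4P; split.
    - by rewrite addr_ge0 ?mulr_ge0.
    - by have := ler_wpM2l t0 h2; have := ler_wpM2l t1 h6; lra.
    - by rewrite addr_ge0 ?mulr_ge0.
    - by have := ler_wpM2l t0 h4; have := ler_wpM2l t1 h8; lra.
  have sc := mulr_gt0 s0 c0; have sa := mulr_gt0 s0 a0.
  by move=> z [[[->|->]|->]|->]; rewrite /= /trap; apply/and4P; split; lra.
move=> [x y] /= /and4P[/= y0 ys x0 xy] A [cA VA].
pose t := y / s; have t0 : 0 <= t by rewrite divr_ge0 // ltW.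
have t1 : t <= 1 by rewrite ler_pdivrMr // mul1r.
have yE : y = t * s by rewrite divfK ?gt_eqF.
have A1 : A (0, y).
  have := convex_segment cA (VA (0, s) _) (VA (0, 0) _) t0 t1; rewrite /= !mulr0 !addr0 -yE.
  by apply; [right|left; left; left].
pose r := a + (1 - t) * c; have r0 : 0 < r by rewrite ltr_pwDl // mulr_ge0 ?subr_ge0 // ltW.
have A2 : A (r, y).
  have := convex_segment cA (VA (a, s) _) (VA (a + c, 0) _) t0 t1; rewrite /= !mulr0 !addr0 -yE.
  have -> : t * a + (1 - t) * (a + c) = r by rewrite /r; ring.
  by apply; [left; right|left; left; right].
have v0 : 0 <= x / r by rewrite divr_ge0 // ltW.
have v1 : x / r <= 1.
  rewrite ler_pdivrMr // mul1r -(ler_pM2r s0).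
  by move: xy; rewrite /r {1}yE; lra.
have := convex_segment cA A2 A1 v0 v1; rewrite /= mulr0 addr0 divfK ?gt_eqF //.
by rewrite -mulrDl addrCA subrr addr0 mul1r.
Qed.

End Hull.

Section Interiors.
Local Open Scope classical_set_scope.
Variable R : realType.
Implicit Types (p q u z : plane R) (x y : R).

Lemma disc_open p x : open [set u : plane R | dist2 u p < x].
Proof.
have ct : continuous (fun u : plane R => dist2 u p : R^o).
  move=> u; rewrite /dist2; apply: cvgD; rewrite expr2.
    by apply: cvgM; apply: cvgB; [exact: cvg_fst|exact: cvg_cst|exact: cvg_fst|exact: cvg_cst].
  by apply: cvgM; apply: cvgB; [exact: cvg_snd|exact: cvg_cst|exact: cvg_snd|exact: cvg_cst].
rewrite (_ : [set u | _] = (fun u : plane R => dist2 u p : R^o) @^-1` [set v | v < x]) //.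
by apply: open_comp => [u _|]; [exact: ct|exact: open_lt].
Qed.

(** Discs are open, so the two interiors have the point [z] in common. *)
Lemma disc_disjoint (I : Type) (A : set (plane R)) (T : I -> set (plane R)) i j p q x y z :
  dissection A T -> (forall u, dist2 u p < x -> T i u) -> (forall u, dist2 u q < y -> T j u) ->
  dist2 z p < x -> dist2 z q < y -> i = j.
Proof.
move=> [_ tT] hi hj zp zq; apply: (tT i j) => //; exists z; split.
  by have := hi; rewrite -/([set u : plane R | dist2 u p < x] `<=` T i) (open_subsetE _ (@disc_open p x)); exact.
by have := hj; rewrite -/([set u : plane R | dist2 u q < y] `<=` T j) (open_subsetE _ (@disc_open q y)); exact.
Qed.

End Interiors.

Section Strict.
Variable R : realFieldType.

Lemma strap_disc (s c a x y : R) : s <= 1 -> c <= 1 -> 0 < s -> 0 < c -> strap s c a x y ->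
  exists2 r, 0 < r & forall u, dist2 u (x, y) < r ^+ 2 -> trap s c a u.1 u.2.
Proof.
move=> s1 c1 s0 c0 /and4P[h1 h2 h3 h4].
pose m := ((a + c) * s - (x * s + y * c)) / 2.
pose r := Num.min (Num.min y (s - y)) (Num.min x m).
have m0 : 0 < m by rewrite divr_gt0 ?subr_gt0.
have r0 : 0 < r by rewrite !lt_min h1 h3 m0 subr_gt0 h2.
exists r => // -[u v]; rewrite /dist2 /= => h.
have : r <= r by []. rewrite {2}/r !le_min => /andP[/andP[r1 r2] /andP[r3 r4]].
have bd w w' : 0 <= w' ^+ 2 -> w ^+ 2 + w' ^+ 2 < r ^+ 2 -> - r < w /\ w < r.
  move=> hw h'; have : `|w| < r.
    by rewrite -(ltr_pXn2r (n := 2)) ?nnegrE ?normr_ge0 ?ltW // real_normK ?num_real //; lra.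
  by rewrite ltr_norml => /andP.
have [b1 b2] := bd _ _ (sqr_ge0 _) h.
rewrite addrC in h; have [b3 b4] := bd _ _ (sqr_ge0 _) h.
apply/and4P; split; try lra.
have := ler_wpM2r (ltW s0) (ltW b2); have := ler_wpM2r (ltW c0) (ltW b4).
have := ler_wpM2l (ltW r0) s1; have := ler_wpM2l (ltW r0) c1.
by move: r4; rewrite /m; lra.
Qed.

(** By convexity, a segment towards an interior point is interior from the start. *)
Lemma trap_to_strap (s c a x y x0 y0 t : R) : 0 < t -> t <= 1 -> trap s c a x y -> strap s c a x0 y0 ->
  strap s c a (x + t * (x0 - x)) (y + t * (y0 - y)).
Proof.
move=> t0 t1 /and4P[h1 h2 h3 h4] /and4P[h5 h6 h7 h8].
have t1' : 0 <= 1 - t by rewrite subr_ge0.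
apply/and4P; split.
- by have := ler_wpM2l t1' h1; have := mulr_gt0 t0 h5; lra.
- by have := ler_wpM2l t1' h2; rewrite -(ltr_pM2l t0) in h6; lra.
- by have := ler_wpM2l t1' h3; have := mulr_gt0 t0 h7; lra.
- by have := ler_wpM2l t1' h4; rewrite -(ltr_pM2l t0) in h8; lra.
Qed.

Lemma strap_center (s c a : R) : 0 < s -> 0 < c -> 0 < a -> strap s c a (a / 2) (s / 2).
Proof.
move=> h1 h2 h3; have h4 := mulr_gt0 h1 h2; have h5 := mulr_gt0 h1 h3.
by apply/and4P; split; lra.
Qed.

Lemma px_invK (f : frame R) x y : okf f -> px (invf f) (px f x y) (py f x y) = x.
Proof.
case: f => [u v p q e] [/= h1 h2]; rewrite /invf /px /py /=.
have h3 : p * p = 1 - q * q by rewrite -h1 addrK.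
by ring: h2 h3.
Qed.

Lemma py_invK (f : frame R) x y : okf f -> py (invf f) (px f x y) (py f x y) = y.
Proof.
case: f => [u v p q e] [/= h1 h2]; rewrite /invf /px /py /=.
have h3 : p * p = 1 - q * q by rewrite -h1 addrK.
by ring: h2 h3.
Qed.

End Strict.

Section Core.
Local Open Scope classical_set_scope.
Variables (R : realType) (s c a k : R) (n : nat) (f : 'I_n -> plane R -> plane R).
Hypotheses (s_gt0 : 0 < s) (c_gt0 : 0 < c) (a_gt0 : 0 < a) (sc1 : s * s + c * c = 1).
Hypotheses (k_gt0 : 0 < k) (n_gt1 : (1 < n)%N).
Hypothesis sim : forall i p q, dist2 (f i p) (f i q) = k ^+ 2 * dist2 p q.
Let A := [set z : plane R | trap s c a z.1 z.2].
Hypothesis dis : dissection A (fun i => f i @` A).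

Lemma tile_frames : exists g : 'I_n -> frame R, forall i, okf (g i) /\
  forall z, f i z = (k * px (g i) z.1 z.2, k * py (g i) z.1 z.2).
Proof.
have h i := similarity_frame k_gt0 (sim i).
have [g gP] := boolp.choice h; exists g => i; exact: gP.
Qed.

Lemma parts z : A z <-> exists i z', A z' /\ z = f i z'.
Proof.
have [E _] := dis; split=> [h|[i [z' [h ->]]]].
  have : (\bigcup_i (f i @` A)) z by rewrite E.
  by move=> [i _ [z' h' <-]]; exists i, z'.
have : (\bigcup_i (f i @` A)) (f i z') by exists i => //; exists z'.
by rewrite E.
Qed.

Lemma surj i z : exists z', f i z' = z.
Proof.
have [g gP] := tile_frames; have [go gE] := gP i.
exists (px (invf (g i)) (z.1 / k) (z.2 / k), py (invf (g i)) (z.1 / k) (z.2 / k)).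
by rewrite gE /= px_inv // py_inv // !(mulrC k) !divfK ?gt_eqF // -surjective_pairing.
Qed.

Lemma legs_lt1 : s < 1 /\ c < 1.
Proof.
have := sc1; have := mulr_gt0 s_gt0 s_gt0; have := mulr_gt0 c_gt0 c_gt0.
move: (s_gt0) (c_gt0) => h1 h2 h3 h4 h5.
by split; rewrite ltNge; apply/negP => h; have := ler_pM ler01 ler01 h h; lra.
Qed.

Lemma in_box z : A z -> [/\ 0 <= z.1, z.1 <= a + c, 0 <= z.2 & z.2 <= a + c + s].
Proof.
move=> /and4P[h1 h2 h3 h4]; split=> //; last by move: (a_gt0) (c_gt0) => ? ?; lra.
rewrite -(ler_pM2r s_gt0); apply: le_trans h4; rewrite lerDl.
by apply: mulr_ge0 => //; exact: ltW.
Qed.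

(** The diagonal from [(0, s)] to [(a + c, 0)] is also one of the bounding box, so
    that its image by an enlarging map would not fit. *)
Lemma ratio_le1 : k <= 1.
Proof.
have i : 'I_n := Ordinal (ltnW n_gt1).
have s0 := s_gt0; have c0 := c_gt0; have a0 := a_gt0.
have sc := mulr_gt0 s0 c0; have sa := mulr_gt0 s0 a0.
have A1 : A (0, s) by apply/and4P; split=> /=; lra.
have A2 : A (a + c, 0) by apply/and4P; split=> /=; lra.
have B z : A z -> A (f i z) by move=> h; apply/parts; exists i, z.
have /and4P[h1 h2 h3 h4] := B _ A1; have /and4P[h5 h6 h7 h8] := B _ A2.
have [_ h9 _ _] := in_box (B _ A1); have [_ h10 _ _] := in_box (B _ A2).
have sq (x x' m : R) : 0 <= x -> x <= m -> 0 <= x' -> x' <= m -> (x - x') ^+ 2 <= m ^+ 2.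
  by move=> *; rewrite -subr_ge0 subr_sqr mulr_ge0 //; lra.
have := lerD (sq _ _ _ h3 h9 h7 h10) (sq _ _ _ h1 h2 h5 h6).
rewrite -/(dist2 _ _) sim /dist2 /= sub0r subr0 sqrrN => h.
have d0 : 0 < (a + c) ^+ 2 + s ^+ 2 by rewrite addr_gt0 ?exprn_gt0 ?addr_gt0.
by move: h; rewrite ger_pMl // expr_le1 // ltW.
Qed.

Lemma ratio : n%:R * k ^+ 2 = 1.
Proof.
have [s1 c1] := legs_lt1.
have [r r0 rP] := strap_disc (ltW s1) (ltW c1) s_gt0 c_gt0 (strap_center s_gt0 c_gt0 a_gt0).
apply: (@dissection_ratio R n A f k (a + c + s) r (a / 2, s / 2)) => //.
- exact: ratio_le1.
- by rewrite !addr_gt0.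
- exact: ltnW.
- move=> z /in_box[h1 h2 h3 h4]; split=> //; apply: le_trans h2 _; rewrite lerDl; exact: ltW.
- exact: surj.
- exact: parts.
move=> i i' p q x z zp zq h.
pose U := [set u : plane R | dist2 u p < x] `&` [set u | dist2 u q < x].
have oU : open U by apply: openI; exact: disc_open.
have [_ tr] := dis; apply: (tr i i') => //; exists z; split.
  suff : U `<=` f i @` A by rewrite open_subsetE //; exact.
  by move=> u [h1 h2]; have [[u' [h3 ->]] _] := h u h1 h2; exists u'.
suff : U `<=` f i' @` A by rewrite open_subsetE //; exact.
by move=> u [h1 h2]; have [_ [u' [h3 ->]]] := h u h1 h2; exists u'.
Qed.

Lemma inner_disc_tile i z : strap s c a z.1 z.2 ->
  exists2 r, 0 < r & forall u, dist2 u (f i z) < r -> (f i @` A) u.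
Proof.
move=> h; have [s1 c1] := legs_lt1.
have [r r0 rP] := strap_disc (ltW s1) (ltW c1) s_gt0 c_gt0 h.
exists (k ^+ 2 * r ^+ 2); first by rewrite mulr_gt0 ?exprn_gt0.
move=> u; have [u' <-] := surj i u; rewrite sim ltr_pM2l ?exprn_gt0 // => h'.
by exists u' => //; apply: rP; rewrite -surjective_pairing.
Qed.

(** Moved slightly towards the centre of its tile, the common point is inside both
    tiles. *)
Lemma strict_disjoint i j z z' : strap s c a z.1 z.2 -> A z' -> f i z = f j z' -> i = j.
Proof.
move=> zi zj e; have [r r0 rP] := inner_disc_tile i zi.
pose z0 : plane R := (a / 2, s / 2).
have /ev_ex[t t0 [t1 t2]] := ev_and (ev_lt (@ltr01 R))
  (ev_quad_pos (k' := r) (l' := 0) (- (k ^+ 2 * dist2 z0 z')) (or_introl r0)).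
pose w : plane R := (z'.1 + t * (z0.1 - z'.1), z'.2 + t * (z0.2 - z'.2)).
have wS : strap s c a w.1 w.2.
  exact: (trap_to_strap t0 (ltW t1) zj (strap_center s_gt0 c_gt0 a_gt0)).
have [r' r0' rP'] := inner_disc_tile j wS.
apply: (disc_disjoint (z := f j w) dis rP rP').
  rewrite e sim; have -> : dist2 w z' = t ^+ 2 * dist2 z0 z' by rewrite /dist2 /w /=; ring.
  by move: t2; lra.
by rewrite /dist2 !subrr expr0n addr0.
Qed.

Let N := k^-1.

(** Enlarged by [N = 1 / k], the dissection is one of the large trapezoid into unit
    copies, where [N ^ 2 = n]. *)
Lemma core : [/\ ~ (forall x y z : int, z != 0 -> z%:~R * c <> x%:~R + y%:~R * s),
  2 * c = 1 -> a \in [:: 1; 1 / 2; 1 / 4; 1 / 6; 1 / 8] & c = s -> a = c].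
Proof.
have [g gP] := tile_frames.
pose T i x y := trap s c a (px (invf (g i)) x y) (py (invf (g i)) x y).
pose S i x y := strap s c a (px (invf (g i)) x y) (py (invf (g i)) x y).
have kn : k != 0 by rewrite gt_eqF.
have N2 : N ^+ 2 = n%:R.
  by apply: (mulIf (expf_neq0 2 kn)); rewrite ratio /N -exprMn mulVf // expr1n.
have N0 : 0 < N by rewrite invr_gt0.
have N1 : 1 < N by rewrite -(ltr_pXn2r (n := 2)) ?nnegrE ?ltW // N2 expr1n ltr1n.
have tl i : tile s c a (T i) (S i).
  by exists (invf (g i)); split; [apply: okf_inv; case: (gP i)|].
pose pre i x y : plane R := (px (invf (g i)) x y, py (invf (g i)) x y).
have preE i x y : f i (pre i x y) = (k * x, k * y).
  by have [go gE] := gP i; rewrite gE /= px_inv // py_inv.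
have dj i j x y : S i x y -> T j x y -> i = j.
  move=> h1 h2; apply: (@strict_disjoint i j (pre i x y) (pre j x y)) => //.
  by rewrite !preE.
have cv x y : trap s c a (x / N) (y / N) <-> exists i, T i x y.
  rewrite /N invrK !(mulrC _ k); split=> [h|[i h]].
    have /parts[i [[x' y'] [h1 h2]]] : A (k * x, k * y) by [].
    exists i; have [go gE] := gP i; move: h2; rewrite gE /= => -[e1 e2].
    by rewrite /T (mulfI kn e1) (mulfI kn e2) px_invK // py_invK.
  by rewrite -[X in trap _ _ _ X _]/((k * x, k * y).1) -[X in trap _ _ _ _ X]/((k * x, k * y).2) -(preE i); apply/(parts (f i (pre i x y))); exists i, (pre i x y).
split.
- exact: (independent_case s_gt0 c_gt0 a_gt0 sc1 N1 tl dj cv N2).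
- exact: (third_case s_gt0 c_gt0 a_gt0 sc1 N1 tl dj cv N2).
- exact: (quarter_case s_gt0 c_gt0 a_gt0 sc1 N1 tl dj cv N2).
Qed.

End Core.

(** * The theorem *)

Section Angles.
Variable R : realType.
Implicit Types (t : R).
Local Open Scope complex_scope.

Lemma de_moivre t m : (cos t +i* sin t) ^+ m = cos (m%:R * t) +i* sin (m%:R * t).
Proof.
elim: m => [|m ih]; first by rewrite expr0 mul0r cos0 sin0.
rewrite exprS ih -natr1 mulrDl mul1r addrC cosD sinD.
by apply/eqP; rewrite eq_complex /=; apply/andP; split; apply/eqP; ring.
Qed.

Lemma rational_angle_unity t (q : rat) : 0 < t -> t / pi = ratr q ->
  exists2 m, (0 < m)%N & (cos t +i* sin t) ^+ m = 1.
Proof.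
move=> t0 tq; have p0 : 0 < pi :> R := pi_gt0 R.
exists (2 * `|denq q|)%N; first by rewrite muln_gt0 absz_gt0 denq_neq0.
have q0 : 0 < q by rewrite -(ltr_rat R) rmorph0 -tq divr_gt0.
have e : (2 * `|denq q|)%N%:R * t = (`|numq q|%N)%:R * (pi *+ 2).
  rewrite natrM !natr_absz !intr_norm !gtr0_norm ?ltr0z ?denq_gt0 ?numq_gt0 //.
  have tE : t = ratr q * pi by rewrite -tq divfK // gt_eqF.
  rewrite tE -{2}(divq_num_den q) fmorph_div /= !ratr_int; field.
  by rewrite intr_eq0 denq_neq0.
rewrite de_moivre e; elim: (`|numq q|%N) => [|j]; first by rewrite mul0r cos0 sin0.
by rewrite -natr1 mulrDl mul1r cosD2pi sinD2pi.
Qed.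

(** The value [-1] at [pi = 3 (pi / 3)] is a cubic equation for the cosine, with the
    roots [-1] and, twice, 1/2. *)
Lemma cos_pi3 : 2 * cos (pi / 3) = 1 :> R.
Proof.
have p0 : 0 < pi :> R := pi_gt0 R.
set t : R := pi / 3; have t3 : t + (t + t) = pi by rewrite /t; field.
have : 0 < cos t by apply: cos_gt0_pihalf; rewrite /t; apply/andP; split; lra.
have := cospi R; rewrite -t3 cosD cosD sinD; have := cos2Dsin2 t.
move: (cos t) (sin t) => c s; rewrite !expr2 => sc h c0.
have : (c + 1) * ((2 * c - 1) * (2 * c - 1)) = 0.
  have {}h : c * (c * c - s * s) - s * (s * c + c * s) = -1 by [].
  have e : s * s = 1 - c * c by lra.
  have : c * (c * c - s * s) - 2 * (s * s) * c = -1 by lra.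
  by rewrite e; lra.
move/eqP; rewrite !mulf_eq0 orbb => /orP[] /eqP; lra.
Qed.

Lemma angle_pi3 t : 0 < t -> t < pi / 2 -> 2 * cos t = 1 -> t = pi / 3.
Proof.
move=> t0 t1 h; have p0 : 0 < pi :> R := pi_gt0 R; have := cos_pi3 => h'.
apply: cos_inj; rewrite ?in_itv /=; [apply/andP; split; lra|apply/andP; split; lra|lra].
Qed.

Lemma angle_pi4 t : 0 < t -> t < pi / 2 -> cos t = sin t -> t = pi / 4.
Proof.
move=> t0 t1 h; have p0 : 0 < pi :> R := pi_gt0 R.
have : t = pi / 2 - t; last by lra.
apply: cos_inj; rewrite ?in_itv /=; [apply/andP; split; lra|apply/andP; split; lra|].
by rewrite cosB cos_pihalf sin_pihalf mul0r add0r mul1r.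
Qed.

End Angles.

Theorem theorem3p6 (R : realType) (theta a : R)
    (theta_gt0 : 0 < theta) (theta_lt : theta < pi / 2) (a_gt0 : 0 < a)
    (reptile_R : reptile (right_trapezoid theta a))
    (theta_rat : exists q : rat, theta / pi = ratr q) :
  (theta, a) \in [:: (pi / 4, 1 / Num.sqrt 2); (pi / 3, 1); (pi / 3, 1 / 2);
                     (pi / 3, 1 / 4); (pi / 3, 1 / 6); (pi / 3, 1 / 8)].
Proof.
have p0 : 0 < pi :> R := pi_gt0 R.
have s0 : 0 < sin theta by apply: sin_gt0_pihalf; rewrite theta_gt0.
have c0 : 0 < cos theta by apply: cos_gt0_pihalf; rewrite theta_lt andbT; lra.
have sc : sin theta * sin theta + cos theta * cos theta = 1.
  by rewrite -!expr2 addrC cos2Dsin2.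
have distE k f : similarity k f -> 0 < k /\ forall p q : plane R, dist2 (f p) (f q) = k ^+ 2 * dist2 p q.
  move=> [k0 h]; split=> // p q; have := congr1 (fun x => x ^+ 2) (h p q).
  by rewrite /euclid_dist exprMn !sqr_sqrtr // addr_ge0 ?sqr_ge0.
case: reptile_R => n n2 [T [dis sm cg]].
have [k [f0 [/distE[k0 f0E] T0]]] := sm (Ordinal n2).
have [g gP] := boolp.choice (cg (Ordinal n2)).
have fE i p q : dist2 (g i (f0 p)) (g i (f0 q)) = k ^+ 2 * dist2 p q.
  by have [/distE[_ gE] _] := gP i; rewrite gE expr1n mul1r f0E.
rewrite /right_trapezoid hull_trap // in dis T0.
have {}dis : dissection [set z : plane R | trap (sin theta) (cos theta) a z.1 z.2]%classic
    (fun i => (fun p => g i (f0 p)) @` [set z : plane R | trap (sin theta) (cos theta) a z.1 z.2])%classic.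
  suff -> : (fun i => (fun p => g i (f0 p)) @` [set z : plane R | trap (sin theta) (cos theta) a z.1 z.2])%classic = T by [].
  by apply: funext => i; have [_ ->] := gP i; rewrite T0 image_comp.
have [ind third quarter] := core s0 c0 a_gt0 sc k0 n2 fE dis.
have [[x [y [z [z0 e]]]]|no] := EM (exists x y z : int, z != 0 /\ z%:~R * cos theta = x%:~R + y%:~R * sin theta); last first.
  by case: ind => x y z z0 e; apply: no; exists x, y, z.
have [q tq] := theta_rat; have [m m0 wm] := rational_angle_unity theta_gt0 tq.
have zR : z%:~R != 0 :> R by rewrite intr_eq0.
have cE : cos theta = ratr (x%:~R / z%:~R) + ratr (y%:~R / z%:~R) * sin theta.
  by rewrite !fmorph_div /= !ratr_int; apply: (mulfI zR); rewrite e; field.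
case: (dependent_angle m0 c0 s0 sc wm cE) => h.
  have := third h; rewrite (angle_pi3 _ _ h) // !inE !xpair_eqE !eqxx /=.
  by move=> ->; rewrite orbT.
have ac := quarter h; have tE := angle_pi4 theta_gt0 theta_lt h.
suff aE : a = 1 / Num.sqrt 2 by rewrite aE tE inE eqxx.
have q0 : 0 < Num.sqrt 2 :> R by rewrite sqrtr_gt0.
apply: (mulIf (lt0r_neq0 q0)); rewrite divfK ?gt_eqF //.
apply/eqP; rewrite -(eqrXn2 (n := 2)) // ?mulr_ge0 ?ltW // expr1n exprMn sqr_sqrtr //.
by apply/eqP; move: sc; rewrite -h ac expr2; lra.
Qed.
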